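(* Let $Q$ be a quiver with vertex set $I$ and edge set $E$, let $\mathbb{K}$ be a field of characteristic $0$, and let $q$ and $t_e$ ($e\in E$) be non-zero elements of $\mathbb{K}$. Let ${}_{\mathbb{K}}\mathcal{S}$ be the shuffle algebra over $\mathbb{K}$ and let ${}_{\mathbb{K}}\mathring{\mathcal{S}}\subseteq{}_{\mathbb{K}}\mathcal{S}$ be the subalgebra generated by Laurent polynomials in one variable, i.e. by $\{z_{i1}^d\}_{i\in I,d\in\mathbb{Z}}$ (where $z_{i1}^d$ lies in degree $\boldsymbol{\varsigma}_i$). Assume that there exists a field homomorphism $\rho:\mathbb{K}\to\mathbb{C}$ such that $|\rho(q)|<|\rho(t_e)|<1$ for all $e\in E$. Then ${}_{\mathbb{K}}\mathring{\mathcal{S}}={}_{\mathbb{K}}\mathcal{S}$.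
   Context: A quiver $Q$ is a finite oriented graph with vertex set $I$ and edge set $E$; edge loops and multiple edges are allowed. The notation $e=\overrightarrow{ij}$ means that $e$ is an edge from $i$ to $j$. The set $\mathbb{N}$ includes $0$. For $i\in I$, $\boldsymbol{\varsigma}_i\in\mathbb{N}^I$ has a single $1$ in position $i$ and zeroes elsewhere. Let ${}_{\mathbb{K}}\mathcal{V}=\bigoplus_{\boldsymbol{n}\in\mathbb{N}^I}\mathbb{K}[z_{i1}^{\pm1},\dots,z_{in_i}^{\pm1}]_{i\in I}^{\mathrm{sym}}$, where ''sym'' means symmetric in $z_{i1},\dots,z_{in_i}$ for each $i$ separately. For $i,j\in I$ put $$\zeta_{ij}(x)=\left(\frac{1-xq^{-1}}{1-x}\right)^{\delta_{ij}}\prod_{e=\overrightarrow{ij}\in E}(1-t_ex)\prod_{e=\overrightarrow{ji}\in E}\left(1-\frac{qx}{t_e}\right)$$ (a loop at $i=j$ contributes to both products). The shuffle product of $R$ of degree $\boldsymbol{n}$ and $R'$ of degree $\boldsymbol{n}'$ is $$R*R'=\mathrm{Sym}\left[\frac{R(\dots,z_{i1},\dots,z_{in_i},\dots)R'(\dots,z_{i,n_i+1},\dots,z_{i,n_i+n_i'},\dots)}{\prod_{i}n_i!\prod_i n_i'!}\prod_{i,j\in I}\ \prod_{1\le a\le n_i}\ \prod_{n_j<b\le n_j+n_j'}\zeta_{ij}\left(\frac{z_{ia}}{z_{jb}}\right)\right],$$ where Sym is the sum over all permutations of $z_{i1},\dots,z_{i,n_i+n_i'}$ for each $i$ separately. It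 makes ${}_{\mathbb{K}}\mathcal{V}$ an associative algebra. The shuffle algebra ${}_{\mathbb{K}}\mathcal{S}\subset{}_{\mathbb{K}}\mathcal{V}$ is the subalgebra of those symmetric Laurent polynomials $R$ such that $$\prod_{e=\overrightarrow{ij}}\left(z_{ia}-\frac{qz_{j1}}{t_e}\right)\prod_{e=\overrightarrow{ji}}(z_{ia}-t_ez_{j1})\quad\text{divides}\quad R\Big|_{z_{j2}=qz_{j1}}$$ (in the ring of Laurent polynomials) for all $i,j\in I$ and all $a$ such that $(i,a)\notin\{(j,1),(j,2)\}$.
   Formalization: The condition |ρ(q)| < 1 is required explicitly; it follows from the stated chain unless the quiver has no edges, where the claim as literally stated fails (one vertex, no edges, q = -1). *)

(* Defs.v *)
From HB Require Import structures.
From mathcomp Require Import all_boot all_order all_fingroup all_algebra.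
From mathcomp Require Import freeg mpoly.
From mathcomp Require Import reals complex.

Set Implicit Arguments.
Unset Strict Implicit.
Unset Printing Implicit Defensive.

Import GRing.Theory Num.Theory.
Local Open Scope ring_scope.

Record quiver := Quiver {
  vertex : finType;
  edge : finType;
  source : edge -> vertex;
  target : edge -> vertex
}.

(* In degree n, the variables z_{i1}, ..., z_{i n_i} are indexed by
   {i & 'I_(n i)}: all variable indices are 0-based, so the paper's z_{ia} is
   the variable of index a.-1 at the vertex i. *)
Definition zindex (I : finType) (n : I -> nat) : finType := {i : I & 'I_(n i)}.

Definition ratfun (K : fieldType) (I : finType) (n : I -> nat) : fieldType :=
  {fraction {mpoly K[#|zindex n|]}}.

Definition ratC (K : fieldType) (I : finType) (n : I -> nat) (c : K) :
  ratfun K n := tofrac (c%:MP).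

Definition var_perm (I : finType) (n : I -> nat) : finType :=
  {dffun forall i : I, 'S_(n i)}.

(* A point of the torus is a family x i a indexed by all a : nat, of which only
   the entries with a < n i matter in degree n. zperm s is the generic point
   with its coordinates permuted by s; the junk value 0 is used out of range. *)
Definition zperm (K : fieldType) (I : finType) (n : I -> nat)
    (s : var_perm n) (i : I) (a : nat) : ratfun K n :=
  if insub a is Some a' then
    tofrac 'X_(enum_rank (Tagged (fun j => 'I_(n j)) (s i a') : zindex n))
  else 0.

Definition zvar (K : fieldType) (I : finType) (n : I -> nat) :
  I -> nat -> ratfun K n := zperm K [ffun i => 1%g].

(* The direct sum over n of K[z_{i1}^{+-1}, ..., z_{i n_i}^{+-1}]_{i in I} as a
   free module. The basis element e : {ffun I -> seq int} is the Laurent monomial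
   \prod_i \prod_(a < size (e i)) z_{ia} ^ (e i)_a
   in degree n, where n i = size (e i). *)
Definition laurent (K : fieldType) (I : finType) : lmodType K :=
  {freeg {ffun I -> seq int} / K}.

(* Value at x of the component of F of degree k. *)
Definition leval (K : fieldType) (I : finType) (m k : I -> nat)
    (F : laurent K I) (x : I -> nat -> ratfun K m) : ratfun K m :=
  \sum_(e <- dom F | [forall i, size (e i) == k i])
    ratC m (coeff e F) * \prod_i \prod_(a < k i) x i a ^ (e i)`_a.

Definition symmetric_laurent (K : fieldType) (I : finType)
    (F : laurent K I) : Prop :=
  forall (n : I -> nat) (s : var_perm n),
    leval n F (zperm K s) = leval n F (@zvar K I n).

Section ShuffleAlgebra.
Context (K : fieldType) (Q : quiver) (q : K) (t : edge Q -> K).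
Let I := vertex Q.

Definition zeta (n : I -> nat) (i j : I) (x : ratfun K n) : ratfun K n :=
  ((1 - x * ratC n q^-1) / (1 - x)) ^+ (i == j)
  * \prod_(e : edge Q | (source e == i) && (target e == j))
      (1 - ratC n (t e) * x)
  * \prod_(e : edge Q | (source e == j) && (target e == i))
      (1 - ratC n q * x / ratC n (t e)).

(* The shuffle product, in degree m, of the component of F of degree k with the
   component of G of degree m - k. *)
Definition shuffle_component (m k : I -> nat) (F G : laurent K I) :
    ratfun K m :=
  \sum_(s : var_perm m)
    leval k F (zperm K s)
    * leval (fun i => m i - k i)%N G (fun i a => zperm K s i (k i + a)%N)
    / ((\prod_i (k i)`!) * (\prod_i (m i - k i)`!))%N%:R
    * \prod_i \prod_j \prod_(a < k i) \prod_(k j <= b < m j)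
        zeta i j (zperm K s i a / zperm K s j b).

(* P = F * G. The product is a priori a family of rational functions; its poles
   at z_{ia} = z_{ib} cancel in the symmetrization, so such a P exists, and it
   is determined by its values at the generic points. *)
Definition is_shuffle_product (F G P : laurent K I) : Prop :=
  forall m : I -> nat,
    leval m P (@zvar K I m) =
    \sum_(k : {dffun forall i : I, 'I_(m i).+1})
      shuffle_component m (fun i => k i : nat) F G.

Inductive generated_subalgebra (X : laurent K I -> Prop) :
    laurent K I -> Prop :=
| gen_mem F of X F : generated_subalgebra X F
| gen_one : generated_subalgebra X << [ffun=> [::]] >>
| gen_add F G of generated_subalgebra X F & generated_subalgebra X G :
    generated_subalgebra X (F + G)
| gen_scale c F of generated_subalgebra X F : generated_subalgebra X (c *: F)
| gen_mul F G P of generated_subalgebra X F & generated_subalgebra X G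
    & is_shuffle_product F G P : generated_subalgebra X P.

(* z_{i1}^d, in the degree with a single 1 at the position i *)
Definition zpow (i : I) (d : int) : laurent K I :=
  << [ffun j => if j == i then [:: d] else [::]] >>.

Definition spherical_subalgebra : laurent K I -> Prop :=
  generated_subalgebra (fun F => exists i d, F = zpow i d).

(* The generic point specialized at z_{j2} = q z_{j1}. *)
Definition wheel_point (n : I -> nat) (j : I) : I -> nat -> ratfun K n :=
  fun i a => if (i == j) && (a == 1%N) then ratC n q * zvar K n j 0
             else zvar K n i a.

Definition wheel_divisor (n : I -> nat) (i j : I) (a : nat) : ratfun K n :=
  \prod_(e : edge Q | (source e == i) && (target e == j))
    (zvar K n i a - ratC n q * zvar K n j 0 / ratC n (t e))
  * \prod_(e : edge Q | (source e == j) && (target e == i))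
      (zvar K n i a - ratC n (t e) * zvar K n j 0).

(* The wheel conditions: the cofactor H ranges over Laurent polynomials. *)
Definition wheel (F : laurent K I) : Prop :=
  forall (n : I -> nat) (i j : I) (a : nat),
    (1 < n j)%N -> (a < n i)%N -> ~~ ((i == j) && (a < 2)%N) ->
    exists H : laurent K I,
      leval n F (@wheel_point n j) =
      wheel_divisor n i j a * leval n H (@zvar K I n).

Definition shuffle_algebra (F : laurent K I) : Prop :=
  symmetric_laurent F /\ wheel F.

End ShuffleAlgebra.

(* Main.v *)
Require Import Defs.
From HB Require Import structures.
From mathcomp Require Import all_boot all_order all_fingroup all_algebra.
From mathcomp Require Import freeg mpoly.
From mathcomp Require Import reals complex.
From mathcomp Require Import ring lra zify.
From mathcomp Require boolp.

Set Implicit Arguments.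
Unset Strict Implicit.
Unset Printing Implicit Defensive.

Import Order.TTheory GRing.Theory Num.Theory.
Local Open Scope ring_scope.

(* Let V be the product over the vertices of the Vandermonde determinants of the
   variables of that vertex, and for a total order on all the variables let Z_<
   be the product over a < b of the numerators of zeta (z_a / z_b). Expanding
   products of generators z_{i1}^d shows that a symmetric Laurent polynomial R is
   spherical as soon as V R is the antisymmetrization of an element of the ideal J
   generated by the Z_<, while R satisfies the wheel conditions if and only if V R
   does. The converse inclusion thus reduces to: an antisymmetric F subject to the
   wheel conditions lies in J, up to a monomial.

   This is local on the torus: it suffices that each point has a function U, not
   vanishing there, such that U F is in J. Near a point, the linear forms that
   vanish there are z_a - c z_b for coordinates of ratio c. Chaining variables
   z, qz, q^2 z, ... into strings gives linear strata through the point, on which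
   the variables of a string stay proportional. For a stratum f, a suitable order
   of the variables gives a Z_< that vanishes on every other stratum of at least
   the same weight, while antisymmetry and the wheel conditions show that, if F
   vanishes on the strata of larger weight, the restriction of F to f is divisible
   by that of Z_<, up to a nonvanishing factor. The weight counts the moduli of the
   heads of the strings, and |q| < |t_e| < 1 guarantees that no edge factor
   vanishes identically inside a string. Subtracting multiples of the Z_< by
   descending induction on the weight makes F vanish on all strata, including the
   one without links, which is the whole space. *)

(** The field need not be algebraically closed, so a proper ideal on the torus may have no rational
    point. It is instead enlarged finitely many times, until each ratio z_a / z_b is either a
    constant or differs from every constant by a unit; these constants, class by class, are the
    point in question, and linear forms see nothing else.

    The weight is dictated by a count on each stratum. For two strings, the vanishing edge factors
    of Z_< are matched by wheel conditions. The vanishing factors z_a - q z_b are matched by the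
    zeros of F on diagonals: shifting one of the two variables along a link turns a pair of ratio q
    into a pair of ratio 1. At most one pair, at the tail of a string, is left over; its zero comes
    from the stratum where the two strings are joined there, on which F must therefore vanish
    already. Joining gives variables a head of larger modulus, whence the direction of the
    induction.

    Subtracting an element of J destroys antisymmetry; it is restored by alternating over the
    stabilizer of the point, whose order is invertible in characteristic 0. *)

Lemma mpoly_ring_ind (n : nat) (R : nzRingType) (P : {mpoly R[n]} -> Prop) :
  (forall c, P c%:MP) -> (forall i, P 'X_i) ->
  (forall p q, P p -> P q -> P (p + q)) ->
  (forall p q, P p -> P q -> P (p * q)) -> forall p, P p.
Proof.
move=> PC PX PD PM; apply: mpolyind; first by rewrite -mpolyC0.
move=> c m p _ _ Pp; apply: PD => //; rewrite -mul_mpolyC; apply: (PM) => //.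
rewrite mpolyXE_id; apply: (big_ind P) => [|p1 p2|]; [by rewrite -mpolyC1 | exact: PM |].
move=> i _; elim: (m i) => [|k IH]; first by rewrite expr0 -mpolyC1.
by rewrite exprS; apply: PM.
Qed.

Lemma mpoly_morph_ext (n : nat) (R : nzRingType) (S : nzRingType)
    (f g : {rmorphism {mpoly R[n]} -> S}) :
  (forall c, f c%:MP = g c%:MP) -> (forall i, f 'X_i = g 'X_i) -> f =1 g.
Proof.
move=> hC hX p; elim/mpoly_ring_ind: p => // p r hp hr.
  by rewrite !rmorphD hp hr.
by rewrite !rmorphM hp hr.
Qed.

(** * Substitutions and linear forms *)

Section Substitution.
Context (K : fieldType).

(** Permutations of the variables, substitutions z_a = c z_b, restrictions to strata and inclusions
    of sets of variables all have this form, and [subst_var_comp] composes them; identities between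
    them reduce to a check on indices and scalars. *)
Definition subst_var (n m : nat) (h : 'I_n -> 'I_m) (c : 'I_n -> K) :
    {mpoly K[n]} -> {mpoly K[m]} :=
  mmap (@mpolyC m K) (fun i => c i *: 'X_(h i)).

HB.instance Definition _ n m h c :=
  GRing.RMorphism.copy (@subst_var n m h c)
    (mmap (@mpolyC m K) (fun i => c i *: 'X_(h i))).

Lemma subst_varC n m (h : 'I_n -> 'I_m) c k : subst_var h c k%:MP = k%:MP.
Proof. exact: mmapC. Qed.

Lemma subst_varX n m (h : 'I_n -> 'I_m) c i :
  subst_var h c 'X_i = c i *: 'X_(h i).
Proof. by rewrite /subst_var mmapX mmap1U. Qed.

Lemma subst_varZ n m (h : 'I_n -> 'I_m) c k p :
  subst_var h c (k *: p) = k *: subst_var h c p.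
Proof. by rewrite -!mul_mpolyC rmorphM /= subst_varC. Qed.

Lemma subst_var_ext n m (h h' : 'I_n -> 'I_m) c c' :
  h =1 h' -> c =1 c' -> subst_var h c =1 subst_var h' c'.
Proof.
move=> eh ec; apply: mpoly_morph_ext => [k|i] /=; first by rewrite !subst_varC.
by rewrite !subst_varX eh ec.
Qed.

Lemma subst_var_comp n m l (h : 'I_n -> 'I_m) c (h' : 'I_m -> 'I_l) c' p :
  subst_var h' c' (subst_var h c p) =
  subst_var (h' \o h) (fun i => c i * c' (h i)) p.
Proof.
apply: (mpoly_morph_ext (f := subst_var h' c' \o subst_var h c)) p => [k|i] /=.
  by rewrite !subst_varC.
by rewrite !subst_varX subst_varZ subst_varX scalerA.
Qed.

Lemma subst_var_id n p : @subst_var n n id (fun=> 1) p = p.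
Proof.
apply: (mpoly_morph_ext (g := idfun)) p => [k|i] /=; first exact: subst_varC.
by rewrite subst_varX scale1r.
Qed.

End Substitution.

Section Divisibility.
Context (A : idomainType).

Definition divides (p r : A) : Prop := exists s, r = p * s.

Lemma divides_refl p : divides p p.
Proof. by exists 1; rewrite mulr1. Qed.

Lemma divides1 p : divides 1 p.
Proof. by exists p; rewrite mul1r. Qed.

Lemma divides0 p : divides p 0.
Proof. by exists 0; rewrite mulr0. Qed.

Lemma divides_trans r p s : divides p r -> divides r s -> divides p s.
Proof. by move=> [x ->] [y ->]; exists (x * y); rewrite mulrA. Qed.

Lemma dividesD p r s : divides p r -> divides p s -> divides p (r + s).
Proof. by move=> [x ->] [y ->]; exists (x + y); rewrite mulrDr. Qed.

Lemma dividesB p r s : divides p r -> divides p s -> divides p (r - s).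
Proof. by move=> [x ->] [y ->]; exists (x - y); rewrite mulrBr. Qed.

Lemma divides_mull p r s : divides p r -> divides p (s * r).
Proof. by move=> [x ->]; exists (s * x); rewrite mulrCA. Qed.

Lemma divides_mulr p r s : divides p r -> divides p (r * s).
Proof. by move=> h; rewrite mulrC; apply: divides_mull. Qed.

Lemma divides_mul p r p' r' :
  divides p r -> divides p' r' -> divides (p * p') (r * r').
Proof. by move=> [x ->] [y ->]; exists (x * y); rewrite mulrACA. Qed.

Lemma divides_exp p m n : (m <= n)%N -> divides (p ^+ m) (p ^+ n).
Proof. by move=> /subnK <-; exists (p ^+ (n - m)); rewrite addnC exprD. Qed.

Lemma divides_prod (I : Type) (r : seq I) (P : pred I) (F G : I -> A) :
  (forall i, P i -> divides (F i) (G i)) ->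
  divides (\prod_(i <- r | P i) F i) (\prod_(i <- r | P i) G i).
Proof.
move=> h; apply: (big_ind2 divides) => //; first exact: divides1.
by move=> ? ? ? ?; exact: divides_mul.
Qed.

Lemma divides_prod_mem (I : finType) (P : pred I) (F : I -> A) i :
  P i -> divides (F i) (\prod_(j | P j) F j).
Proof. by move=> Pi; rewrite (bigD1 i) //=; apply/divides_mulr/divides_refl. Qed.

Lemma divides_mulfI p r s : p != 0 -> divides (p * r) (p * s) -> divides r s.
Proof.
by move=> p0 [x]; rewrite -mulrA => /(mulfI p0) ->; exists x.
Qed.

End Divisibility.

Lemma divides_morph (A B : idomainType) (f : {rmorphism A -> B}) p r :
  divides p r -> divides (f p) (f r).
Proof. by move=> [x ->]; exists (f x); rewrite rmorphM. Qed.

Section LinearForms.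
Context (K : fieldType) (n : nat).
Implicit Types (a b : 'I_n) (c : K) (P R : {mpoly K[n]}).

Definition lin a b c : {mpoly K[n]} := 'X_a - c *: 'X_b.

Definition elim_var a b c : {mpoly K[n]} -> {mpoly K[n]} :=
  subst_var (fun x => if x == a then b else x) (fun x => if x == a then c else 1).

HB.instance Definition _ a b c :=
  GRing.RMorphism.copy (elim_var a b c)
    (subst_var (fun x => if x == a then b else x) (fun x => if x == a then c else 1)).

Lemma elim_varX a b c x :
  elim_var a b c 'X_x = if x == a then c *: 'X_b else 'X_x.
Proof. by rewrite /elim_var subst_varX; case: eqP => // _; rewrite scale1r. Qed.

Lemma elim_varC a b c k : elim_var a b c k%:MP = k%:MP.
Proof. exact: subst_varC. Qed.

Lemma elim_varZ a b c k p : elim_var a b c (k *: p) = k *: elim_var a b c p.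
Proof. exact: subst_varZ. Qed.

Lemma elim_var_lin a b c : a != b -> elim_var a b c (lin a b c) = 0.
Proof.
move=> ab; rewrite /lin rmorphB /= elim_varZ !elim_varX eqxx.
by rewrite [b == a]eq_sym (negbTE ab) subrr.
Qed.

Lemma divides_elim_var a b c P : divides (lin a b c) (P - elim_var a b c P).
Proof.
elim/mpoly_ring_ind: P => [k|i|p r hp hr|p r hp hr].
- by rewrite elim_varC subrr; apply: divides0.
- rewrite elim_varX; case: eqP => [->|_]; first exact: divides_refl.
  by rewrite subrr; apply: divides0.
- by rewrite rmorphD /= opprD addrACA; apply: dividesD.
- rewrite rmorphM /=.
  have ->: p * r - elim_var a b c p * elim_var a b c r =
    p * (r - elim_var a b c r) + (p - elim_var a b c p) * elim_var a b c r by ring.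
  by apply: dividesD; [apply: divides_mull | apply: divides_mulr].
Qed.

Lemma lin_dividesP a b c P : a != b ->
  divides (lin a b c) P <-> elim_var a b c P = 0.
Proof.
move=> ab; split=> [[s ->]|h]; first by rewrite rmorphM /= elim_var_lin ?mul0r.
by have := divides_elim_var a b c P; rewrite h subr0.
Qed.

Lemma mpolyX_neq0 (i : 'I_n) : 'X_i != 0 :> {mpoly K[n]}.
Proof.
apply/eqP => /(congr1 (fun p => p@_U_(i))).
by rewrite mcoeff0 mcoeffX eqxx => /eqP; rewrite oner_eq0.
Qed.

Lemma monom_diff_neq0 i j (c d : K) : (i != j) && ((c != 0) || (d != 0)) ->
  c *: 'X_i - d *: 'X_j != 0 :> {mpoly K[n]}.
Proof.
move=> /andP[ij cd]; apply/eqP => e.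
have := congr1 (fun p => p@_U_(i)) e; have := congr1 (fun p => p@_U_(j)) e.
rewrite !mcoeffB !mcoeffZ !mcoeff0 !mcoeffXU !eqxx (negbTE ij) [j == i]eq_sym (negbTE ij).
rewrite /= !mulr0 !mulr1 sub0r subr0 => /eqP; rewrite oppr_eq0 => /eqP d0 c0.
by move: cd; rewrite c0 d0 eqxx.
Qed.

Lemma lin_neq0 a b c : a != b -> lin a b c != 0.
Proof.
by move=> ab; rewrite /lin -[X in X - _]scale1r monom_diff_neq0 // ab oner_neq0.
Qed.

Lemma lin_divides_mul a b c P R : a != b ->
  divides (lin a b c) (P * R) -> elim_var a b c P != 0 -> divides (lin a b c) R.
Proof.
move=> ab /(lin_dividesP _ _ ab); rewrite rmorphM /= => /eqP.
rewrite mulf_eq0 => /orP[->//|/eqP h _].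
exact/lin_dividesP.
Qed.

Lemma lin_exp_divides_mul a b c m P R : a != b ->
  divides (lin a b c ^+ m) (P * R) -> elim_var a b c P != 0 ->
  divides (lin a b c ^+ m) R.
Proof.
move=> ab h hP; elim: m R h => [|m IH] R h; first exact: divides1.
have [S ER]: divides (lin a b c) R.
  apply: lin_divides_mul hP => //; apply: divides_trans h.
  by rewrite exprS; apply/divides_mulr/divides_refl.
rewrite ER exprS; apply: divides_mul; first exact: divides_refl.
apply: IH; apply: (@divides_mulfI _ (lin a b c)); first exact: lin_neq0.
by rewrite -exprS [lin a b c * _]mulrCA -ER.
Qed.

Lemma elim_var_lin_neq0 a b c a' b' c' : a != b -> a' != b' -> c != 0 -> c' != 0 ->
  ~~ [|| (a == a') && (b == b') | (a == b') && (b == a')] ->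
  elim_var a b c (lin a' b' c') != 0.
Proof.
move=> ab ab' c0 c'0; rewrite !negb_or !negb_and => /andP[h1 h2].
rewrite /lin rmorphB /= elim_varZ !elim_varX.
case: (eqVneq a' a) h1 h2 => [ea|na] h1 h2; case: (eqVneq b' a) => [eb|nb].
- by rewrite ea eb eqxx in ab'.
- by rewrite monom_diff_neq0 // c0 andbT.
- rewrite scalerA -[X in X - _]scale1r monom_diff_neq0 // oner_neq0 andbT eq_sym.
  by move: h2; rewrite eb eqxx.
- by rewrite -[X in X - _]scale1r monom_diff_neq0 // ab' oner_neq0.
Qed.

(** A substitute for unique factorization: [elim_var] takes values in a domain, where the forms on
    the other pairs of variables stay non-zero, so each power can be split off the cofactor in
    turn. *)
Lemma prod_lin_divides (I : eqType) (r : seq I) (A B : I -> 'I_n) (C : I -> K)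
    (m : I -> nat) P :
  uniq r -> (forall i, i \in r -> (A i != B i) && (C i != 0)) ->
  (forall i j, i \in r -> j \in r -> i != j ->
     ~~ [|| (A i == A j) && (B i == B j) | (A i == B j) && (B i == A j)]) ->
  (forall i, i \in r -> divides (lin (A i) (B i) (C i) ^+ m i) P) ->
  divides (\prod_(i <- r) lin (A i) (B i) (C i) ^+ m i) P.
Proof.
elim: r => [|i r IH] /= => [*|/andP[ir ur] hAB hne hd].
  by rewrite big_nil; apply: divides1.
have [|||S ES] := IH ur.
- by move=> j jr; apply: hAB; rewrite inE jr orbT.
- by move=> j k jr kr; apply: hne; rewrite inE ?jr ?kr orbT.
- by move=> j jr; apply: hd; rewrite inE jr orbT.
rewrite big_cons ES mulrC; apply: divides_mul; first exact: divides_refl.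
have /andP[ABi Ci] := hAB i (mem_head _ _).
apply: (lin_exp_divides_mul (P := \prod_(j <- r) lin (A j) (B j) (C j) ^+ m j)) => //.
  by rewrite -ES; apply: hd; rewrite mem_head.
rewrite rmorph_prod prodf_seq_neq0; apply/allP => j jr /=.
have /andP[ABj Cj] : (A j != B j) && (C j != 0) by apply: hAB; rewrite inE jr orbT.
rewrite rmorphXn expf_eq0 negb_and; apply/orP; right.
apply: elim_var_lin_neq0 => //; apply: hne; rewrite ?mem_head ?inE ?jr ?orbT //.
by apply: contraNneq ir => ->.
Qed.

(** The forms may coincide: each is prime and does not divide [P], so it is cancelled once for each
    occurrence in the product. *)
Lemma prod_lin_divides_mul (I : Type) (r : seq I) (p : pred I)
    (A B : I -> 'I_n) (C : I -> K) P R :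
  (forall i, p i -> A i != B i) ->
  (forall i, p i -> elim_var (A i) (B i) (C i) P != 0) ->
  divides (\prod_(i <- r | p i) lin (A i) (B i) (C i)) (P * R) ->
  divides (\prod_(i <- r | p i) lin (A i) (B i) (C i)) R.
Proof.
move=> hAB hP; elim: r R => [|i r IH] R; first by rewrite big_nil => _; apply: divides1.
rewrite big_cons; case: ifP => [pi|_]; last exact: IH.
move=> h; have [S ER]: divides (lin (A i) (B i) (C i)) R.
  apply: lin_divides_mul (hP _ pi); first exact: hAB.
  by apply: divides_trans h; apply/divides_mulr/divides_refl.
rewrite ER; apply: divides_mul; first exact: divides_refl.
apply: IH; apply: (@divides_mulfI _ (lin (A i) (B i) (C i))); first exact/lin_neq0/hAB.
by rewrite [X in divides _ X]mulrCA -ER.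
Qed.

Definition var_prod : {mpoly K[n]} := \prod_i 'X_i.

Lemma elim_var_Xall_neq0 a b c s : c != 0 -> elim_var a b c (var_prod ^+ s) != 0.
Proof.
move=> c0; rewrite rmorphXn /= expf_neq0 // /var_prod rmorph_prod /=.
apply/prodf_neq0 => i _; rewrite elim_varX; case: ifP => _; last exact: mpolyX_neq0.
by rewrite scaler_eq0 negb_or c0 mpolyX_neq0.
Qed.

End LinearForms.

(** Two-digit numbers in base [d.+1] encode lexicographic orders as natural numbers; the keys of
    heads and variables are built this way. *)
Lemma digit_lt d x x' y y' : (y <= d)%N -> (x < x')%N ->
  (x * d.+1 + y < x' * d.+1 + y')%N.
Proof. by move=> hy hx; have := leq_mul hx (leqnn d.+1); lia. Qed.

Lemma digit_inj d x x' y y' : (y <= d)%N -> (y' <= d)%N ->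
  (x * d.+1 + y = x' * d.+1 + y')%N -> x = x' /\ y = y'.
Proof.
move=> hy hy' e; case: (ltngtP x x') => [h|h|h].
- by have := digit_lt y' hy h; lia.
- by have := digit_lt y hy' h; lia.
- by move: e; rewrite h => /addnI ->.
Qed.

Lemma digit_le d x x' y y' : (y <= d)%N -> (y' <= d)%N ->
  (x * d.+1 + y < x' * d.+1 + y')%N ->
  (x <= x')%N /\ (x = x' -> (y < y')%N).
Proof.
move=> hy hy' h; split; last by move=> e; move: h; rewrite e ltn_add2l.
by rewrite leqNgt; apply/negP => h'; have := digit_lt y hy' h'; lia.
Qed.

(* [val] gives the coordinates of a point of the torus. Of the absolute value
   [nu] only the multiplicativity matters: no triangle inequality is used. *)
Class torus_point (K : fieldType) (R : realFieldType) (nu : K -> R) (q : K)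
    (n : nat) (val : 'I_n -> K) : Prop := TorusPoint {
  point_nuM : forall x y, nu (x * y) = nu x * nu y;
  point_nu_gt0 : forall x, x != 0 -> 0 < nu x;
  point_q_neq0 : q != 0;
  point_nuq_lt1 : nu q < 1;
  point_val_neq0 : forall a, val a != 0
}.

(** * Strings z, qz, q^2 z, ... through a point of the torus *)

Section Strings.
Context (K : fieldType) (R : realFieldType) (nu : K -> R) (q : K) (n : nat).
Context (C T : eqType) (col : 'I_n -> C) (cls : 'I_n -> T) (val : 'I_n -> K).
Context {pt : torus_point nu q val}.

Let nuM : forall x y, nu (x * y) = nu x * nu y := @point_nuM _ _ _ _ _ _ pt.
Let nu_gt0 : forall x, x != 0 -> 0 < nu x := @point_nu_gt0 _ _ _ _ _ _ pt.
Let q_neq0 : q != 0 := @point_q_neq0 _ _ _ _ _ _ pt.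
Let nuq_lt1 : nu q < 1 := @point_nuq_lt1 _ _ _ _ _ _ pt.
Let val_neq0 : forall a, val a != 0 := @point_val_neq0 _ _ _ _ _ _ pt.

Implicit Types (a b c x y z : 'I_n) (f : {ffun 'I_n -> 'I_n}).

Definition modulus a : R := nu (val a).

Lemma modulus_gt0 a : 0 < modulus a.
Proof. exact/nu_gt0/val_neq0. Qed.

Lemma nuq_gt0 : 0 < nu q.
Proof. exact: nu_gt0. Qed.

Lemma nu1 : nu 1 = 1.
Proof.
have h := nu_gt0 (oner_neq0 K).
by apply: (mulfI (lt0r_neq0 h)); rewrite -nuM !mulr1.
Qed.

Lemma nuX (x : K) k : nu (x ^+ k) = nu x ^+ k.
Proof. by elim: k => [|k IH]; rewrite ?expr0 ?nu1 // !exprS nuM IH. Qed.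

Lemma nuq_exp_inj i j : nu q ^+ i = nu q ^+ j -> i = j.
Proof.
move=> e; apply/eqP; rewrite eqn_leq.
by rewrite -!(ler_iXn2l nuq_gt0 nuq_lt1) e lexx.
Qed.

Lemma q_exp_inj i j : q ^+ i = q ^+ j -> i = j.
Proof. by move=> /(congr1 nu); rewrite !nuX => /nuq_exp_inj. Qed.

(** The weights depend on the moduli only through their order; ranks are natural numbers, so that
    one can descend on the weight. *)
Definition rk a : nat := #|[pred b | modulus b < modulus a]|.

Lemma rk_lt a b : (rk a < rk b)%N = (modulus a < modulus b).
Proof.
have le x y : modulus x <= modulus y -> (rk x <= rk y)%N.
  move=> h; apply/subset_leq_card/subsetP => z; rewrite !inE => hz.
  exact: lt_le_trans hz h.
case: (ltP (modulus a) (modulus b)) => [h|/le]; last by rewrite ltnNge => ->.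
apply: proper_card; apply/properP; split.
  by apply/subsetP => z; rewrite !inE => hz; apply: lt_trans hz h.
by exists a; rewrite !inE ?h ?ltxx.
Qed.

Lemma rk_le a b : (rk a <= rk b)%N = (modulus a <= modulus b).
Proof. by rewrite leqNgt rk_lt leNgt. Qed.

Lemma rk_eq a b : (rk a == rk b) = (modulus a == modulus b).
Proof. by rewrite eqn_leq !rk_le eq_le. Qed.

Lemma rk_ltn a : (rk a < n)%N.
Proof.
rewrite -[X in (_ < X)%N]card_ord; apply: proper_card; apply/properP; split.
  by apply/subsetP.
by exists a; rewrite // inE ltxx.
Qed.

Definition link b c := [&& col b == col c, cls b == cls c & val c == q * val b].

Lemma link_modulus b c : link b c -> modulus c = nu q * modulus b.
Proof. by move=> /and3P[_ _ /eqP e]; rewrite /modulus e nuM. Qed.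

Lemma link_rk b c : link b c -> (rk c < rk b)%N.
Proof.
by move=> /link_modulus e; rewrite rk_lt e gtr_pMl // modulus_gt0.
Qed.

(* A system of strings z, qz, q^2 z, ... through the point [val]: [f] sends each
   variable to its predecessor, and fixes the heads. *)
Definition string_system f :=
  [forall a, (f a != a) ==> link (f a) a] &&
  [forall a, forall b, [&& f a == f b, f a != a & f b != b] ==> (a == b)].

Section System.
Context (f : {ffun 'I_n -> 'I_n}).
Hypothesis f_ok : string_system f.

Lemma sys_link a : f a != a -> link (f a) a.
Proof. by move: f_ok => /andP[/forallP /(_ a) /implyP]. Qed.

Lemma sys_inj a b : f a = f b -> f a != a -> f b != b -> a = b.
Proof.
move: f_ok => /andP[_ /forallP /(_ a) /forallP /(_ b) /implyP h] e na nb.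
by apply/eqP/h; rewrite na nb e eqxx.
Qed.

Lemma sys_rk a : f a != a -> (rk a < rk (f a))%N.
Proof. by move=> /sys_link /link_rk. Qed.

Definition shead a := iter n f a.

(** Each step that moves raises the rank, and ranks are below [n], so [n] iterations reach a
    head. *)
Lemma head_fix a : f (shead a) = shead a.
Proof.
have h k : f (iter k f a) = iter k f a \/ (k <= rk (iter k f a))%N.
  elim: k => [|k [IH|IH]]; [by right | by left; rewrite /= !IH |].
  case: (eqVneq (f (iter k f a)) (iter k f a)) => [e|ne]; first by left; rewrite /= !e.
  by right; apply: leq_ltn_trans IH _; apply: sys_rk.
by case: (h n) => //; rewrite leqNgt rk_ltn.
Qed.

Lemma head_f a : shead (f a) = shead a.
Proof. by rewrite /shead -iterSr iterS head_fix. Qed.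

Lemma head_of_fix a : f a = a -> shead a = a.
Proof. by move=> e; rewrite /shead; apply: (iter_fix n e). Qed.

Lemma head_head a : shead (shead a) = shead a.
Proof. exact/head_of_fix/head_fix. Qed.

Lemma sys_ind (P : 'I_n -> Prop) :
  (forall a, f a = a -> P a) -> (forall a, f a != a -> P (f a) -> P a) ->
  forall a, P a.
Proof.
move=> P0 PS a; have [k] := ubnP (n - rk a); elim: k a => // k IH a hk.
case: (eqVneq (f a) a) => [e|ne]; first exact: P0.
apply: PS => //; apply: IH; have := sys_rk ne; have := rk_ltn (f a); lia.
Qed.

Definition lv a : nat := \sum_(i < n) (f (iter i f a) != iter i f a).

Lemma lv_fix a : f a = a -> lv a = 0%N.
Proof.
move=> e; apply: big1 => i _; rewrite (iter_fix i e).
by rewrite e eqxx.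
Qed.

Lemma lv_f a : f a != a -> lv a = (lv (f a)).+1.
Proof.
move=> ne; pose F k : nat := f (iter k f a) != iter k f a.
have e : (\sum_(i < n) F i + F n = F 0 + \sum_(i < n) F i.+1)%N.
  transitivity (\sum_(i < n.+1) F i)%N; first by rewrite big_ord_recr.
  by rewrite big_ord_recl.
have Fn : F n = 0%N by rewrite /F; have := head_fix a; rewrite /shead => ->; rewrite eqxx.
have F0 : F 0 = 1%N by rewrite /F /= ne.
rewrite Fn F0 addn0 add1n in e; rewrite /lv [LHS]e; congr _.+1.
by apply: eq_bigr => i _; rewrite /F -!iterSr.
Qed.

Lemma val_lv a : val a = q ^+ lv a * val (shead a).
Proof.
elim/sys_ind: a => [a e|a ne IH]; first by rewrite lv_fix // mul1r head_of_fix.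
have /and3P[_ _ /eqP ->] := sys_link ne.
by rewrite lv_f // IH head_f exprS mulrA.
Qed.

Lemma modulus_lv a : modulus a = nu q ^+ lv a * modulus (shead a).
Proof. by rewrite /modulus {1}val_lv nuM nuX. Qed.

Lemma modulus_head a : modulus a <= modulus (shead a).
Proof.
rewrite modulus_lv; apply: ler_piMl; first exact/ltW/modulus_gt0.
by apply: exprn_ile1; apply: ltW => //; exact: nuq_gt0.
Qed.

Lemma lv0_head a : lv a = 0%N -> f a = a.
Proof. by move=> h; apply/eqP/negPn/negP => /lv_f; rewrite h. Qed.

Lemma lv_inj a b : shead a = shead b -> lv a = lv b -> a = b.
Proof.
elim/sys_ind: a b => [a e|a ne IH] b.
  rewrite lv_fix // => hh /esym /lv0_head eb.
  by rewrite -[LHS](head_of_fix e) hh head_of_fix.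
move=> hh; rewrite lv_f // => el; have nb : f b != b.
  by apply/eqP => eb; rewrite (lv_fix eb) in el.
move: el; rewrite (lv_f nb) => -[el].
by apply: sys_inj => //; apply: IH; rewrite ?head_f.
Qed.

Lemma val_inj_string a b : shead a = shead b -> val a = val b -> a = b.
Proof.
move=> hh; rewrite val_lv [in RHS]val_lv hh => /(mulIf (val_neq0 _)) /q_exp_inj.
exact: lv_inj.
Qed.

Lemma modulus_inj_string a b : shead a = shead b -> modulus a = modulus b -> a = b.
Proof.
move=> hh; rewrite modulus_lv [in RHS]modulus_lv hh.
by move=> /(mulIf (lt0r_neq0 (modulus_gt0 _))) /nuq_exp_inj; apply: lv_inj.
Qed.

Lemma string_down a k : (k <= lv a)%N -> exists2 b, shead b = shead a & lv b = k.
Proof.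
elim/sys_ind: a => [a e|a ne IH].
  by rewrite lv_fix // leqn0 => /eqP ->; exists a; rewrite ?lv_fix.
rewrite leq_eqVlt => /orP[/eqP ->|]; first by exists a.
by rewrite lv_f // ltnS => /IH[b hb lb]; exists b; rewrite ?hb ?head_f.
Qed.

Definition tail_lv h : nat := (\max_(a | shead a == h) lv a)%N.

Lemma lv_tail a : (lv a <= tail_lv (shead a))%N.
Proof. by rewrite /tail_lv (bigD1 a) //= leq_maxl. Qed.

Lemma string_level h k : shead h = h -> (k <= tail_lv h)%N ->
  exists2 b, shead b = h & lv b = k.
Proof.
move=> hh; rewrite /tail_lv (bigop.bigmax_eq_arg h) ?hh //.
case: arg_maxnP => [|a /eqP ha _]; first by rewrite hh.
by rewrite -ha; apply: string_down.
Qed.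

Lemma sys_chain a b : shead a = shead b -> (lv a < lv b)%N ->
  exists2 c, f c = a & f c != c.
Proof.
elim/sys_ind: b => [b e|b ne IH]; first by rewrite (lv_fix e) ltn0.
rewrite (lv_f ne) ltnS leq_eqVlt => hh /orP[/eqP e|]; last by apply: IH; rewrite head_f.
by exists b => //; apply/esym/lv_inj; rewrite ?head_f.
Qed.

Definition is_tail b := [forall c, (f c == b) ==> (c == b)].

Lemma is_tailP b c : is_tail b -> f c = b -> c = b.
Proof. by move=> /forallP /(_ c) /implyP h /eqP e; apply/eqP/h. Qed.

Lemma not_tail b : ~~ is_tail b -> exists2 c, f c = b & c != b.
Proof.
by rewrite negb_forall => /existsP[c]; rewrite negb_imply => /andP[/eqP ? ?]; exists c.
Qed.

Lemma tail_uniq a b : is_tail a -> is_tail b -> shead a = shead b -> a = b.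
Proof.
move=> ta tb hh; case: (ltngtP (lv a) (lv b)) => [h|h|]; last exact: lv_inj.
- have [c ec nc] := sys_chain hh h.
  by move: nc; rewrite ec -{1}(is_tailP ta ec) eqxx.
- have [c ec nc] := sys_chain (esym hh) h.
  by move: nc; rewrite ec -{1}(is_tailP tb ec) eqxx.
Qed.

(** A head counts once for every variable of its string, so that moving variables to a head of
    larger modulus raises the weight, as [merge_system] does. *)
Definition string_weight : nat := \sum_a rk (shead a).

(* Lexicographic: modulus of the head, then length of the string (long strings
   first), then the head itself, then the position in the string. *)
Definition head_key h : nat := ((rk h * n.+1 + (n - tail_lv h)) * n.+1 + h)%N.
Definition string_key a : nat := (head_key (shead a) * n.+1 + (n - rk a))%N.

Lemma tail_lv_le h : (tail_lv h <= n)%N.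
Proof.
apply/bigop.bigmax_leqP => a _; apply: (@leq_trans (\sum_(i < n) 1)%N).
  by apply: leq_sum => i _; apply: leq_b1.
by rewrite sum1_card card_ord.
Qed.

Lemma head_key_inj h h' : head_key h = head_key h' -> h = h'.
Proof.
by move=> /(digit_inj (ltnW (ltn_ord h)) (ltnW (ltn_ord h')))[_ /val_inj].
Qed.

Lemma head_key_le h h' : (head_key h < head_key h')%N ->
  (rk h <= rk h')%N /\ (rk h = rk h' -> (tail_lv h' <= tail_lv h)%N).
Proof.
move=> /(digit_le (ltnW (ltn_ord h)) (ltnW (ltn_ord h')))[+ _].
have hs x : (n - tail_lv x <= n)%N by apply: leq_subr.
rewrite leq_eqVlt => /orP[/eqP|].
  move=> /(digit_inj (hs h) (hs h'))[-> e]; split=> // _.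
  by have := tail_lv_le h; have := tail_lv_le h'; lia.
by move=> /(digit_le (hs h) (hs h'))[h1 h2]; split=> // /h2; lia.
Qed.

Lemma string_key_heads a b : shead a != shead b ->
  (string_key a < string_key b)%N = (head_key (shead a) < head_key (shead b))%N.
Proof.
move=> hne; case: (ltngtP (head_key (shead a)) (head_key (shead b))).
- by move=> h; apply: digit_lt => //; apply: leq_subr.
- by move=> h; apply/negbTE; rewrite -leqNgt ltnW // digit_lt // leq_subr.
- by move=> /head_key_inj e; rewrite e eqxx in hne.
Qed.

Lemma string_key_string a b : shead a = shead b ->
  (string_key a < string_key b)%N = (rk b < rk a)%N.
Proof.
move=> e; rewrite /string_key e ltn_add2l.
by have := rk_ltn a; have := rk_ltn b; lia.
Qed.

Lemma string_key_inj : injective string_key.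
Proof.
move=> a b /(digit_inj (leq_subr _ _) (leq_subr _ _))[/head_key_inj e h].
apply: modulus_inj_string => //; apply/eqP; rewrite -rk_eq.
by have := rk_ltn a; have := rk_ltn b; lia.
Qed.

Lemma string_key_head_rk a b : (string_key a < string_key b)%N ->
  (rk (shead a) <= rk (shead b))%N.
Proof.
case: (eqVneq (shead a) (shead b)) => [->//|ne].
by rewrite string_key_heads // => /head_key_le[].
Qed.

End System.

(* Links that go forward in the order of [f] can only lower the moduli of the
   heads; the ties are broken so that equality forces the two systems to agree. *)
Lemma forward_system f f' : string_system f -> string_system f' ->
  (forall a, f' a != a -> (string_key f (f' a) < string_key f a)%N) ->
  (string_weight f <= string_weight f')%N -> f' = f.
Proof.
move=> ok ok' fwd hw.
(* Going down a string of [f'], the ranks of the heads in [f] can only grow, and the head of that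
   string has at most the rank of its own head in [f]. *)
have hle a : (rk (shead f' a) <= rk (shead f a))%N.
  apply: (@leq_trans (rk (shead f (shead f' a)))).
    by rewrite rk_le; apply: modulus_head.
  elim/(sys_ind ok'): a => [a e|a ne IH]; first by rewrite (head_of_fix e).
  rewrite (head_f ok') in IH; apply: leq_trans IH _.
  exact/string_key_head_rk/fwd.
(* A strict inequality at one variable would make the total weight of [f'] smaller. *)
have heq a : rk (shead f' a) = rk (shead f a).
  apply/eqP; rewrite eqn_leq hle /= leqNgt; apply/negP => hlt.
  suff : (string_weight f' < string_weight f)%N by rewrite ltnNge hw.
  rewrite /string_weight (bigD1 a) //= [in ltnRHS](bigD1 a) //= -addSn leq_add //.
  by apply: leq_sum => b _; apply: hle.
apply/ffunP => a; have [k] := ubnP (string_key f a); elim: k a => // k IH a hk.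
have modeq x : modulus (shead f' x) = modulus (shead f x).
  by apply/eqP; rewrite -rk_eq heq.
case: (eqVneq (f' a) a) => [e|ne'].
  rewrite e; apply/esym/eqP/negPn/negP => ne.
  have := sys_rk ok ne; rewrite rk_lt ltNge; case/negP.
  rewrite -[X in _ <= modulus X](head_of_fix e) modeq -head_f //.
  exact: modulus_head.
have ne : f a != a.
  apply/eqP => e; have := sys_rk ok' ne'; rewrite rk_lt ltNge; case/negP.
  rewrite -[X in _ <= modulus X](head_of_fix e) -modeq -head_f //.
  exact: modulus_head.
have vb : val (f' a) = val (f a).
  have /and3P[_ _ /eqP e] := sys_link ok ne; have /and3P[_ _ /eqP] := sys_link ok' ne'.
  by rewrite e => /(mulfI q_neq0).
case: (eqVneq (shead f (f' a)) (shead f a)) => [hh|hne].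
  by apply: (val_inj_string ok) => //; rewrite hh (head_f ok).
have hk1 := fwd _ ne'; rewrite string_key_heads // in hk1.
have [_ htl] := head_key_le ok hk1.
have hrk : rk (shead f (f' a)) = rk (shead f a) by rewrite -!heq head_f.
have lvb : lv f (f' a) = lv f (f a).
  have : modulus (f' a) = modulus (f a) by rewrite /modulus vb.
  rewrite (modulus_lv ok (f' a)) (modulus_lv ok (f a)) (head_f ok a).
  have /eqP -> : modulus (shead f (f' a)) == modulus (shead f a).
    by rewrite -rk_eq hrk.
  by move/(mulIf (lt0r_neq0 (modulus_gt0 _)))/nuq_exp_inj.
(* The predecessors of [a] in [f] and [f'] have equal values but lie in different strings of [f].
   The string of [f' a] has the smaller head key, hence is at least as long, and contains an [a'] at
   the level of [a]. By induction [f' a'] equals [f' a], and [f'] is injective off its heads. *)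
have [a' ha' la'] := string_level ok (head_head ok (f' a))
  (leq_trans (lv_tail f a) (htl hrk)).
have na' : f a' != a'.
  by apply/eqP => /(lv_fix) e; move: la'; rewrite e (lv_f ok ne).
have fa' : f a' = f' a.
  apply: (lv_inj ok); first by rewrite head_f.
  by move: la'; rewrite (lv_f ok na') (lv_f ok ne) lvb => -[].
have ka' : (string_key f a' < string_key f a)%N.
  by rewrite string_key_heads ha'.
have e : f' a' = f a' by apply: IH; apply: leq_trans ka' _.
have na'' : f' a' != a' by rewrite e.
have aa : a' = a by apply: (sys_inj ok') => //; rewrite e.
by move: hne; rewrite -ha' aa eqxx.
Qed.

(** The part of the string of [a] that starts at [a] is cut off and attached below the tail [b];
    these variables exchange the head of [a] for that of [b], and the others keep theirs. *)
Lemma merge_system f a b : string_system f -> is_tail f b -> link b a ->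
  (rk (shead f a) < rk (shead f b))%N ->
  let f' := [ffun x => if x == a then b else f x] in
  [/\ string_system f', (string_weight f < string_weight f')%N &
      forall x, shead f' x = shead f x \/
        shead f x = shead f a /\ shead f' x = shead f b].
Proof.
move=> ok tb lk hr f'.
have hab : shead f a != shead f b by apply: contraTneq hr => ->; rewrite ltnn.
have ab : b != a by apply: contraNneq hab => ->.
have fE x : f' x = if x == a then b else f x by rewrite ffunE.
have ok' : string_system f'.
  apply/andP; split; apply/forallP => x.
    rewrite fE; case: (eqVneq x a) => [->|_]; apply/implyP => // h; exact: (sys_link ok).
  apply/forallP => y; apply/implyP; rewrite !fE.
  case: (eqVneq x a) => [->|xa]; case: (eqVneq y a) => [->|ya] //.
  - by move=> /and3P[/eqP e _ ny]; move: ny; rewrite -e (is_tailP tb (esym e)) eqxx.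
  - by move=> /and3P[/eqP e ny _]; move: ny; rewrite e (is_tailP tb e) eqxx.
  - by move=> /and3P[/eqP e nx ny]; apply/eqP; apply: (sys_inj ok).
have hb : shead f' b = shead f b.
  have : shead f b != shead f a by rewrite eq_sym.
  elim/(sys_ind ok): (b) => [x e|x ne IH] hx.
    rewrite (head_of_fix e) head_of_fix // fE; case: eqP => // xa.
    by rewrite xa eqxx in hx.
  rewrite -(head_f ok) -IH ?head_f // -(head_f ok' x) fE.
  by case: eqP => // xa; rewrite xa eqxx in hx.
have hh x : shead f' x = shead f x \/ shead f x = shead f a /\ shead f' x = shead f b.
  elim/(sys_ind ok): x => [x e|x ne IH].
    case: (eqVneq x a) => [->|xa]; first by right; rewrite -(head_f ok') fE eqxx.
    by left; rewrite (head_of_fix e) head_of_fix // fE (negbTE xa).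
  case: (eqVneq x a) => [->|xa]; first by right; rewrite -(head_f ok') fE eqxx.
  by rewrite -(head_f ok') fE (negbTE xa) -(head_f ok x).
split=> //; rewrite /string_weight (bigD1 a) //= [in ltnRHS](bigD1 a) //= -addSn leq_add //.
  by rewrite -(head_f ok') fE eqxx hb.
apply: leq_sum => x _; case: (hh x) => [->//|[-> ->]]; exact: ltnW.
Qed.

End Strings.

(** * Products of zeta factors and the wheel conditions *)

Section Kernels.
Context (K : fieldType) (Q : quiver) (q : K) (t : edge Q -> K).
Hypothesis q_neq0 : q != 0.
Hypothesis t_neq0 : forall e, t e != 0.
Context (n : nat) (col : 'I_n -> vertex Q).
Implicit Types (a b c : 'I_n) (P F : {mpoly K[n]}) (h : bool * edge Q).
Implicit Types (i j : vertex Q).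

(* The half-edges of [e] are [(false, e)], with weight [t e], and [(true, e)],
   the reversed edge, with weight [q / t e]. *)
Definition adj i j h : bool :=
  if h.1 then (source h.2 == j) && (target h.2 == i)
  else (source h.2 == i) && (target h.2 == j).
Definition hweight h : K := if h.1 then q / t h.2 else t h.2.
Definition hflip h : bool * edge Q := (~~ h.1, h.2).

Lemma hflipK : involutive hflip.
Proof. by case=> b e; rewrite /hflip /= negbK. Qed.

Lemma adj_flip i j h : adj i j (hflip h) = adj j i h.
Proof. by case: h => [[] e]; rewrite /adj /=. Qed.

Lemma hweight_neq0 h : hweight h != 0.
Proof. by rewrite /hweight; case: h.1 => //; rewrite mulf_neq0 ?invr_eq0. Qed.

Lemma hweight_flip h : hweight (hflip h) = q / hweight h.
Proof.
rewrite /hweight; case: h => [[] e] //=.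
by rewrite invf_div mulrCA divff ?mulr1.
Qed.

(* The numerator of [zeta (z_a / z_b)]. *)
Definition kernel a b : {mpoly K[n]} :=
  (if col a == col b then lin a b q else 1)
  * \prod_(h | adj (col a) (col b) h) lin b a (hweight h).

Definition wheel_factor b a : {mpoly K[n]} :=
  \prod_(h | adj (col a) (col b) h) lin a b (q / hweight h).

(** Flipping a half-edge exchanges the weights w and q / w. In this form the factor is the edge part
    of [kernel b a]; as defined, it is up to scalars the edge part of [kernel a c] at z_c = q
    z_b. *)
Lemma wheel_factorE b a :
  wheel_factor b a = \prod_(h | adj (col b) (col a) h) lin a b (hweight h).
Proof.
rewrite /wheel_factor (reindex_inj (inv_inj hflipK)) /=.
apply: eq_big => h; first exact: adj_flip.
by rewrite hweight_flip invf_div mulrCA divff ?mulr1.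
Qed.

Definition in_wheel F : Prop := forall a b c,
  col b = col c -> b != c -> a != b -> a != c ->
  divides (wheel_factor b a) (elim_var c b q F).

(** The Z_< of the overview, with the total order encoded by an injective [key]. *)
Definition ordered_kernel (key : 'I_n -> nat) : {mpoly K[n]} :=
  \prod_(ab : 'I_n * 'I_n | (key ab.1 < key ab.2)%N) kernel ab.1 ab.2.

Inductive kernel_ideal : {mpoly K[n]} -> Prop :=
| kernel_ideal0 : kernel_ideal 0
| kernel_idealD key P F : injective key -> kernel_ideal F ->
    kernel_ideal (P * ordered_kernel key + F).

Lemma in_wheelD P F : in_wheel P -> in_wheel F -> in_wheel (P + F).
Proof.
by move=> hP hF a b c *; rewrite rmorphD; apply: dividesD; [apply: hP|apply: hF].
Qed.

Lemma in_wheelB P F : in_wheel P -> in_wheel F -> in_wheel (P - F).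
Proof.
by move=> hP hF a b c *; rewrite rmorphB; apply: dividesB; [apply: hP|apply: hF].
Qed.

Lemma in_wheelM P F : in_wheel F -> in_wheel (P * F).
Proof. by move=> hF a b c *; rewrite rmorphM; apply/divides_mull/hF. Qed.

Lemma in_wheel0 : in_wheel 0.
Proof. by move=> a b c *; rewrite rmorph0; apply: divides0. Qed.

Lemma in_wheel_sum (I : Type) (r : seq I) (p : pred I) (G : I -> {mpoly K[n]}) :
  (forall x, p x -> in_wheel (G x)) -> in_wheel (\sum_(i <- r | p i) G i).
Proof.
by move=> hG; apply: (big_ind in_wheel) => //; [exact: in_wheel0 | exact: in_wheelD].
Qed.

Lemma elim_kernel_zero b c : col b = col c -> b != c ->
  elim_var c b q (kernel c b) = 0.
Proof.
by move=> e ne; rewrite /kernel e eqxx rmorphM /= elim_var_lin ?mul0r // eq_sym.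
Qed.

Lemma elim_kernel_right a b c : col b = col c -> a != b -> a != c ->
  divides (wheel_factor b a) (elim_var c b q (kernel a c)).
Proof.
move=> e ab ac; rewrite rmorphM; apply: divides_mull; rewrite rmorph_prod -e.
apply: divides_prod => h _ /=; rewrite /lin !rmorphB /= !elim_varZ !elim_varX eqxx.
rewrite (negbTE ac); exists (- hweight h)%:MP; rewrite mulrC mul_mpolyC.
by rewrite scaleNr scalerBr opprB scalerA (mulrC (hweight h)) divfK ?hweight_neq0.
Qed.

Lemma elim_kernel_left a b c : col b = col c -> a != b -> a != c -> b != c ->
  divides (wheel_factor b a) (elim_var c b q (kernel b a)).
Proof.
move=> e ab ac bc; rewrite rmorphM; apply: divides_mull; rewrite rmorph_prod.
rewrite wheel_factorE; apply: divides_prod => h _ /=.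
rewrite /lin !rmorphB /= !elim_varZ !elim_varX (negbTE ac) (negbTE bc).
exact: divides_refl.
Qed.

(** If [c] precedes [b], the factor [kernel c b] vanishes at z_c = q z_b. Otherwise [a] precedes [c]
    or follows [b], and [kernel a c] or [kernel b a] contains the divisor. *)
Lemma ordered_kernel_wheel key : injective key -> in_wheel (ordered_kernel key).
Proof.
move=> kinj a b c e bc ab ac.
have dv x y : (key x < key y)%N ->
    divides (wheel_factor b a) (elim_var c b q (kernel x y)) ->
    divides (wheel_factor b a) (elim_var c b q (ordered_kernel key)).
  move=> hxy h; apply: divides_trans h _; apply: divides_morph.
  exact: (@divides_prod_mem _ _ _ (fun ab : 'I_n * 'I_n => kernel ab.1 ab.2) (x, y)).
have neq x y : x != y -> key x != key y by apply: contraNneq => /kinj ->.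
case: (ltngtP (key b) (key c)) => [hbc|hcb|/eqP]; last by rewrite (negbTE (neq _ _ bc)).
- case: (ltngtP (key a) (key c)) => [hac|hca|/eqP]; last by rewrite (negbTE (neq _ _ ac)).
    by apply: (dv a c) => //; apply: elim_kernel_right.
  by apply: (dv b a); [apply: ltn_trans hca | apply: elim_kernel_left].
- by apply: (dv c b) => //; rewrite elim_kernel_zero //; apply: divides0.
Qed.

Lemma kernel_ideal_wheel F : kernel_ideal F -> in_wheel F.
Proof.
elim=> [|key P G kinj _ hG]; first exact: in_wheel0.
by apply: in_wheelD => //; apply/in_wheelM/ordered_kernel_wheel.
Qed.

Lemma kernel_ideal_add P F : kernel_ideal P -> kernel_ideal F -> kernel_ideal (P + F).
Proof.
move=> hP hF; elim: hP => [|key P' G kinj _ hG]; first by rewrite add0r.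
by rewrite -addrA; apply: kernel_idealD.
Qed.

Lemma kernel_ideal_mul P F : kernel_ideal F -> kernel_ideal (P * F).
Proof.
elim=> [|key P' G kinj _ hG]; first by rewrite mulr0; apply: kernel_ideal0.
by rewrite mulrDr mulrA; apply: kernel_idealD.
Qed.

Lemma kernel_ideal_gen key P : injective key -> kernel_ideal (P * ordered_kernel key).
Proof.
by move=> kinj; rewrite -[X in kernel_ideal X]addr0; apply/kernel_idealD/kernel_ideal0.
Qed.

Lemma kernel_ideal_sum (I : Type) (r : seq I) (p : pred I) (G : I -> {mpoly K[n]}) :
  (forall x, p x -> kernel_ideal (G x)) -> kernel_ideal (\sum_(i <- r | p i) G i).
Proof.
move=> hG; apply: (big_ind kernel_ideal) => //.
- exact: kernel_ideal0.
- exact: kernel_ideal_add.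
Qed.

Definition permv (s : {perm 'I_n}) : {mpoly K[n]} -> {mpoly K[n]} :=
  subst_var s (fun=> 1).

HB.instance Definition _ s :=
  GRing.RMorphism.copy (permv s) (subst_var s (fun=> 1)).

Lemma permvX s a : permv s 'X_a = 'X_(s a).
Proof. by rewrite /permv subst_varX scale1r. Qed.

Lemma permvZ s k P : permv s (k *: P) = k *: permv s P.
Proof. exact: subst_varZ. Qed.

Lemma permvM s s' P : permv (s * s')%g P = permv s' (permv s P).
Proof.
by rewrite /permv subst_var_comp; apply: subst_var_ext => x /=; rewrite ?permM ?mulr1.
Qed.

Lemma permv1 P : permv 1%g P = P.
Proof.
rewrite -[RHS]subst_var_id /permv; apply: subst_var_ext => x //=; exact: perm1.
Qed.

Lemma permv_lin s a b (c : K) : permv s (lin a b c) = lin (s a) (s b) c.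
Proof. by rewrite /lin rmorphB /= permvZ !permvX. Qed.

Definition color_perm (s : {perm 'I_n}) := [forall a, col (s a) == col a].

Lemma color_permP s a : color_perm s -> col (s a) = col a.
Proof. by move=> /forallP /(_ a) /eqP. Qed.

Lemma permv_kernel s a b : color_perm s -> permv s (kernel a b) = kernel (s a) (s b).
Proof.
move=> cs; rewrite /kernel !(color_permP _ cs) rmorphM rmorph_prod /=; congr (_ * _).
  by case: ifP => _; rewrite ?permv_lin ?rmorph1.
by apply: eq_bigr => h _; rewrite permv_lin.
Qed.

Lemma permv_ordered_kernel s key : color_perm s ->
  permv s (ordered_kernel key) = ordered_kernel (key \o s^-1)%g.
Proof.
move=> cs; rewrite /ordered_kernel rmorph_prod /=.
rewrite [RHS](reindex_inj (h := fun ab => (s ab.1, s ab.2))) /=; last first.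
  by move=> [x y] [x' y'] /= [/perm_inj -> /perm_inj ->].
by apply: eq_big => [ab|ab _]; rewrite /= ?permK ?permv_kernel.
Qed.

Lemma kernel_ideal_perm s P : color_perm s -> kernel_ideal P -> kernel_ideal (permv s P).
Proof.
move=> cs; elim=> [|key P' G kinj _ hG]; first by rewrite rmorph0; apply: kernel_ideal0.
rewrite rmorphD rmorphM /= permv_ordered_kernel //; apply: kernel_idealD => //.
exact/inj_comp/perm_inj.
Qed.

Lemma permv_elim s a b (c : K) P :
  permv s (elim_var a b c P) = elim_var (s a) (s b) c (permv s P).
Proof.
apply: (mpoly_morph_ext (f := permv s \o elim_var a b c)
  (g := elim_var (s a) (s b) c \o permv s)) P => [k|x] /=.
  by rewrite elim_varC /permv !subst_varC elim_varC.
rewrite elim_varX permvX elim_varX (inj_eq perm_inj).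
by case: ifP => _; rewrite ?permvZ permvX.
Qed.

Lemma in_wheel_perm s P : color_perm s -> in_wheel P -> in_wheel (permv s P).
Proof.
move=> cs hP a b c e bc ab ac.
have := hP (s^-1 a)%g (s^-1 b)%g (s^-1 c)%g.
have sV x : col (s^-1 x)%g = col x by rewrite -(color_permP (s^-1 x)%g cs) permKV.
rewrite !sV !(inj_eq perm_inj) => /(_ e bc ab ac) /(divides_morph (permv s)).
rewrite /= permv_elim !permKV /wheel_factor rmorph_prod !sV /=.
by under eq_bigr => h _ do rewrite permv_lin !permKV.
Qed.

End Kernels.

Lemma scale_divides (K : fieldType) (n : nat) (k : K) (P S : {mpoly K[n]}) :
  k != 0 -> divides P S -> divides (k *: P) S.
Proof.
move=> k0 [x ->]; exists (k^-1 *: x).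
by rewrite -scalerAl -scalerAr scalerA divff // scale1r.
Qed.

(** * Restriction to strata *)

Section Strata.
Context (K : fieldType) (R : realFieldType) (nu : K -> R).
Context (Q : quiver) (q : K) (t : edge Q -> K).
Hypothesis t_neq0 : forall e, t e != 0.
Context (n : nat) (col : 'I_n -> vertex Q).
Context (T : eqType) (cls : 'I_n -> T) (val : 'I_n -> K).
Context {pt : torus_point nu q val}.
Hypothesis nu_weight : forall h, nu q < nu (hweight q t h) < 1.

Let nuM : forall x y, nu (x * y) = nu x * nu y := @point_nuM _ _ _ _ _ _ pt.
Let q_neq0 : q != 0 := @point_q_neq0 _ _ _ _ _ _ pt.
Let nuq_lt1 : nu q < 1 := @point_nuq_lt1 _ _ _ _ _ _ pt.
Let val_neq0 : forall a, val a != 0 := @point_val_neq0 _ _ _ _ _ _ pt.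

Implicit Types (a b c x y z : 'I_n) (f : {ffun 'I_n -> 'I_n}).
Implicit Types (P F : {mpoly K[n]}) (h : bool * edge Q).

Local Notation ok := (string_system q col cls val).
Local Notation md := (modulus nu val).
Local Notation hw := (hweight q t).
Local Notation Lin := (@lin K n).

(* The point is generic up to scale in each class of [cls]: there, X_a is [val a]
   times a parameter attached to [cls a]. So this says that [lin a b c] vanishes
   at the point. *)
Definition vanishes a b (c : K) : bool := (cls a == cls b) && (val a == c * val b).

(** Generated by linear forms, and not defined by a value at the point, so that invertibility modulo
    an ideal follows by induction. *)
Inductive nonvanishing : {mpoly K[n]} -> Prop :=
| nonvanishing1 : nonvanishing 1
| nonvanishingM P F : nonvanishing P -> nonvanishing F -> nonvanishing (P * F)
| nonvanishing_lin a b (c : K) : a != b -> c != 0 -> ~~ vanishes a b c ->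
    nonvanishing (lin a b c).

Lemma nonvanishing_prod (I : Type) (r : seq I) (p : pred I) (G : I -> {mpoly K[n]}) :
  (forall k, p k -> nonvanishing (G k)) -> nonvanishing (\prod_(x <- r | p x) G x).
Proof.
move=> hG; apply: (big_ind nonvanishing) => //.
- exact: nonvanishing1.
- exact: nonvanishingM.
Qed.

Lemma vanishes_modulus a b (c : K) : vanishes a b c -> md a = nu c * md b.
Proof. by move=> /andP[_ /eqP e]; rewrite /modulus e nuM. Qed.

(** Restriction to the stratum of [f]: the variables of a string keep the ratios they have at the
    point, and the heads remain as coordinates. *)
Definition restrict f : {mpoly K[n]} -> {mpoly K[n]} :=
  subst_var (shead f) (fun a => val a / val (shead f a)).

HB.instance Definition _ f :=
  GRing.RMorphism.copy (restrict f)
    (subst_var (shead f) (fun a => val a / val (shead f a))).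

Lemma restrictX f a : restrict f 'X_a = (val a / val (shead f a)) *: 'X_(shead f a).
Proof. exact: subst_varX. Qed.

Lemma restrictZ f k P : restrict f (k *: P) = k *: restrict f P.
Proof. exact: subst_varZ. Qed.

(** On its zero locus the strings with heads [y] and [z] are locked together in the ratio they have
    at the point. *)
Definition ratio_lin y z := Lin y z (val y / val z).

Lemma restrict_lin f a b (c : K) : vanishes a b c ->
  restrict f (lin a b c) =
  (val a / val (shead f a)) *: ratio_lin (shead f a) (shead f b).
Proof.
move=> /andP[_ /eqP e]; rewrite /ratio_lin /lin rmorphB /= restrictZ !restrictX.
rewrite scalerBr !scalerA; congr (_ - _ *: _).
by rewrite mulrA e; field; rewrite !val_neq0.
Qed.

Lemma restrict_vanish f a b (c : K) : vanishes a b c -> shead f a = shead f b ->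
  restrict f (lin a b c) = 0.
Proof.
move=> v e; rewrite restrict_lin // e /ratio_lin /lin divff //.
by rewrite scale1r subrr scaler0.
Qed.

Lemma vals_neq0 a b : val a / val b != 0.
Proof. by rewrite mulf_neq0 ?invr_eq0. Qed.

Lemma restrict_lin_divides f a b (c : K) : vanishes a b c ->
  divides (restrict f (lin a b c)) (ratio_lin (shead f a) (shead f b)).
Proof.
by move=> v; rewrite restrict_lin //; apply: scale_divides; [exact: vals_neq0 | exact: divides_refl].
Qed.

Lemma ratio_linC y z : divides (ratio_lin y z) (ratio_lin z y).
Proof.
exists (- (val z / val y))%:MP; rewrite mulrC mul_mpolyC /ratio_lin /lin.
rewrite scalerBr scalerA !scaleNr mulNr scaleNr opprK addrC.
by have -> : val z / val y * (val y / val z) = 1; [field; rewrite !val_neq0 | rewrite scale1r].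
Qed.

(** [qmult] and [hmult] count the factors of [kernel a b] that vanish at the point, the diagonal one
    and the edge ones. *)
Definition qmult a b : nat := (col a == col b) && vanishes a b q.
Definition hmult a b : nat :=
  \sum_(h | adj (col a) (col b) h) vanishes b a (hw h).

Definition vanishing_kernel a b : {mpoly K[n]} :=
  (if (col a == col b) && vanishes a b q then lin a b q else 1)
  * \prod_(h | adj (col a) (col b) h)
      (if vanishes b a (hw h) then lin b a (hw h) else 1).

Definition unit_kernel a b : {mpoly K[n]} :=
  (if (col a == col b) && ~~ vanishes a b q then lin a b q else 1)
  * \prod_(h | adj (col a) (col b) h)
      (if vanishes b a (hw h) then 1 else lin b a (hw h)).

Lemma kernel_split a b :
  kernel q t col a b = unit_kernel a b * vanishing_kernel a b.
Proof.
rewrite /kernel /unit_kernel /vanishing_kernel mulrACA -big_split /=.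
congr (_ * _); first by case: (col a == col b); case: (vanishes a b q); rewrite /= ?mul1r ?mulr1.
by apply: eq_bigr => h _; case: ifP; rewrite ?mul1r ?mulr1.
Qed.

Lemma nonvanishing_unit_kernel a b : a != b -> nonvanishing (unit_kernel a b).
Proof.
move=> ab; apply: nonvanishingM.
  case: ifP => [/andP[_ nv]|_]; last exact: nonvanishing1.
  exact: nonvanishing_lin.
apply: nonvanishing_prod => h _; case: ifP => [_|/negbT nv]; first exact: nonvanishing1.
by apply: nonvanishing_lin => //; [rewrite eq_sym | apply: hweight_neq0].
Qed.

Lemma restrict_kernel_divides f a b :
  divides (restrict f (vanishing_kernel a b))
    (ratio_lin (shead f a) (shead f b) ^+ (qmult a b + hmult a b)).
Proof.
rewrite exprD rmorphM; apply: divides_mul.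
  rewrite /qmult; case: ifP => [/andP[_ v]|_]; last by rewrite rmorph1; apply: divides1.
  exact: restrict_lin_divides.
rewrite rmorph_prod /hmult expr_sum; apply: divides_prod => h _ /=.
case: ifP => [v|_]; last by rewrite rmorph1; apply: divides1.
apply: divides_trans (restrict_lin_divides f v) _; exact: ratio_linC.
Qed.

(* Since [nu q < nu (hw h) < 1], two variables whose difference is killed by an
   edge factor never lie in the same [q]-string. *)
Lemma no_q_power (x y : R) i j : 0 < x -> 0 < y -> nu q * x < y < x ->
  y * nu q ^+ i != x * nu q ^+ j.
Proof.
move=> x0 y0 /andP[h1 h2]; apply/eqP => e.
have Q0 : 0 < nu q := nuq_gt0 (pt := pt).
have cancel k l (u v : R) : u * nu q ^+ (k + l) = v * nu q ^+ k -> u * nu q ^+ l = v.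
  rewrite addnC exprD mulrA => /mulIf; apply.
  by rewrite expf_neq0 // lt0r_neq0.
have pow_le k : nu q ^+ k.+1 <= nu q.
  by rewrite exprS; apply: ler_piMr; [exact: ltW | apply: exprn_ile1; exact: ltW].
case: (leqP i j) => hij.
  have := cancel i (j - i)%N x y; rewrite subnKC // => /(_ (esym e)).
  case: (j - i)%N => [|k] ey; first by move: h2; rewrite -ey expr0 mulr1 ltxx.
  move: h1; rewrite -ey (mulrC (nu q)) ltr_pM2l // => h1.
  by have := lt_le_trans h1 (pow_le k); rewrite ltxx.
have := cancel j (i - j)%N y x; rewrite subnKC ?(ltnW hij) // => /(_ e).
case: (i - j)%N (subn_gt0 j i) => [|k _ ex]; first by rewrite hij.
have := pow_le k; rewrite -(ler_pM2l y0) ex => h3.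
by have := lt_le_trans h2 h3; rewrite ltr_pMr // ltNge ltW.
Qed.

Lemma hmult_window a b : (0 < hmult a b)%N -> nu q * md a < md b < md a.
Proof.
rewrite lt0n sum_nat_eq0 negb_forall => /existsP[h]; rewrite negb_imply => /andP[_].
rewrite eqb0 negbK => /vanishes_modulus ->.
by have /andP[h1 h2] := nu_weight h; rewrite ltr_pM2r ?gtr_pMl ?h1 ?modulus_gt0.
Qed.

Lemma restrict_trans f g P : (forall a, shead f (shead g a) = shead f a) ->
  restrict f (restrict g P) = restrict f P.
Proof.
move=> h; rewrite /restrict subst_var_comp; apply: subst_var_ext => a /=; rewrite h //.
by field; rewrite !val_neq0.
Qed.

Lemma restrict_elim g b P : ok g -> g b != b ->
  restrict g (elim_var b (g b) q P) = restrict g P.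
Proof.
move=> okg nb; rewrite /restrict /elim_var subst_var_comp.
apply: subst_var_ext => a /=; case: (eqVneq a b) => [->|_]; rewrite ?mul1r ?(head_f okg) //.
by have /and3P[_ _ /eqP ->] := sys_link okg nb; rewrite mulrA.
Qed.

Lemma modulus_cross f a b : ok f -> shead f a = shead f b ->
  md b * nu q ^+ lv f a = md a * nu q ^+ lv f b.
Proof.
move=> okf e; rewrite (modulus_lv okf b) (modulus_lv okf a) e; ring.
Qed.

Lemma hmult_string f a b : ok f -> shead f a = shead f b -> hmult a b = 0%N.
Proof.
move=> okf e; apply/eqP; rewrite -leqn0 leqNgt; apply/negP => /hmult_window w.
have := no_q_power (lv f a) (lv f b) (modulus_gt0 (pt := pt) a) (modulus_gt0 (pt := pt) b) w.
by rewrite (modulus_cross okf e) eqxx.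
Qed.

(** Inside a string the order runs away from the head, so moduli decrease, whereas the diagonal
    factor of [kernel a b] vanishes only when [a] has smaller modulus than [b]. *)
Lemma qmult_string f a b : ok f -> shead f a = shead f b ->
  (string_key nu val f a < string_key nu val f b)%N -> qmult a b = 0%N.
Proof.
move=> okf e; rewrite (string_key_string okf e) rk_lt /qmult => h.
case: andP => // -[_ /vanishes_modulus ea]; move: h.
by rewrite ea ltNge ler_piMl // ?ltW ?modulus_gt0.
Qed.

(** Both moduli lie strictly between [nu q * md a] and [md a], a window too narrow for two levels of
    one string. *)
Lemma hmult_uniq f a b b' : ok f -> shead f b = shead f b' ->
  (0 < hmult a b)%N -> (0 < hmult a b')%N -> b = b'.
Proof.
move=> okf e /hmult_window /andP[h1 h2] /hmult_window /andP[h3 h4].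
have win x y : shead f x = shead f y -> md y < md x -> md x < md a -> nu q * md a < md y -> False.
  move=> exy yx xa ay.
  have := @no_q_power (md x) (md y) (lv f x) (lv f y) (modulus_gt0 (pt := pt) x)
    (modulus_gt0 (pt := pt) y).
  rewrite (modulus_cross okf exy) eqxx yx andbT => /(_ _)/negP; apply => //.
  by apply: lt_trans ay; rewrite ltr_pM2l ?nuq_gt0.
case: (ltgtP (md b) (md b')) => [lt|lt|]; last exact: (modulus_inj_string okf).
- by case: (win _ _ (esym e) lt h4 h1).
- by case: (win _ _ e lt h2 h3).
Qed.

(** Dissolving all strings but that of [z] keeps the other variables independent, so that
    divisibilities by forms in different variables can be combined before restricting further. *)
Definition block f z : {ffun 'I_n -> 'I_n} :=
  [ffun x => if shead f x == z then f x else x].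

Lemma block_system f z : ok f -> ok (block f z).
Proof.
move=> okf; apply/andP; split; apply/forallP => a.
  apply/implyP; rewrite ffunE; case: ifP => _; rewrite ?eqxx // => na.
  exact: (sys_link okf).
apply/forallP => b; apply/implyP; rewrite !ffunE.
case: ifP => _; case: ifP => _ /and3P[/eqP e na nb]; rewrite ?eqxx // in na nb *.
by apply/eqP/(sys_inj okf).
Qed.

Lemma block_head f z x : ok f -> shead f z = z ->
  shead (block f z) x = if shead f x == z then z else x.
Proof.
move=> okf hz; have okb := block_system z okf.
elim/(sys_ind okf): x => [x e|x ne IH].
  rewrite (head_of_fix e) head_of_fix ?ffunE ?e ?if_same //.
  by case: eqP.
case: ifP => hx; last by rewrite head_of_fix // ffunE hx.
by rewrite -(head_f okb) ffunE hx IH (head_f okf) hx.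
Qed.

Lemma lin_divides_scale a b (c k : K) : divides (lin a b c) (k *: Lin a b c).
Proof. by exists k%:MP; rewrite mulrC mul_mpolyC. Qed.

(** At most one [b] in the string of [z] contributes. Its modulus is below that of [a], hence below
    that of [z], so [b] has a predecessor, and the wheel condition at z_b = q z_(f b) supplies the
    edge factors. *)
Lemma edge_row F f z a : in_wheel q t col F -> ok f -> shead f z = z ->
  shead f a != z -> md a <= md z ->
  divides (ratio_lin a z ^+ (\sum_(b | shead f b == z) hmult a b))
    (restrict (block f z) F).
Proof.
move=> hF okf hz ha haz.
case: (pickP [pred b | (shead f b == z) && (0 < hmult a b)%N]) => [b /= /andP[/eqP hb mb]|h0].
  rewrite (bigD1 b) /= ?hb // big1 ?addn0; last first.
    move=> c /andP[/eqP hc cb]; apply/eqP; rewrite -leqn0 leqNgt; apply/negP => mc.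
    by move: cb; rewrite (hmult_uniq okf _ mc mb) ?eqxx // hc hb.
  have nb : f b != b.
    apply/eqP => e; have /andP[_] := hmult_window mb; rewrite ltNge; case/negP.
    by rewrite -(head_of_fix e) hb.
  have okg := block_system z okf; set g := block f z in okg *.
  have gb : g b = f b by rewrite ffunE hb eqxx.
  have hgb : shead g b = z by rewrite block_head // hb eqxx.
  have hga : shead g a = a by rewrite block_head // (negbTE ha).
  have ab : a != b by apply: contraNneq ha => ->; rewrite hb.
  have afb : a != f b by apply: contraNneq ha => ->; rewrite (head_f okf) hb.
  have /and3P[/eqP cb /eqP clb /eqP vb] := sys_link okf nb.
  have := hF a (f b) b cb nb afb ab => /(divides_morph (restrict g)) /=.
  rewrite -gb restrict_elim ?gb //; apply: divides_trans.
  rewrite /wheel_factor rmorph_prod /hmult expr_sum cb; apply: divides_prod => h _ /=.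
  case: (boolP (vanishes b a (hw h))) => [/andP[/eqP cl /eqP va]|_]; last exact: divides1.
  have v : vanishes a (f b) (q / hw h).
    rewrite /vanishes clb cl eqxx /=; apply/eqP.
    rewrite mulrAC -vb va mulrAC divff ?mul1r //; exact: hweight_neq0.
  rewrite restrict_lin // hga -gb (head_f okg) hgb; exact: lin_divides_scale.
rewrite big1 ?expr0; first exact: divides1.
by move=> b hb; apply/eqP; rewrite eqn0Ngt; have /= := h0 b; rewrite hb /= => ->.
Qed.

Lemma restrict_ratio f a z : shead f z = z ->
  restrict f (ratio_lin a z) = (val a / val (shead f a)) *: ratio_lin (shead f a) z.
Proof.
move=> hz; rewrite /ratio_lin /lin rmorphB /= restrictZ !restrictX hz scalerBr !scalerA.
by congr (_ - _ *: _); field; rewrite !val_neq0.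
Qed.

(** While the string of [y] is dissolved, the forms of its different rows involve different pairs of
    variables and multiply; restricting to the whole stratum turns each into a multiple of
    [ratio_lin y z]. *)
Lemma edge_pair F f y z : in_wheel q t col F -> ok f -> shead f y = y ->
  shead f z = z -> y != z -> md y <= md z ->
  divides (ratio_lin y z ^+ (\sum_(a | shead f a == y) \sum_(b | shead f b == z) hmult a b))
    (restrict f F).
Proof.
move=> hF okf hy hz yz hm.
pose m a := (\sum_(b | shead f b == z) hmult a b)%N.
have az a : shead f a = y -> a != z.
  by move=> ha; apply: contraNneq yz => e; rewrite -ha e hz.
have hd : divides (\prod_(a <- enum [pred a | shead f a == y]) ratio_lin a z ^+ m a)
    (restrict (block f z) F).
  apply: (@prod_lin_divides _ _ _ _ id (fun=> z) (fun a => val a / val z) m).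
  - exact: enum_uniq.
  - by move=> a; rewrite mem_enum inE => /eqP ha; rewrite vals_neq0 az.
  - move=> a b; rewrite !mem_enum !inE => /eqP ha /eqP hb ab.
    by rewrite /= (negbTE ab) (negbTE (az _ ha)).
  - move=> a; rewrite mem_enum inE => /eqP ha; apply: edge_row => //; first by rewrite ha.
    by apply: le_trans hm; rewrite -ha; exact: (modulus_head okf).
move: hd => /(divides_morph (restrict f)) /=; rewrite restrict_trans; last first.
  by move=> a; rewrite block_head //; case: eqP => // ->; rewrite hz.
apply: divides_trans; rewrite rmorph_prod expr_sum big_enum_cond /=.
rewrite [X in divides _ X](eq_bigl (fun a => shead f a == y)); last by move=> a; rewrite andbT.
apply: divides_prod => a /eqP ha; rewrite rmorphXn /= restrict_ratio // ha exprZn.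
by exists ((val a / val y) ^+ m a)%:MP; rewrite [RHS]mulrC mul_mpolyC.
Qed.

(** Once [y] and [z] are proportional as at the point, it no longer matters to which of the two
    heads a variable is attached. *)
Lemma elim_merge f f' y z P : y != z ->
  (forall x, shead f' x = shead f x \/ shead f x = y /\ shead f' x = z) ->
  elim_var y z (val y / val z) (restrict f P) =
  elim_var y z (val y / val z) (restrict f' P).
Proof.
move=> yz hh; rewrite /restrict /elim_var !subst_var_comp.
apply: subst_var_ext => x /=; case: (hh x) => [->//|[-> ->]].
  by rewrite eqxx eq_sym (negbTE yz).
by rewrite eqxx [z == y]eq_sym (negbTE yz); field; rewrite !val_neq0.
Qed.

Section RootPair.
Context (F : {mpoly K[n]}) (f : {ffun 'I_n -> 'I_n}) (y z : 'I_n).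
Hypothesis F_diag : forall a b, a != b -> col a = col b -> vanishes a b 1 ->
  elim_var a b 1 F = 0.
Hypothesis okf : ok f.
Hypothesis hy : shead f y = y.
Hypothesis hz : shead f z = z.
Hypothesis yz : y != z.
Hypothesis F_above : forall f', ok f' -> (string_weight nu val f < string_weight nu val f')%N ->
  restrict f' F = 0.

(** [S] lists the diagonal factors whose zeros are needed, [D] the diagonals on which antisymmetry
    makes [F] vanish; the proof compares their sizes. *)
Let S := [set ab | [&& shead f ab.1 == y, shead f ab.2 == z,
  col ab.1 == col ab.2 & vanishes ab.1 ab.2 q]].
Let D := [set ab | [&& shead f ab.1 == y, shead f ab.2 == z,
  col ab.1 == col ab.2 & vanishes ab.1 ab.2 1]].
Let diag := \prod_(ab in D) Lin ab.1 ab.2 1.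

Lemma sum_qmult :
  (\sum_(a | shead f a == y) \sum_(b | shead f b == z) qmult a b)%N = #|S|.
Proof.
rewrite pair_big_dep /= -sum1_card (eq_bigr (fun ab => if
  (col ab.1 == col ab.2) && vanishes ab.1 ab.2 q then 1 else 0)%N); last first.
  by move=> ab _; rewrite /qmult; case: ifP.
by rewrite -big_mkcondr; apply: eq_bigl => ab; rewrite inE -andbA.
Qed.

Lemma diag_divides : divides diag F.
Proof.
rewrite /diag -big_enum.
have hD ab : ab \in enum D -> [/\ shead f ab.1 = y, shead f ab.2 = z,
    col ab.1 = col ab.2 & vanishes ab.1 ab.2 1].
  by rewrite mem_enum inE => /and4P[/eqP -> /eqP -> /eqP -> ->].
have neD ab : ab \in enum D -> ab.1 != ab.2.
  by move=> /hD[h1 h2 _ _]; apply: contraNneq yz => e; rewrite -h1 e h2.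
have := @prod_lin_divides K n _ (enum D) fst snd (fun=> 1) (fun=> 1%N) F.
rewrite (eq_bigr (fun ab => Lin ab.1 ab.2 1)); last by move=> ab _; rewrite expr1.
apply.
- exact: enum_uniq.
- by move=> ab h; rewrite neD ?oner_neq0.
- move=> ab ab' h h' ne; have [h1 h2 _ _] := hD _ h; have [h1' h2' _ _] := hD _ h'.
  apply/negP => /orP[/andP[/eqP e1 /eqP e2]|/andP[/eqP e1 /eqP e2]].
    by case/eqP: ne; apply: injective_projections.
  by case/eqP: yz; rewrite -h1 e1.
- move=> ab h; have [h1 h2 hc hv] := hD _ h; rewrite expr1.
  by apply/lin_dividesP; [apply: neD | apply: F_diag => //; apply: neD].
Qed.

Lemma restrict_diag : divides (ratio_lin y z ^+ #|D|) (restrict f diag).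
Proof.
rewrite -prodr_const rmorph_prod; apply: divides_prod => ab.
rewrite inE => /and4P[/eqP h1 /eqP h2 _ v] /=.
by rewrite restrict_lin // h1 h2; apply: lin_divides_scale.
Qed.

(** For a pair in [S], the modulus of [a] is below that of [b], hence below that of the heads. So
    [a] has a predecessor, whose value is that of [b], and ([f a], [b]) is in [D]. *)
Lemma card_S_eq : md y = md z -> (#|S| <= #|D|)%N.
Proof.
move=> e; have nh ab : ab \in S -> f ab.1 != ab.1.
  rewrite inE => /and4P[/eqP h1 /eqP h2 _ /vanishes_modulus v].
  apply/eqP => fx; have := modulus_head (pt := pt) okf ab.2.
  rewrite h2 -e -h1 (head_of_fix fx) v; apply/negP; rewrite -ltNge.
  by rewrite gtr_pMl // modulus_gt0.
rewrite -(@card_in_imset _ _ (fun ab => (f ab.1, ab.2))).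
  apply/subset_leq_card/subsetP => _ /imsetP[ab hab ->].
  have nab := nh _ hab; have /and3P[/eqP c1 /eqP c2 /eqP v1] := sys_link okf nab.
  move: hab; rewrite !inE /= (head_f okf) c1 => /and4P[-> -> -> /andP[/eqP c3 /eqP v2]] /=.
  by rewrite /vanishes c2 c3 eqxx mul1r /=; apply/eqP/(mulfI q_neq0); rewrite -v1 -v2.
move=> [a b] [a' b'] h h' [ea eb]; congr (_, _) => //.
by apply: (sys_inj okf) => //; [exact: nh h | exact: nh h'].
Qed.

(** Here [a] may be a head, so [b] is shifted instead: its successor has the value of [a]. This
    fails only when [b] is the tail of its string, and then [a] is determined by its value. *)
Lemma card_S_lt : md y < md z ->
  (#|S| <= #|D|)%N \/
  (#|S| <= #|D|.+1)%N /\ exists2 ab, ab \in S & is_tail f ab.2.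
Proof.
move=> yzlt; pose S0 := [set ab in S | ~~ is_tail f ab.2].
pose S1 := [set ab in S | is_tail f ab.2].
pose succ b := odflt b [pick c | (f c == b) && (c != b)].
have succP b : ~~ is_tail f b -> f (succ b) = b /\ succ b != b.
  move=> /not_tail[c fc cb]; rewrite /succ; case: pickP => [d /= /andP[/eqP]|/(_ c)] //.
  by rewrite fc eqxx cb.
have h0 : (#|S0| <= #|D|)%N.
  rewrite -(@card_in_imset _ _ (fun ab => (ab.1, succ ab.2))).
    apply/subset_leq_card/subsetP => _ /imsetP[ab hab ->].
    move: hab; rewrite inE => /andP[hab nt]; have [fs ns] := succP _ nt.
    have nfs : f (succ ab.2) != succ ab.2 by rewrite fs eq_sym.
    have := sys_link okf nfs; rewrite fs => /and3P[/eqP c1 /eqP c2 /eqP v1].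
    move: hab; rewrite !inE /= -(head_f okf (succ _)) fs -c1.
    move=> /and4P[-> -> -> /andP[/eqP c3 /eqP v2]] /=.
    by rewrite /vanishes -c2 c3 eqxx mul1r v1 v2 /=.
  move=> [a b] [a' b']; rewrite !inE => /andP[_ nb] /andP[_ nb'] /= [-> e].
  have [e1 _] := succP _ nb; have [e2 _] := succP _ nb'.
  by congr (_, _); rewrite -[LHS]e1 -[RHS]e2 e.
have S01 : (#|S| <= #|S0| + #|S1|)%N.
  rewrite -(cardsID [set ab | is_tail f ab.2] S) addnC leq_add //.
    by apply: subset_leq_card; apply/subsetP => ab; rewrite !inE andbC.
  by apply: subset_leq_card; apply/subsetP => ab; rewrite !inE.
have h1 : (#|S1| <= 1)%N.
  apply/card_le1_eqP => -[a b] [a' b']; rewrite !inE /=.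
  move=> /andP[/and4P[/eqP ha /eqP hb _ /andP[_ /eqP v]] tb].
  move=> /andP[/and4P[/eqP ha' /eqP hb' _ /andP[_ /eqP v']] tb'].
  have eb : b = b' by apply: (tail_uniq okf) => //; rewrite hb.
  by congr (_, _) => //; apply: (val_inj_string okf); rewrite ?ha // v v' eb.
case: (set_0Vmem S1) => [e|[ab]].
  by left; move: S01; rewrite e cards0 addn0 => h; apply: leq_trans h0.
rewrite inE => /andP[habS tb]; right; split; last by exists ab.
by apply: leq_trans S01 _; rewrite -addn1 leq_add.
Qed.

(** The missing zero, if any, is one of the quotient of [F] by the diagonal forms: it vanishes on
    the stratum obtained by attaching [a] to the tail [b], and by [elim_merge] this stratum agrees
    with that of [f] where [ratio_lin y z] is zero. *)
Lemma root_pair : md y <= md z ->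
  divides (ratio_lin y z ^+ (\sum_(a | shead f a == y) \sum_(b | shead f b == z) qmult a b))
    (restrict f F).
Proof.
rewrite sum_qmult; have [G FG] := diag_divides.
have hD m : (m <= #|D|)%N -> divides (ratio_lin y z ^+ m) (restrict f F).
  move=> hm; apply: divides_trans (divides_exp _ hm) _.
  by rewrite FG rmorphM; apply: divides_mulr; apply: restrict_diag.
rewrite le_eqVlt => /orP[/eqP e|hlt]; first exact/hD/card_S_eq.
case: (card_S_lt hlt) => [|[hm [[a b]]]]; first exact: hD.
rewrite inE /= => /and4P[/eqP ha /eqP hb /eqP cab /andP[/eqP clab /eqP vab]] tb.
have lk : link q col cls val b a by rewrite /link cab clab vab !eqxx.
have hrk : (rk nu val (shead f a) < rk nu val (shead f b))%N by rewrite rk_lt ha hb.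
have [okf' hw hh] := merge_system okf tb lk hrk.
set f' := [ffun x => _] in okf' hw hh; rewrite ha hb in hh.
(* The diagonal forms do not vanish identically on the joined stratum, since distinct variables of
   one string have distinct values. *)
have G0 : restrict f' G = 0.
  have := F_above okf' hw; rewrite FG rmorphM /= => /eqP.
  rewrite mulf_eq0 => /orP[|/eqP //]; rewrite rmorph_prod.
  rewrite prodf_seq_eq0 => /hasP[ab _ /andP[]].
  rewrite inE => /and4P[/eqP h1 /eqP h2 _ v] /=; rewrite restrict_lin //.
  rewrite scaler_eq0 (negbTE (vals_neq0 _ _)) /= => /eqP l0.
  case: (eqVneq (shead f' ab.1) (shead f' ab.2)) => [e|ne]; last first.
    by have := lin_neq0 (val (shead f' ab.1) / val (shead f' ab.2)) ne; rewrite -/(ratio_lin _ _) l0 eqxx.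
  have e12 : ab.1 = ab.2.
    by apply: (val_inj_string okf') => //; move: v => /andP[_ /eqP ->]; rewrite mul1r.
  by case/eqP: yz; rewrite -h1 e12.
have hG : divides (ratio_lin y z) (restrict f G).
  by apply/lin_dividesP => //; rewrite (elim_merge _ yz hh) G0 rmorph0.
apply: divides_trans (divides_exp _ hm) _; rewrite exprSr FG rmorphM.
by apply: divides_mul hG; apply: restrict_diag.
Qed.

End RootPair.

End Strata.

(** * Descending induction over the strata *)

Section Stratification.
Context (K : fieldType) (R : realFieldType) (nu : K -> R).
Context (Q : quiver) (q : K) (t : edge Q -> K).
Hypothesis t_neq0 : forall e, t e != 0.
Context (n : nat) (col : 'I_n -> vertex Q).
Context (T : eqType) (cls : 'I_n -> T) (val : 'I_n -> K).
Context {pt : torus_point nu q val}.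
Hypothesis nu_weight : forall h, nu q < nu (hweight q t h) < 1.
Hypothesis charK : [pchar K] =i pred0.

Let q_neq0 : q != 0 := @point_q_neq0 _ _ _ _ _ _ pt.
Let val_neq0 : forall a, val a != 0 := @point_val_neq0 _ _ _ _ _ _ pt.

Implicit Types (a b c x y z : 'I_n) (f : {ffun 'I_n -> 'I_n}).
Implicit Types (P F G U : {mpoly K[n]}) (h : bool * edge Q) (s : {perm 'I_n}).

Local Notation ok := (string_system q col cls val).
Local Notation md := (modulus nu val).
Local Notation hw := (hweight q t).
Local Notation weight := (string_weight nu val).
Local Notation restrict := (restrict val).
Local Notation ideal := (kernel_ideal q t col).
Local Notation wheel := (in_wheel q t col).
Local Notation nonvan := (nonvanishing cls val).
Local Notation vanish := (vanishes cls val).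

Let qm := qmult q col cls val.
Let hm := hmult q t col cls val.

(** A vanishing diagonal factor makes the moduli of the two heads differ by a power of [nu q], which
    [no_q_power] excludes as soon as an edge factor vanishes. *)
Lemma mult_exclusive f y z : ok f ->
  (\sum_(a | shead f a == y) \sum_(b | shead f b == z) qm a b = 0)%N \/
  (\sum_(a | shead f a == y) \sum_(b | shead f b == z) hm a b = 0)%N.
Proof.
move=> okf.
case: (pickP [pred ab : 'I_n * 'I_n | [&& shead f ab.1 == y, shead f ab.2 == z
    & 0 < hm ab.1 ab.2]%N]) => [[a b] /= /and3P[/eqP ha /eqP hb hab]|h0]; last first.
  right; apply: big1 => a ha; apply: big1 => b hb; apply/eqP.
  by rewrite eqn0Ngt; have /= := h0 (a, b); rewrite ha hb /= => ->.
left; apply: big1 => a' /eqP ha'; apply: big1 => b' /eqP hb'.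
rewrite /qm /qmult; case: andP => // -[_ /vanishes_modulus v].
have mp x := modulus_gt0 (pt := pt) x.
have := no_q_power (pt := pt) (lv f a + (lv f b').+1) (lv f b + lv f a') (mp a) (mp b)
  (hmult_window (pt := pt) nu_weight hab).
move: v; rewrite !(modulus_lv okf a') (modulus_lv okf b') (modulus_lv okf a).
rewrite (modulus_lv okf b) ha hb ha' hb' => v; case/eqP.
rewrite !exprD exprS.
transitivity (nu q ^+ lv f b * nu q ^+ lv f a * (nu q * (nu q ^+ lv f b' * md z))).
  by ring.
by rewrite -v; ring.
Qed.

(** Pairs inside one string contribute no vanishing factor in this order. The others are grouped by
    their heads; forms for different pairs of heads are coprime, and for each pair only one of
    [edge_pair] and [root_pair] is called for. *)
Lemma vanishing_divides F f :
  wheel F -> ok f ->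
  (forall a b, a != b -> col a = col b -> vanish a b 1 -> elim_var a b 1 F = 0) ->
  (forall f', ok f' -> (weight f < weight f')%N -> restrict f' F = 0) ->
  divides (restrict f (\prod_(ab : 'I_n * 'I_n |
      (string_key nu val f ab.1 < string_key nu val f ab.2)%N)
      vanishing_kernel q t col cls val ab.1 ab.2)) (restrict f F).
Proof.
move=> hF okf hdiag habove; pose key := string_key nu val f.
pose m (ab : 'I_n * 'I_n) := (qm ab.1 ab.2 + hm ab.1 ab.2)%N.
pose Rr (yz : 'I_n * 'I_n) := [&& shead f yz.1 == yz.1, shead f yz.2 == yz.2
  & head_key nu val f yz.1 < head_key nu val f yz.2]%N.
pose hd (ab : 'I_n * 'I_n) := (shead f ab.1, shead f ab.2).
pose ratio (yz : 'I_n * 'I_n) := ratio_lin val yz.1 yz.2.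
pose Pk (ab : 'I_n * 'I_n) := (key ab.1 < key ab.2)%N && (shead f ab.1 != shead f ab.2).
pose M yz := (\sum_(ab | Pk ab && (hd ab == yz)) m ab)%N.
apply: (@divides_trans _ (\prod_(yz in Rr) ratio yz ^+ M yz)).
  apply: (@divides_trans _ (\prod_(ab | (key ab.1 < key ab.2)%N) ratio (hd ab) ^+ m ab)).
    rewrite rmorph_prod; apply: divides_prod => ab _; exact: restrict_kernel_divides.
  rewrite (bigID (fun ab => shead f ab.1 == shead f ab.2)) /= big1 ?mul1r; last first.
    move=> ab /andP[hk /eqP e]; rewrite /m /qm /hm.
    by rewrite (qmult_string okf e hk) (hmult_string nu_weight okf e) expr0.
  rewrite (partition_big hd Rr) /=; last first.
    move=> ab /andP[hk ne]; rewrite /Rr /= !(head_head okf) !eqxx /=.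
    by rewrite -string_key_heads.
  apply: divides_prod => yz _; rewrite /M expr_sum.
  by apply: divides_prod => ab /andP[_ /eqP <-]; apply: divides_refl.
rewrite -big_enum.
have hR yz : yz \in enum Rr -> [/\ shead f yz.1 = yz.1, shead f yz.2 = yz.2
    & (head_key nu val f yz.1 < head_key nu val f yz.2)%N].
  by rewrite mem_enum => /and3P[/eqP ? /eqP ? ?].
have hne yz : yz \in enum Rr -> yz.1 != yz.2.
  by move=> /hR[_ _ h]; apply: contraTneq h => ->; rewrite ltnn.
apply: (@prod_lin_divides _ _ _ (enum Rr) fst snd (fun yz => val yz.1 / val yz.2) M).
- exact: enum_uniq.
- by move=> yz /hne -> /=; rewrite mulf_neq0 ?invr_eq0 ?val_neq0.
- move=> yz yz' h h' ne; have [_ _ k1] := hR _ h; have [_ _ k2] := hR _ h'.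
  apply/negP => /orP[/andP[/eqP e1 /eqP e2]|/andP[/eqP e1 /eqP e2]].
    by case/eqP: ne; apply: injective_projections.
  by move: k1; rewrite e1 e2 ltnNge ltnW.
move=> [y z] h; have /= [hy hz hk] := hR _ h; have /= yz := hne _ h.
have hmd : md y <= md z by rewrite -rk_le; have [] := head_key_le okf hk.
have hM : (M (y, z) <= \sum_(a | shead f a == y) \sum_(b | shead f b == z) qm a b
    + \sum_(a | shead f a == y) \sum_(b | shead f b == z) hm a b)%N.
  rewrite -big_split /=; under eq_bigr => a _ do rewrite -big_split /=.
  rewrite pair_big_dep /= /M; rewrite [leqRHS](bigID Pk) /= -[leqLHS]addn0 leq_add //.
  by rewrite leq_eqVlt; apply/orP; left; apply/eqP/eq_bigl => ab; rewrite /hd xpair_eqE andbC.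
apply: divides_trans (divides_exp _ hM) _.
case: (mult_exclusive y z okf) => ->; rewrite ?add0n ?addn0.
  exact: edge_pair.
exact: root_pair.
Qed.

(** [G] is a multiple of the ordered kernel for the key of [f], and [U] collects its nonvanishing
    factors. By [forward_system], any other [f'] of at least the same weight has a link that goes
    backward in this order; the corresponding diagonal factor is zero on the stratum of [f']. *)
Lemma stratum F f :
  wheel F -> ok f ->
  (forall a b, a != b -> col a = col b -> vanish a b 1 -> elim_var a b 1 F = 0) ->
  (forall f', ok f' -> (weight f < weight f')%N -> restrict f' F = 0) ->
  exists U G, [/\ nonvan U, ideal G, restrict f G = restrict f (U * F) &
    forall f', ok f' -> f' != f -> (weight f <= weight f')%N -> restrict f' G = 0].
Proof.
move=> hF okf hdiag habove.
have [h0 eh0] := vanishing_divides hF okf hdiag habove.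
set key := string_key nu val f in eh0.
pose U := \prod_(ab : 'I_n * 'I_n | (key ab.1 < key ab.2)%N)
  unit_kernel q t col cls val ab.1 ab.2.
have kinj : injective key by apply: (string_key_inj okf).
exists U, (h0 * ordered_kernel q t col key); split.
- apply: nonvanishing_prod => ab hk; apply: nonvanishing_unit_kernel => //.
  by apply: contraTneq hk => ->; rewrite ltnn.
- exact: kernel_ideal_gen.
- have idem P : restrict f (restrict f P) = restrict f P.
    by apply: restrict_trans => a; rewrite (head_head okf).
  have -> : ordered_kernel q t col key = U * \prod_(ab | (key ab.1 < key ab.2)%N)
      vanishing_kernel q t col cls val ab.1 ab.2.
    by rewrite -big_split; apply: eq_bigr => ab _; apply: kernel_split.
  rewrite !rmorphM /= -(idem F) eh0 rmorphM /= idem; ring.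
- move=> f' okf' ne hw.
  have /existsP[a /andP[na hk]] : [exists a, (f' a != a) && (key a < key (f' a))%N].
    apply: contraNT ne => /existsPn h; apply/eqP/(forward_system okf okf') => // a na.
    have := h a; rewrite na /= -leqNgt leq_eqVlt => /orP[/eqP /kinj e|//].
    by rewrite e eqxx in na.
  have /and3P[/eqP c1 /eqP c2 /eqP v] := sys_link okf' na.
  rewrite rmorphM /= /ordered_kernel (bigD1 (a, f' a)) //= /kernel c1 eqxx.
  rewrite !rmorphM /= (restrict_vanish (cls := cls) (c := q)) ?mul0r ?mulr0 //.
    by rewrite /vanishes c2 v !eqxx.
  by rewrite (head_f okf').
Qed.

(** The color-preserving stabilizer of the point: other permutations could move a nonvanishing form
    to a vanishing one. *)
Definition point_perm s :=
  [forall a, [&& col (s a) == col a, cls (s a) == cls a & val (s a) == val a]].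

Lemma point_permP s a : point_perm s ->
  [/\ col (s a) = col a, cls (s a) = cls a & val (s a) = val a].
Proof. by move=> /forallP /(_ a) /and3P[/eqP -> /eqP -> /eqP ->]. Qed.

Lemma point_perm_col s : point_perm s -> color_perm col s.
Proof. by move=> h; apply/forallP => a; have [-> _ _] := point_permP a h. Qed.

Lemma point_perm1 : point_perm 1%g.
Proof. by apply/forallP => a; rewrite perm1 !eqxx. Qed.

Lemma point_permM s s' : point_perm s' -> point_perm (s * s')%g = point_perm s.
Proof.
move=> h'; apply: eq_forallb => a; rewrite permM.
by have [-> -> ->] := point_permP (s a) h'.
Qed.

Lemma point_permV s : point_perm s -> point_perm s^-1%g.
Proof. by move=> h; rewrite -(point_permM _ h) mulVg point_perm1. Qed.

Lemma nonvanishing_perm s P : point_perm s -> nonvan P -> nonvan (permv s P).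
Proof.
move=> hs; elim=> [|P1 P2 _ h1 _ h2|a b c ab c0 nv].
- by rewrite rmorph1; apply: nonvanishing1.
- by rewrite rmorphM; apply: nonvanishingM.
- rewrite permv_lin; apply: nonvanishing_lin; rewrite ?(inj_eq perm_inj) //.
  have [_ e1 e2] := point_permP a hs; have [_ e3 e4] := point_permP b hs.
  by rewrite /vanishes e1 e2 e3 e4.
Qed.

Lemma restrict_perm s f P : point_perm s -> ok f ->
  exists f', [/\ ok f', weight f' = weight f &
    restrict f (permv s P) = permv s (restrict f' P)].
Proof.
move=> hs okf; pose f' : {ffun 'I_n -> 'I_n} := [ffun a => s^-1 (f (s a))]%g.
have hs' := point_permV hs.
have fE a : s (f' a) = f (s a) by rewrite ffunE permKV.
have hE a : s (shead f' a) = shead f (s a).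
  have hk k : s (iter k f' a) = iter k f (s a) by elim: k => //= k <-; rewrite fE.
  exact: hk.
have nE a : (f' a == a) = (f (s a) == s a) by rewrite -fE (inj_eq perm_inj).
have inv a : [/\ col (f' a) = col (f (s a)), cls (f' a) = cls (f (s a))
    & val (f' a) = val (f (s a))].
  by have [<- <- <-] := point_permP (f' a) hs; rewrite fE.
exists f'; split.
- apply/andP; split; apply/forallP => a.
    apply/implyP; rewrite nE => /(sys_link okf); rewrite /link.
    by have [-> -> ->] := inv a; have [-> -> ->] := point_permP a hs.
  apply/forallP => b; apply/implyP; rewrite !nE => /and3P[/eqP e na nb].
  apply/eqP/(@perm_inj _ s)/(sys_inj okf) => //.
  by rewrite -!fE e.
- have rkE a : rk nu val (s a) = rk nu val a.
    rewrite /rk /modulus; have [_ _ ->] := point_permP a hs.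
    by apply: eq_card => b; rewrite !inE.
  rewrite /string_weight [RHS](reindex_inj (@perm_inj _ s)) /=.
  by apply: eq_bigr => a _; rewrite -hE rkE.
- rewrite /restrict /permv !subst_var_comp; apply: subst_var_ext => a /=.
    by rewrite hE.
  have [_ _ ->] := point_permP a hs; rewrite mul1r mulr1.
  by rewrite -hE; have [_ _ ->] := point_permP (shead f' a) hs.
Qed.

Context (sgn : {perm 'I_n} -> K).
Hypothesis sgnM : forall s s', color_perm col s -> color_perm col s' ->
  sgn (s * s')%g = sgn s * sgn s'.
Hypothesis sgn_sqr : forall s, color_perm col s -> sgn s * sgn s = 1.
Hypothesis sgn_tperm : forall a b, a != b -> col a = col b -> sgn (tperm a b) = -1.

Definition antisym F := forall s, point_perm s -> permv s F = sgn s *: F.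

Lemma natr_neq0 k : (0 < k)%N -> k%:R != 0 :> K.
Proof. by move=> k0; rewrite (proj1 (pcharf0P K) charK) -lt0n. Qed.

Lemma antisym_diag F : antisym F -> forall a b, a != b -> col a = col b ->
  vanish a b 1 -> elim_var a b 1 F = 0.
Proof.
move=> hF a b ab cab /andP[/eqP clab /eqP]; rewrite mul1r => vab.
have hs : point_perm (tperm a b).
  by apply/forallP => x; case: tpermP => [->|->|_ _]; rewrite ?cab ?clab ?vab !eqxx.
have := congr1 (elim_var a b 1) (hF _ hs); rewrite sgn_tperm // scaleN1r rmorphN /=.
have -> : elim_var a b 1 (permv (tperm a b) F) = elim_var a b 1 F.
  rewrite /permv /elim_var subst_var_comp; apply: subst_var_ext => x /=.
    by case: tpermP => [->|->|//]; rewrite eqxx [b == a]eq_sym (negbTE ab).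
  by rewrite !if_same mul1r.
move=> /eqP; rewrite -addr_eq0 -mulr2n -scaler_nat scaler_eq0.
by rewrite (negbTE (natr_neq0 _)) //= => /eqP.
Qed.

Definition alternate P := \sum_(s | point_perm s) sgn s *: permv s P.

Lemma alternate_antisym P : antisym (alternate P).
Proof.
move=> s hs; rewrite /alternate rmorph_sum scaler_sumr [RHS](reindex_inj (mulIg s)) /=.
apply: eq_big => [s'|s' hs']; first by rewrite point_permM.
rewrite permvZ permvM scalerA sgnM ?point_perm_col //.
by rewrite mulrCA sgn_sqr ?mulr1 ?point_perm_col.
Qed.

(** Strata of equal weight do not interfere: the correction for each vanishes on the others, so the
    corrections add up after cross-multiplying by the nonvanishing [U]. *)
Lemma clear_level k F (l : seq {ffun 'I_n -> 'I_n}) : wheel F -> antisym F ->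
  (forall f, ok f -> (k < weight f)%N -> restrict f F = 0) ->
  uniq l -> (forall f, f \in l -> ok f /\ weight f = k) ->
  exists U G, [/\ nonvan U, ideal G & forall f, ok f -> (k <= weight f)%N ->
    restrict f G = if f \in l then restrict f (U * F) else 0].
Proof.
move=> hF /antisym_diag aF habove; elim: l => [|f0 l IH] /=.
  move=> _ _; exists 1, 0; split; [exact: nonvanishing1 | exact: kernel_ideal0 |].
  by move=> f _ _; rewrite rmorph0.
move=> /andP[nf0 ul] hl; have [okf0 wf0] := hl f0 (mem_head _ _).
have [|U [G [hU hG hfG]]] := IH ul; first by move=> f fl; apply: hl; rewrite inE fl orbT.
have [U0 [G0 [hU0 hG0 e0 hfG0]]] : exists U0 G0, [/\ nonvan U0, ideal G0,
    restrict f0 G0 = restrict f0 (U0 * F) & forall f', ok f' -> f' != f0 ->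
    (weight f0 <= weight f')%N -> restrict f' G0 = 0].
  by apply: stratum => //; rewrite wf0.
exists (U0 * U), (U0 * G + U * G0); split; first exact: nonvanishingM.
  by apply: kernel_ideal_add; apply: kernel_ideal_mul.
move=> f okf hk; rewrite !rmorphD !rmorphM /= hfG // inE.
case: (eqVneq f f0) => [->|ne] /=.
  by rewrite (negbTE nf0) e0 rmorphM /=; ring.
rewrite hfG0 ?wf0 //; case: ifP => _; rewrite ?rmorphM /=; ring.
Qed.

(** At [k] = 0 the stratum without links already gives [F] = 0. In the step, [U * F - G] vanishes on
    one more level but is not antisymmetric, so its alternation is passed on, and differs from a
    multiple of [F] by an element of the ideal. *)
Lemma clear_strata k F : wheel F -> antisym F ->
  (forall f, ok f -> (k <= weight f)%N -> restrict f F = 0) ->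
  exists2 U, nonvan U & ideal (U * F).
Proof.
elim: k F => [|k IH] F hF aF hv.
  pose f0 : {ffun 'I_n -> 'I_n} := [ffun a => a].
  have ok0 : ok f0.
    apply/andP; split; apply/forallP => a; first by rewrite ffunE eqxx.
    by apply/forallP => b; rewrite !ffunE eqxx andbF.
  have F0 : F = 0.
    rewrite -(hv f0 ok0) // -[LHS]subst_var_id /restrict; apply: subst_var_ext => a.
      by rewrite head_of_fix ?ffunE.
    by rewrite head_of_fix ?ffunE // divff.
  by exists 1; [apply: nonvanishing1 | rewrite F0 mulr0; apply: kernel_ideal0].
pose l := enum [pred f | ok f && (weight f == k)].
have [U [G [hU hG hfG]]] : exists U G, [/\ nonvan U, ideal G &
    forall f, ok f -> (k <= weight f)%N ->
    restrict f G = if f \in l then restrict f (U * F) else 0].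
  apply: clear_level => //; first exact: enum_uniq.
  by move=> f; rewrite mem_enum => /andP[? /eqP].
have hX f : ok f -> (k <= weight f)%N -> restrict f (U * F - G) = 0.
  move=> okf hk; rewrite rmorphB /= hfG // mem_enum inE okf /=.
  case: eqP => [_|/eqP ne]; first by rewrite subrr.
  by rewrite subr0 rmorphM /= hv ?mulr0 // ltn_neqAle eq_sym ne.
(* Completes [U] to the product of its translates, which is invariant, so that alternating
   [V * U * F] only multiplies it by the order [N] of the stabilizer. *)
pose V := \prod_(s | point_perm s && (s != 1%g)) permv s U.
have hVU : V * U = \prod_(s | point_perm s) permv s U.
  by rewrite [RHS](bigD1 1%g) ?point_perm1 //= permv1 mulrC.
have inv s : point_perm s -> permv s (V * U) = V * U.
  move=> hs; rewrite hVU rmorph_prod [RHS](reindex_inj (mulIg s)) /=.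
  by apply: eq_big => [s'|s' _]; rewrite ?point_permM // permvM.
pose N := #|[pred s | point_perm s]|.
have altE : alternate (V * (U * F - G)) = N%:R *: (V * U * F) - alternate (V * G).
  have -> : N%:R *: (V * U * F) = \sum_(s | point_perm s) V * U * F.
    by rewrite scaler_nat -sumr_const; apply: eq_bigl => s.
  rewrite /alternate -sumrB; apply: eq_bigr => s hs.
  rewrite mulrBr mulrA rmorphB rmorphM /= inv // aF // scalerBr.
  by rewrite -scalerAr scalerA sgn_sqr ?point_perm_col // scale1r.
have hA : ideal (alternate (V * G)).
  apply: kernel_ideal_sum => s hs; rewrite -mul_mpolyC; apply: kernel_ideal_mul.
  by apply: kernel_ideal_perm; [apply: point_perm_col | apply: kernel_ideal_mul].
have [||f okf hk|W hW hWi] := IH (alternate (V * (U * F - G))).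
- rewrite altE -mul_mpolyC; apply: in_wheelB; first by do 2!apply: in_wheelM.
  exact: kernel_ideal_wheel hA.
- exact: alternate_antisym.
- rewrite /alternate rmorph_sum big1 //= => s hs; rewrite restrictZ.
  have [f' [okf' wf' ->]] := restrict_perm (V * (U * F - G)) hs okf.
  by rewrite rmorphM /= hX ?wf' // mulr0 rmorph0 scaler0.
exists (W * (V * U)).
  apply: nonvanishingM => //; apply: nonvanishingM => //; apply: nonvanishing_prod.
  by move=> s /andP[hs _]; apply: nonvanishing_perm.
have N0 : N%:R != 0 :> K.
  by apply: natr_neq0; apply/card_gt0P; exists 1%g; rewrite inE point_perm1.
have -> : W * (V * U) * F = (N%:R^-1)%:MP * (W * alternate (V * (U * F - G)) +
    W * alternate (V * G)).
  rewrite -mulrDr altE subrK mul_mpolyC -scalerAr scalerA mulVf // scale1r; ring.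
by apply: kernel_ideal_mul; apply: kernel_ideal_add => //; apply: kernel_ideal_mul.
Qed.

Lemma local_membership F : wheel F -> antisym F -> exists2 U, nonvan U & ideal (U * F).
Proof.
(* Above the maximal weight there is no stratum on which vanishing must be checked. *)
move=> hF aF; apply: (clear_strata (k := (\max_(f : {ffun 'I_n -> 'I_n}) weight f).+1)%N) => //.
by move=> f okf; rewrite ltnNge (bigop.leq_bigmax f).
Qed.

End Stratification.

(* Ideals of the Laurent polynomial ring are handled through polynomials, with
   the powers of the product of all variables as units. *)
(** * From local to global membership *)

Section Ideals.
Context (K : fieldType) (n : nat).
Implicit Types (J : {mpoly K[n]} -> Prop) (P : {mpoly K[n]}) (a b e : 'I_n).
Local Notation Xall := (var_prod K n).

Definition is_ideal J := [/\ J 0, forall P P', J P -> J P' -> J (P + P')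
  & forall P P', J P' -> J (P * P')].
(** Properness in the Laurent ring, where the powers of the product of all variables are units. *)
Definition proper_ideal J := is_ideal J /\ forall d, ~ J (Xall ^+ d).
Definition extend_ideal J P := fun S => exists r, J (S - r * P).
Definition invertible_mod J P := exists r d, J (r * P - Xall ^+ d).
Definition related J a b := exists c, J (lin a b c).

Lemma is_ideal_extend J P : is_ideal J -> is_ideal (extend_ideal J P).
Proof.
move=> [J0 JD JM]; split.
- by exists 0; rewrite mul0r subr0.
- move=> S S' [r h] [r' h']; exists (r + r').
  by have := JD _ _ h h'; congr J; ring.
- move=> S S' [r h]; exists (S * r); have := JM S _ h; congr J; ring.
Qed.

Lemma extend_ideal_sub J P S : is_ideal J -> J S -> extend_ideal J P S.
Proof. by move=> _ JS; exists 0; rewrite mul0r subr0. Qed.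

Lemma extend_ideal_mem J P : is_ideal J -> extend_ideal J P P.
Proof. by move=> [J0 _ _]; exists 1; rewrite mul1r subrr. Qed.

Lemma is_idealN J P : is_ideal J -> J P -> J (- P).
Proof. by move=> [_ _ JM] h; rewrite -mulN1r; apply: JM. Qed.

(** Either some form [lin a b c] can be adjoined with the ideal staying proper, or all of them are
    invertible already. Both outcomes persist in larger ideals, so the pairs can be treated one
    after the other, without a maximal ideal. *)
Lemma decide_related J (l : seq ('I_n * 'I_n)) : proper_ideal J ->
  exists J', [/\ proper_ideal J', forall P, J P -> J' P &
    forall a b, (a, b) \in l -> related J' a b \/
      forall c, invertible_mod J' (lin a b c)].
Proof.
elim: l J => [|[a b] l IH] J pJ; first by exists J; split.
have [J1 [pJ1 sub1 dec1]] : exists J', [/\ proper_ideal J', forall P, J P -> J' P &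
    related J' a b \/ forall c, invertible_mod J' (lin a b c)].
  have [iJ hJ] := pJ.
  case: (boolp.EM (exists c, proper_ideal (extend_ideal J (lin a b c)))) => [[c hc]|h].
    exists (extend_ideal J (lin a b c)); split=> // [P|]; first exact: extend_ideal_sub.
    by left; exists c; apply: extend_ideal_mem.
  exists J; split=> //; right=> c; apply: boolp.contrapT => hc; apply: h; exists c.
  split; first exact: is_ideal_extend.
  move=> d [r hr]; apply: hc; exists r, d.
  by rewrite -opprB; apply: is_idealN.
have [J2 [pJ2 sub2 dec2]] := IH J1 pJ1; exists J2; split=> // [P /sub1/sub2 //|a' b'].
rewrite inE => /orP[/eqP[-> ->]|]; last exact: dec2.
case: dec1 => [[c hc]|h]; [left; exists c; exact: sub2 | right=> c].
by have [r [d hd]] := h c; exists r, d; apply: sub2.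
Qed.

Lemma Xall_split e : Xall = 'X_e * \prod_(i | i != e) 'X_i.
Proof. by rewrite /var_prod (bigD1 e). Qed.

Lemma related_equiv J : proper_ideal J ->
  [/\ forall a, related J a a,
      forall a b c, J (lin a b c) -> c != 0,
      forall a b, related J a b -> related J b a &
      forall a b e, related J a b -> related J b e -> related J a e].
Proof.
move=> [[J0 JD JM] pJ].
have nz a b c : J (lin a b c) -> c != 0.
  move=> h; apply/eqP => c0; apply: (pJ 1%N); rewrite expr1 (Xall_split a) mulrC.
  by apply: JM; move: h; rewrite /lin c0 scale0r subr0.
split=> //.
- by move=> a; exists 1; rewrite /lin scale1r subrr.
- move=> a b [c h]; have c0 := nz _ _ _ h; exists c^-1.
  have := JM (- c^-1)%:MP _ h; congr J; rewrite mul_mpolyC /lin scalerBr scalerA.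
  by rewrite mulNr mulVf // !scaleNr scale1r opprK addrC.
- move=> a b e [c h] [d h']; exists (c * d).
  have := JD _ _ h (JM c%:MP _ h'); congr J; rewrite mul_mpolyC /lin scalerBr scalerA.
  by rewrite addrA subrK.
Qed.

(** [val a] is the constant ratio of X_a to the representative of its class. Modulo the ideal, a
    form inside a class is ([val a - c * val b]) times that representative, which is a unit; a form
    between two classes is invertible by construction. *)
Lemma point_of_ideal J : proper_ideal J ->
  exists (J' : {mpoly K[n]} -> Prop) (cls : 'I_n -> 'I_n) (val : 'I_n -> K),
  [/\ proper_ideal J', forall P, J P -> J' P, forall a, val a != 0 &
      forall U, nonvanishing cls val U -> invertible_mod J' U].
Proof.
move=> pJ; have [J' [pJ' sub dec]] := decide_related
  (enum {: 'I_n * 'I_n}) pJ.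
have {}dec a b : related J' a b \/ forall c, invertible_mod J' (lin a b c).
  by apply: dec; rewrite mem_enum.
have [rr nz rs rt] := related_equiv pJ'.
(* The pick depends only on the predicate, so it is constant on a class; reflexivity keeps the
   default from being reached. *)
pose cls a := odflt a [pick b | boolp.asbool (related J' a b)].
have relc a : related J' a (cls a).
  by rewrite /cls; case: pickP => [b /boolp.asboolP|_] //=.
have clsE a b : related J' a b -> cls a = cls b.
  move=> h; rewrite /cls.
  have e : (fun x => boolp.asbool (related J' a x)) =1
      (fun x => boolp.asbool (related J' b x)).
    by move=> x; apply/boolp.asboolP/boolp.asboolP => h'; apply: rt h'; auto.
  rewrite (eq_pick e); case: pickP => // /(_ b) /boolp.asboolP []; exact: rr.
have [val hval] := boolp.choice relc.
exists J', cls, val; split=> // [a|]; first exact: nz (hval a).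
have [[J0 JD JM] _] := pJ'.
move=> U; elim=> [|P P' _ [r [d h]] _ [r' [d' h']]|a b c ab c0 nv].
- by exists 1, 0%N; rewrite mul1r expr0 subrr.
- exists (r * r'), (d + d')%N.
  have := JD _ _ (JM (r' * P') _ h) (JM (Xall ^+ d) _ h'); congr J'.
  by rewrite exprD; ring.
- case: (dec a b) => [hab|]; last exact.
  set e := cls a; have eb : cls b = e by rewrite /e (clsE a b).
  set k := val a - c * val b.
  have k0 : k != 0.
    by rewrite subr_eq0; move: nv; rewrite /vanishes -/e eb eqxx.
  exists ((k^-1)%:MP * \prod_(i | i != e) 'X_i), 1%N.
  have h := JD _ _ (hval a) (JM (- c)%:MP _ (hval b)); rewrite eb -/e in h.
  have := JM ((k^-1)%:MP * \prod_(i | i != e) 'X_i) _ h; congr J'.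
  rewrite expr1 (Xall_split e) /lin -!mul_mpolyC.
  have : (k^-1)%:MP * k%:MP = 1 :> {mpoly K[n]} by rewrite -mpolyCM mulVf.
  rewrite /k mpolyCB mpolyCM mpolyCN; set M := \prod_(i | _) _; set x := _%:MP => hx.
  rewrite -[X in _ = _ - X]mul1r -hx; ring.
Qed.

End Ideals.

Section Saturation.
Context (K : fieldType) (R : realFieldType) (nu : K -> R).
Hypothesis nuM : forall x y, nu (x * y) = nu x * nu y.
Hypothesis nu_gt0 : forall x, x != 0 -> 0 < nu x.
Context (Q : quiver) (q : K) (t : edge Q -> K).
Hypothesis q_neq0 : q != 0.
Hypothesis t_neq0 : forall e, t e != 0.
Hypothesis nuq_lt1 : nu q < 1.
Hypothesis nu_t : forall e, nu q < nu (t e) < 1.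
Hypothesis charK : [pchar K] =i pred0.
Context (n : nat) (col : 'I_n -> vertex Q) (sgn : {perm 'I_n} -> K).
Hypothesis sgnM : forall s s', color_perm col s -> color_perm col s' ->
  sgn (s * s')%g = sgn s * sgn s'.
Hypothesis sgn_sqr : forall s, color_perm col s -> sgn s * sgn s = 1.
Hypothesis sgn_tperm : forall a b, a != b -> col a = col b -> sgn (tperm a b) = -1.

(** The window between [nu q] and 1 is stable under w -> q / w. *)
Lemma nu_hweight h : nu q < nu (hweight q t h) < 1.
Proof.
case: h => [[] e]; rewrite /hweight /=; last exact: nu_t.
have /andP[h1 h2] := nu_t e; have te := nu_gt0 (t_neq0 e); have q0 := nu_gt0 q_neq0.
have e1 : nu (q / t e) * nu (t e) = nu q by rewrite -nuM divfK.
apply/andP; split.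
  by rewrite -(ltr_pM2r te) e1 gtr_pMr.
by rewrite -(ltr_pM2r te) e1 mul1r.
Qed.

(** [J] consists of the multipliers that bring [F] into the ideal, up to monomials. If it were
    proper, the [U] found at one of its points would be both in an enlarged proper ideal and
    invertible modulo it. *)
Theorem wheel_kernel_ideal F : in_wheel q t col F ->
  (forall s, color_perm col s -> permv s F = sgn s *: F) ->
  exists d, kernel_ideal q t col (var_prod K n ^+ d * F).
Proof.
move=> hF aF; apply: boolp.contrapT => hn.
pose J P := exists d, kernel_ideal q t col (var_prod K n ^+ d * P * F).
have pJ : proper_ideal J.
  split; first split.
  - by exists 0%N; rewrite mulr0 mul0r; apply: kernel_ideal0.
  - move=> P P' [d h] [d' h']; exists (d + d')%N.
    have -> : var_prod K n ^+ (d + d') * (P + P') * F =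
      var_prod K n ^+ d' * (var_prod K n ^+ d * P * F) + var_prod K n ^+ d * (var_prod K n ^+ d' * P' * F).
      by rewrite exprD; ring.
    by apply: kernel_ideal_add; apply: kernel_ideal_mul.
  - move=> P P' [d h]; exists d.
    have -> : var_prod K n ^+ d * (P * P') * F = P * (var_prod K n ^+ d * P' * F) by ring.
    exact: kernel_ideal_mul.
  - by move=> d [d' h]; apply: hn; exists (d' + d)%N; rewrite exprD.
have [J' [cls [val [pJ' sub val0 inv]]]] := point_of_ideal pJ.
have pt : torus_point nu q val by split.
have [|U hU hUF] := local_membership (cls := cls) (pt := pt) t_neq0 nu_hweight charK sgnM sgn_sqr sgn_tperm hF.
  by move=> s hs; apply: aF; apply: point_perm_col hs.
have [r [d hd]] := inv U hU; have [[_ JD JM] hX] := pJ'.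
apply: (hX d); have JU : J' U by apply: sub; exists 0%N; rewrite mul1r.
have := JD _ _ (JM r _ JU) (is_idealN pJ'.1 hd); congr J'; ring.
Qed.

End Saturation.

(** * Antisymmetric polynomials *)

Section Vandermonde.
Context (K : fieldType) (Q : quiver) (n : nat) (col : 'I_n -> vertex Q).
Context (pos : 'I_n -> nat).
Hypothesis pos_inj : forall a b, col a = col b -> pos a = pos b -> a = b.
Hypothesis charK : [pchar K] =i pred0.
Implicit Types (a b : 'I_n) (s : {perm 'I_n}) (P : {mpoly K[n]}).

Definition vandermonde : {mpoly K[n]} :=
  \prod_(ab : 'I_n * 'I_n | (col ab.1 == col ab.2) && (pos ab.1 < pos ab.2)%N)
    lin ab.1 ab.2 1.

Definition discriminant : {mpoly K[n]} :=
  \prod_(ab : 'I_n * 'I_n | (col ab.1 == col ab.2) && (ab.1 != ab.2)) lin ab.1 ab.2 1.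

Lemma pos_lt_neq a b : (pos a < pos b)%N -> a != b.
Proof. by apply: contraTneq => ->; rewrite ltnn. Qed.

Lemma vandermonde_neq0 : vandermonde != 0.
Proof.
by apply/prodf_neq0 => ab /andP[_ /pos_lt_neq h]; apply: lin_neq0.
Qed.

Lemma lin1C a b : lin a b 1 = - lin b a 1 :> {mpoly K[n]}.
Proof. by rewrite /lin !scale1r opprB. Qed.

Lemma discriminantE : exists2 e : K, e != 0 & discriminant = e *: vandermonde ^+ 2.
Proof.
have -> : discriminant = vandermonde *
    \prod_(ab : 'I_n * 'I_n | (col ab.1 == col ab.2) && (pos ab.1 < pos ab.2)%N)
      - lin ab.1 ab.2 1.
  rewrite /discriminant (bigID (fun ab : 'I_n * 'I_n => (pos ab.1 < pos ab.2)%N)) /=.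
  congr (_ * _).
    apply: eq_bigl => ab; rewrite -andbA; congr (_ && _); apply/andP/idP => [[]//|h].
    by rewrite pos_lt_neq.
  rewrite (reindex_inj (h := fun ab => (ab.2, ab.1))); last by move=> [? ?] [? ?] [-> ->].
  apply: eq_big => [ab|ab _] /=; last exact: lin1C.
  rewrite eq_sym -andbA; apply/andP/andP => -[/eqP e]; last first.
    move=> h; rewrite e eqxx eq_sym pos_lt_neq //=; split=> //.
    by rewrite -leqNgt ltnW.
  rewrite e eqxx -leqNgt => /andP[ne le]; split=> //; rewrite ltn_neqAle le andbT.
  by apply: contraNneq ne => /(pos_inj e) ->.
rewrite prodrN expr2; exists ((-1) ^+ #|[pred ab : 'I_n * 'I_n |
    (col ab.1 == col ab.2) && (pos ab.1 < pos ab.2)%N]|).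
  by rewrite expf_neq0 // oppr_eq0 oner_neq0.
by rewrite -mul_mpolyC rmorphXn rmorphN1 /= mulrCA.
Qed.

Lemma permv_discriminant s : color_perm col s -> permv s discriminant = discriminant.
Proof.
move=> cs; rewrite /discriminant rmorph_prod /=.
rewrite [RHS](reindex_inj (h := fun ab => (s ab.1, s ab.2))) /=; last first.
  by move=> [x y] [x' y'] /= [/perm_inj -> /perm_inj ->].
apply: eq_big => [ab|ab _]; last by rewrite permv_lin.
by rewrite !(color_permP _ cs) (inj_eq perm_inj).
Qed.

(** The square of the Vandermonde product is the invariant discriminant up to a scalar, so a
    color-preserving permutation multiplies the product by a sign. Reading the sign off in this way
    avoids splitting [s] into permutations at each vertex. *)
Definition vsign s : K := if permv s vandermonde == vandermonde then 1 else -1.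

Lemma vsignP s : color_perm col s -> permv s vandermonde = vsign s *: vandermonde.
Proof.
move=> cs; have [e e0 ed] := discriminantE.
have := permv_discriminant cs; rewrite ed permvZ rmorphXn /=.
move=> /(congr1 (fun p => e^-1 *: p)); rewrite !scalerA mulVf // !scale1r.
move=> /eqP; rewrite eqf_sqr /vsign; case: eqP => [-> _|_ /= /eqP ->].
  by rewrite scale1r.
by rewrite scaleN1r.
Qed.

Lemma scale_vandermonde_inj (k k' : K) : k *: vandermonde = k' *: vandermonde -> k = k'.
Proof.
move=> /eqP; rewrite -subr_eq0 -scalerBl scaler_eq0 (negbTE vandermonde_neq0) orbF.
by rewrite subr_eq0 => /eqP.
Qed.

Lemma color_permM s s' : color_perm col s -> color_perm col s' -> color_perm col (s * s')%g.
Proof. by move=> c c'; apply/forallP => a; rewrite permM !color_permP. Qed.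

Lemma color_permV s : color_perm col s -> color_perm col s^-1%g.
Proof. by move=> c; apply/forallP => a; rewrite -(color_permP _ c) permKV. Qed.

Lemma color_perm1 : color_perm col 1%g.
Proof. by apply/forallP => a; rewrite perm1. Qed.

Lemma color_permMr s s' : color_perm col s' -> color_perm col (s * s')%g = color_perm col s.
Proof.
move=> c'; apply/idP/idP => [h|]; last by move=> c; apply: color_permM.
by rewrite -(mulgK s' s); apply: color_permM h (color_permV c').
Qed.

Lemma color_tperm a b : col a = col b -> color_perm col (tperm a b).
Proof. by move=> e; apply/forallP => x; case: tpermP => [->|->|_ _]; rewrite ?e. Qed.

Lemma vsignM s s' : color_perm col s -> color_perm col s' ->
  vsign (s * s')%g = vsign s * vsign s'.
Proof.
move=> c c'; apply: scale_vandermonde_inj; rewrite -vsignP ?color_permM // permvM.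
by rewrite vsignP // permvZ vsignP // scalerA.
Qed.

Lemma vsign_sqr s : color_perm col s -> vsign s * vsign s = 1.
Proof. by move=> _; rewrite /vsign; case: ifP; rewrite ?mulrNN mul1r. Qed.

Lemma elim_vandermonde_part a b (r : pred ('I_n * 'I_n)) :
  a != b -> ~~ r (a, b) -> ~~ r (b, a) -> (forall ab, r ab -> ab.1 != ab.2) ->
  elim_var a b 1 (\prod_(ab | r ab) lin ab.1 ab.2 1) != 0 :> {mpoly K[n]}.
Proof.
move=> ab nr nr' hr; rewrite rmorph_prod; apply/prodf_neq0 => -[x y] /= hxy.
apply: elim_var_lin_neq0; rewrite ?oner_neq0 //; first exact: (hr _ hxy).
apply/negP => /orP[] /andP[/eqP e1 /eqP e2]; move: hxy.
  by rewrite -e1 -e2 (negbTE nr).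
by rewrite -e1 -e2 (negbTE nr').
Qed.

Lemma two_neq0 : 2%:R != 0 :> K.
Proof. by rewrite (proj1 (pcharf0P K) charK). Qed.

Lemma elim_tperm a b P :
  elim_var a b 1 (permv (tperm a b) P) = elim_var a b 1 P.
Proof.
rewrite /permv /elim_var subst_var_comp; apply: subst_var_ext => x /=.
  by case: tpermP => [->|->|//]; rewrite eqxx; case: eqP.
by rewrite !if_same mul1r.
Qed.

Lemma antisym_elim a b P : permv (tperm a b) P = - P -> elim_var a b 1 P = 0.
Proof.
move=> /(congr1 (elim_var a b 1)); rewrite elim_tperm rmorphN /= => /eqP.
rewrite -addr_eq0 -mulr2n -scaler_nat scaler_eq0 (negbTE two_neq0) /=.
by move/eqP.
Qed.

(** If the transposition fixed the Vandermonde product, the product without z_a - z_b would change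
    sign, hence vanish on z_a = z_b, where none of its factors does. *)
Lemma vsign_tperm a b : a != b -> col a = col b -> vsign (tperm a b) = -1.
Proof.
wlog hab : a b / (pos a < pos b)%N.
  move=> W ab cab; case: (ltngtP (pos a) (pos b)) => h; first exact: W.
    by rewrite tpermC; apply: W; rewrite // eq_sym.
  by rewrite (pos_inj cab h) eqxx in ab.
move=> ab cab; pose r (xy : 'I_n * 'I_n) :=
  [&& col xy.1 == col xy.2, (pos xy.1 < pos xy.2)%N & xy != (a, b)].
pose V := \prod_(xy | r xy) lin xy.1 xy.2 1 : {mpoly K[n]}.
have eV : vandermonde = lin a b 1 * V.
  rewrite /vandermonde (bigD1 (a, b)) /= ?cab ?eqxx //; congr (_ * _).
  by apply: eq_bigl => xy; rewrite /r andbA.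
rewrite /vsign; case: eqP => // e; exfalso.
have : permv (tperm a b) V = - V.
  apply: (mulfI (lin_neq0 1 ab)); rewrite mulrN -eV -e eV rmorphM /= permv_lin.
  by rewrite tpermL tpermR lin1C mulNr.
move=> /antisym_elim/eqP; apply/negP; apply: elim_vandermonde_part => //.
- by rewrite /r eqxx !andbF.
- by rewrite /r /= [(pos b < _)%N]ltnNge (ltnW hab) andbF.
- by move=> xy /and3P[_ /pos_lt_neq].
Qed.

Definition color_alternate P := \sum_(s | color_perm col s) vsign s *: permv s P.

Lemma color_alternate_sum (A : finType) (r : pred A) (G : A -> {mpoly K[n]}) :
  color_alternate (\sum_(w | r w) G w) = \sum_(w | r w) color_alternate (G w).
Proof.
rewrite /color_alternate exchange_big; apply: eq_bigr => s _ /=.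
by rewrite rmorph_sum scaler_sumr.
Qed.

Lemma color_alternateD P P' :
  color_alternate (P + P') = color_alternate P + color_alternate P'.
Proof.
rewrite /color_alternate -big_split; apply: eq_bigr => s _ /=.
by rewrite rmorphD scalerDr.
Qed.

Lemma color_alternate0 : color_alternate 0 = 0.
Proof. by apply: big1 => s _; rewrite rmorph0 scaler0. Qed.

Lemma color_alternateZ c P : color_alternate (c *: P) = c *: color_alternate P.
Proof.
rewrite /color_alternate scaler_sumr; apply: eq_bigr => s _ /=.
by rewrite permvZ !scalerA mulrC.
Qed.

Lemma color_alternate_perm s P : color_perm col s ->
  color_alternate (permv s P) = vsign s *: color_alternate P.
Proof.
move=> cs; rewrite /color_alternate scaler_sumr.
rewrite [RHS](reindex_inj (mulgI s)) /=; apply: eq_big => [s'|s' cs'].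
  apply/idP/idP => [|h]; first exact: color_permM.
  by rewrite -(mulKg s s') color_permM // color_permV.
by rewrite permvM scalerA vsignM // mulrA vsign_sqr // mul1r.
Qed.

Lemma permv_color_alternate s P : color_perm col s ->
  permv s (color_alternate P) = vsign s *: color_alternate P.
Proof.
move=> cs; rewrite /color_alternate rmorph_sum scaler_sumr [RHS](reindex_inj (mulIg s)) /=.
apply: eq_big => [s'|s' hs']; first by rewrite color_permMr.
by rewrite permvZ permvM scalerA vsignM // mulrCA vsign_sqr // mulr1.
Qed.

Lemma vandermonde_divides P :
  (forall s, color_perm col s -> permv s P = vsign s *: P) -> divides vandermonde P.
Proof.
move=> hP; pose r := [pred ab : 'I_n * 'I_n | (col ab.1 == col ab.2) &&
  (pos ab.1 < pos ab.2)%N].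
have -> : vandermonde = \prod_(ab <- enum r) lin ab.1 ab.2 1 ^+ 1.
  by rewrite big_enum; apply: eq_bigr.
have hr ab : ab \in enum r -> col ab.1 = col ab.2 /\ (pos ab.1 < pos ab.2)%N.
  by rewrite mem_enum => /andP[/eqP].
apply: (@prod_lin_divides K n _ (enum r) fst snd (fun=> 1) (fun=> 1%N) P).
- exact: enum_uniq.
- by move=> ab /hr[_ /pos_lt_neq ->]; rewrite oner_neq0.
- move=> ab ab' /hr[_ h] /hr[_ h'] ne.
  apply/negP => /orP[/andP[/eqP e1 /eqP e2]|/andP[/eqP e1 /eqP e2]].
    by case/eqP: ne; apply: injective_projections.
  by move: h; rewrite e1 e2 ltnNge ltnW.
- move=> ab /hr[c h]; rewrite expr1; have ne := pos_lt_neq h.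
  apply/lin_dividesP => //; apply: antisym_elim.
  by rewrite hP ?color_tperm // vsign_tperm // scaleN1r.
Qed.

Lemma color_alternate_divides P : exists S,
  vandermonde * S = color_alternate P /\
  forall s, color_perm col s -> permv s S = S.
Proof.
have [S eS] := vandermonde_divides (fun s => @permv_color_alternate s P).
exists S; split=> // s cs; have := permv_color_alternate P cs.
rewrite eS rmorphM /= vsignP // -!scalerAl => /(congr1 (fun p => vsign s *: p)).
rewrite !scalerA vsign_sqr // !scale1r => /mulfI; apply; exact: vandermonde_neq0.
Qed.

End Vandermonde.

(** * Cancelling factors in the wheel conditions *)

Section Cancellation.
Context (K : fieldType) (Q : quiver) (q : K) (t : edge Q -> K).
Hypothesis q_neq0 : q != 0.
Hypothesis t_neq0 : forall e, t e != 0.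
Context (n : nat) (col : 'I_n -> vertex Q).
Implicit Types (a b c : 'I_n) (P U : {mpoly K[n]}).

(** [U] is coprime to the wheel divisor at z_c = q z_b as soon as it is non-zero on each locus where
    moreover z_a = (q / w) z_b. *)
Lemma in_wheel_cancel U P : in_wheel q t col (U * P) ->
  (forall a b c h, b != c -> a != b -> a != c ->
    elim_var a b (q / hweight q t h) (elim_var c b q U) != 0) ->
  in_wheel q t col P.
Proof.
move=> hUP hU a b c e bc ab ac; have := hUP a b c e bc ab ac.
rewrite rmorphM /= /wheel_factor => h.
apply: prod_lin_divides_mul h => [k _ //|k _]; exact: hU.
Qed.

Lemma elim2_Xall_neq0 a b c (x y : K) d : x != 0 -> y != 0 ->
  elim_var a b x (elim_var c b y (var_prod K n ^+ d)) != 0.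
Proof.
move=> x0 y0; rewrite !rmorphXn /= expf_neq0 // !rmorph_prod /=; apply/prodf_neq0 => i _.
have neq0 z k : elim_var a b x (k *: 'X_z) != 0 = (k != 0) :> bool.
  rewrite elim_varZ elim_varX scaler_eq0 negb_or; case: ifP => _.
    by rewrite scaler_eq0 negb_or x0 mpolyX_neq0 !andbT.
  by rewrite mpolyX_neq0 andbT.
rewrite elim_varX; case: ifP => _; first by rewrite neq0.
by rewrite -['X_i]scale1r neq0 oner_neq0.
Qed.

Hypothesis q_neq1 : q != 1.
Hypothesis w_neq1 : forall h, hweight q t h != 1.
Hypothesis w_neqq : forall h, hweight q t h != q.

(** On this locus z_b, z_c, z_a are in the ratio 1 : q : q / w. The three hypotheses make these
    numbers distinct, so no difference of variables vanishes. *)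
Lemma elim2_lin_neq0 a b c h x y : b != c -> a != b -> a != c -> x != y ->
  elim_var a b (q / hweight q t h) (elim_var c b q (lin x y 1)) != 0.
Proof.
move=> bc ab ac xy; have h0 := hweight_neq0 q_neq0 t_neq0 h.
set k := q / _; have k0 : k != 0 by rewrite mulf_neq0 ?invr_eq0.
have k1 : k != 1.
  apply: contra (w_neqq h) => /eqP e; apply/eqP.
  by rewrite -[LHS]mul1r -e divfK.
have kq : k != q.
  apply: contra (w_neq1 h) => /eqP e; apply/eqP/(mulfI q_neq0).
  by rewrite -{1}e /k divfK // mulr1.
pose img z : 'I_n * K := if z == c then (b, q) else if z == a then (b, k) else (z, 1).
have imgE z : elim_var a b k (elim_var c b q 'X_z) = (img z).2 *: 'X_(img z).1.
  rewrite elim_varX /img; case: (eqVneq z c) => [_|zc].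
    by rewrite elim_varZ elim_varX [b == a]eq_sym (negbTE ab).
  by rewrite elim_varX; case: eqP => //; rewrite scale1r.
rewrite /lin scale1r !rmorphB /= !imgE.
have img0 z : (img z).2 != 0.
  by rewrite /img; case: ifP => _ //; case: ifP => _ //; rewrite oner_neq0.
case: (eqVneq (img x).1 (img y).1) => [e|ne]; last first.
  by apply: monom_diff_neq0; rewrite ne img0.
rewrite e -scalerBl scaler_eq0 negb_or mpolyX_neq0 andbT subr_eq0.
move: e xy; rewrite /img.
case: (eqVneq x c) => [xc|xc]; case: (eqVneq y c) => [yc|yc] /=.
- by rewrite xc yc eqxx.
- by case: (eqVneq y a) => _ /= _ _; rewrite ?q_neq1 // eq_sym.
- by case: (eqVneq x a) => _ /= _ _; rewrite ?kq // eq_sym.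
- case: (eqVneq x a) => [xa|xa]; case: (eqVneq y a) => [ya|ya] /=.
  + by rewrite xa ya eqxx.
  + by move=> _ _; apply: k1.
  + by move=> _ _; rewrite eq_sym; apply: k1.
  + by move=> ->; rewrite eqxx.
Qed.

Lemma in_wheel_cancel_prod (r : pred ('I_n * 'I_n)) P :
  (forall xy, r xy -> xy.1 != xy.2) ->
  in_wheel q t col ((\prod_(xy | r xy) lin xy.1 xy.2 1) * P) -> in_wheel q t col P.
Proof.
move=> hr /in_wheel_cancel; apply=> a b c h bc ab ac.
rewrite !rmorph_prod; apply/prodf_neq0 => xy hxy /=.
by apply: elim2_lin_neq0 => //; apply: hr.
Qed.

Lemma in_wheel_cancel_Xall d P :
  in_wheel q t col (var_prod K n ^+ d * P) -> in_wheel q t col P.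
Proof.
move=> /in_wheel_cancel; apply=> a b c h bc ab ac; apply: elim2_Xall_neq0 => //.
by rewrite mulf_neq0 ?invr_eq0 // hweight_neq0.
Qed.

End Cancellation.

(** * Laurent polynomials as polynomials up to monomials *)

Section Evaluation.
Context (K : fieldType) (I : finType).
Implicit Types (m n k : I -> nat) (F G : laurent K I).

HB.instance Definition _ n :=
  GRing.RMorphism.copy (@ratC K I n) (@tofrac {mpoly K[#|zindex n|]} \o @mpolyC _ K).

Definition zcol n (j : 'I_#|zindex n|) : I := tag (enum_val j).
Definition zpos n (j : 'I_#|zindex n|) : nat := tagged (enum_val j).
Definition zord n (i : I) (a : 'I_(n i)) : 'I_#|zindex n| :=
  enum_rank (Tagged (fun j => 'I_(n j)) a : zindex n).

Lemma zcolE n i (a : 'I_(n i)) : zcol (zord a) = i.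
Proof. by rewrite /zcol /zord enum_rankK. Qed.

Lemma zposE n i (a : 'I_(n i)) : zpos (zord a) = a.
Proof. by rewrite /zpos /zord enum_rankK. Qed.

Lemma zpos_lt n (j : 'I_#|zindex n|) : (zpos j < n (zcol j))%N.
Proof. exact: ltn_ord. Qed.

Lemma zindex_inj n (j j' : 'I_#|zindex n|) :
  zcol j = zcol j' -> zpos j = zpos j' -> j = j'.
Proof.
rewrite /zcol /zpos => e1 e2; apply: enum_val_inj.
case: (enum_val j) (enum_val j') e1 e2 => i a [i' a'] /= e; subst i' => e.
by congr Tagged; apply: val_inj.
Qed.

Lemma zordK n (j : 'I_#|zindex n|) : zord (Ordinal (zpos_lt j)) = j.
Proof. by apply: zindex_inj; rewrite ?zcolE ?zposE. Qed.

Lemma zord_ex n i a : (a < n i)%N -> exists j : 'I_#|zindex n|, zcol j = i /\ zpos j = a.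
Proof. by move=> h; exists (zord (Ordinal h)); rewrite zcolE zposE. Qed.

Lemma prod_zindex (R : comNzRingType) n (G : I -> nat -> R) :
  \prod_(j < #|zindex n|) G (zcol j) (zpos j) = \prod_i \prod_(a < n i) G i a.
Proof.
rewrite (sig_big_dep xpredT (fun i (a : 'I_(n i)) => true) (fun i a => G i a)) /=.
rewrite (reindex (@enum_rank (zindex n))) /=; last exact/onW_bij/enum_rank_bij.
by apply: eq_bigr => p _; rewrite /zcol /zpos enum_rankK.
Qed.

Definition ev m k (x : I -> nat -> ratfun K m) :
    {mpoly K[#|zindex k|]} -> ratfun K m :=
  mmap (@ratC K I m) (fun j => x (zcol j) (zpos j)).

HB.instance Definition _ m k x :=
  GRing.RMorphism.copy (@ev m k x) (mmap (@ratC K I m) (fun j => x (zcol j) (zpos j))).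

Lemma evX m k (x : I -> nat -> ratfun K m) (j : 'I_#|zindex k|) :
  ev x 'X_j = x (zcol j) (zpos j).
Proof. by rewrite /ev mmapX mmap1U. Qed.

Lemma evXm m k (x : I -> nat -> ratfun K m) (u : 'X_{1..#|zindex k|}) :
  ev x 'X_[u] = \prod_j x (zcol j) (zpos j) ^+ u j.
Proof. exact: mmapX. Qed.

Lemma evC m k (x : I -> nat -> ratfun K m) (c : K) :
  ev x (c%:MP : {mpoly K[#|zindex k|]}) = ratC m c.
Proof. exact: mmapC. Qed.

Lemma evZ m k (x : I -> nat -> ratfun K m) c (P : {mpoly K[#|zindex k|]}) :
  ev x (c *: P) = ratC m c * ev x P.
Proof. by rewrite -mul_mpolyC rmorphM /= evC. Qed.

Local Notation Xall n := (var_prod K #|zindex n|).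

Lemma ev_Xall m k (x : I -> nat -> ratfun K m) :
  ev x (Xall k) = \prod_i \prod_(a < k i) x i a.
Proof.
rewrite /var_prod rmorph_prod -prod_zindex; apply: eq_bigr => j _; exact: evX.
Qed.

Definition nonzero_point m k (x : I -> nat -> ratfun K m) : Prop :=
  forall i a, (a < k i)%N -> x i a != 0.

(* The Laurent polynomial [P / Xall k ^+ d] is the component of [F] of degree [k]. *)
Definition represents k F (P : {mpoly K[#|zindex k|]}) (d : nat) : Prop :=
  forall m (x : I -> nat -> ratfun K m), nonzero_point k x ->
    leval k F x = ev x P / ev x (Xall k ^+ d).

Definition laurent_monomial m k (x : I -> nat -> ratfun K m) (e : {ffun I -> seq int}) :
  ratfun K m := \prod_i \prod_(a < k i) x i a ^ (e i)`_a.

(** The support of a sum may be smaller than the union of the supports; summing over a common larger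
    list makes [leval] visibly linear. *)
Lemma leval_sub m k F (x : I -> nat -> ratfun K m) (S : seq {ffun I -> seq int}) :
  uniq S -> {subset dom F <= S} ->
  leval k F x = \sum_(e <- S | [forall i, size (e i) == k i])
    ratC m (coeff e F) * laurent_monomial k x e.
Proof.
move=> uS sS; rewrite /leval.
rewrite [RHS](bigID (mem (dom F))) /= [X in _ + X]big1 ?addr0; last first.
  by move=> e /andP[_ h]; rewrite coeff_outdom // rmorph0 mul0r.
rewrite [RHS](eq_bigl (fun e => (e \in dom F) && [forall i, size (e i) == k i])); last first.
  by move=> e; rewrite andbC.
rewrite -big_filter_cond; apply: perm_big.
apply: uniq_perm; rewrite ?filter_uniq ?uniq_dom // => e.
by rewrite mem_filter /=; apply/idP/andP => [h|[]//]; split=> //; apply: sS.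
Qed.

Lemma levalD m k F G (x : I -> nat -> ratfun K m) :
  leval k (F + G) x = leval k F x + leval k G x.
Proof.
pose S := undup (dom F ++ dom G ++ dom (F + G)).
have uS : uniq S by apply: undup_uniq.
have sub T : {subset T <= dom F ++ dom G ++ dom (F + G)} -> {subset T <= S}.
  by move=> h e /h; rewrite mem_undup.
rewrite !(@leval_sub m k _ x S) //.
- by rewrite -big_split /=; apply: eq_bigr => e _; rewrite coeffD rmorphD mulrDl.
- by apply: sub => e h; rewrite !mem_cat h !orbT.
- by apply: sub => e h; rewrite mem_cat h.
- by apply: sub => e h; rewrite !mem_cat h !orbT.
Qed.

Lemma levalZ m k c F (x : I -> nat -> ratfun K m) :
  leval k (c *: F) x = ratC m c * leval k F x.
Proof.
rewrite !(@leval_sub m k _ x (dom F)) ?uniq_dom //; last exact: domZ_subset.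
rewrite mulr_sumr; apply: eq_bigr => e _.
by rewrite coeffZ rmorphM mulrA.
Qed.

Lemma leval0 m k (x : I -> nat -> ratfun K m) : leval k (0 : laurent K I) x = 0.
Proof. by rewrite /leval dom0 big_nil. Qed.

Lemma levalU m k e (x : I -> nat -> ratfun K m) :
  leval k (<< e >> : laurent K I) x =
  if [forall i, size (e i) == k i] then laurent_monomial k x e else 0.
Proof.
rewrite /leval domU1 big_cons big_nil addr0; case: ifP => // _.
by rewrite coeffU eqxx mulr1 rmorph1 mul1r.
Qed.

Lemma ev_subst m k (x : I -> nat -> ratfun K m) h c (P : {mpoly K[#|zindex k|]}) :
  (forall j, x (zcol j) (zpos j) = tofrac (c j *: 'X_(h j))) ->
  ev x P = tofrac (subst_var h c P).
Proof.
move=> hx; apply: (mpoly_morph_ext (f := ev x)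
  (g := @tofrac _ \o subst_var h c)) P => [u|j] /=; first by rewrite evC subst_varC.
by rewrite evX subst_varX hx.
Qed.

Lemma ev_monomial m k (x : I -> nat -> ratfun K m) (e : {ffun I -> seq int}) d :
  nonzero_point k x -> (forall i a, (absz ((e i)`_a)%R <= d)%N) ->
  laurent_monomial k x e =
  ev x 'X_[[multinom absz ((e (zcol j))`_(zpos j) + d%:Z)%R | j < #|zindex k|]]
    / ev x (Xall k ^+ d).
Proof.
move=> hx hd; rewrite evXm rmorphXn /= /var_prod rmorph_prod.
rewrite -prodrXl -prodf_div /laurent_monomial.
rewrite -(prod_zindex k (fun i a => x i a ^ (e i)`_a)); apply: eq_bigr => j _ /=.
have xj : x (zcol j) (zpos j) != 0 by apply/hx/zpos_lt.
rewrite evX mnmE; apply: (canRL (mulfK _)); first by rewrite expf_neq0.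
rewrite !exprnP -expfzDr //; congr (_ ^ _); rewrite gez0_abs //.
by move: (hd (zcol j) (zpos j)); move: (nth _ _ _) => z; clear; lia.
Qed.

Definition height (e : {ffun I -> seq int}) : nat :=
  (\sum_i \sum_(z <- e i) absz z)%N.

Lemma height_bound (e : {ffun I -> seq int}) i a : (absz ((e i)`_a)%R <= height e)%N.
Proof.
rewrite /height (bigD1 i) //=; apply: leq_trans (leq_addr _ _).
case: (ltnP a (size (e i))) => h; last by rewrite nth_default.
by rewrite (big_rem _ (mem_nth 0 h)) /= leq_addr.
Qed.

Definition laurent_height F : nat := (\sum_(e <- dom F) height e)%N.

(** For [d] at least the height, the shift makes all exponents non-negative, and [absz] merely
    changes the type. *)
Definition laurent_mnm k d (e : {ffun I -> seq int}) : 'X_{1..#|zindex k|} :=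
  [multinom absz ((e (zcol j))`_(zpos j) + d%:Z)%R | j < #|zindex k|].

Definition laurent_num k F : {mpoly K[#|zindex k|]} :=
  \sum_(e <- dom F | [forall i, size (e i) == k i])
    coeff e F *: 'X_[laurent_mnm k (laurent_height F) e].

Lemma coord_le_height F e i a : e \in dom F -> (absz ((e i)`_a)%R <= laurent_height F)%N.
Proof.
move=> he; apply: leq_trans (height_bound e i a) _.
by rewrite /laurent_height (big_rem _ he) leq_addr.
Qed.

Lemma represents_laurent_num k F : represents F (laurent_num k F) (laurent_height F).
Proof.
move=> m x hx; rewrite /leval rmorph_sum mulr_suml big_seq_cond [RHS]big_seq_cond.
apply: eq_bigr => e /andP[he _]; rewrite -/(laurent_monomial k x e) /=.
rewrite (@ev_monomial _ _ _ _ (laurent_height F)) // ?evZ ?mulrA // => i a.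
exact: coord_le_height.
Qed.

Lemma represents_ex k F : exists (P : {mpoly K[#|zindex k|]}) d, represents F P d.
Proof. exists (laurent_num k F), (laurent_height F); exact: represents_laurent_num. Qed.

Lemma laurent_mnm_inj k F e e' : e \in dom F -> e' \in dom F ->
  (forall i, size (e i) = k i) -> (forall i, size (e' i) = k i) ->
  laurent_mnm k (laurent_height F) e = laurent_mnm k (laurent_height F) e' -> e = e'.
Proof.
move=> he he' se se' eq; apply/ffunP => i.
apply: (@eq_from_nth _ 0); rewrite se ?se' // => a /zord_ex[j [<- <-]].
have := congr1 (fun u : 'X_{1..#|zindex k|} => u j) eq; rewrite /= !mnmE.
have := coord_le_height (zcol j) (zpos j) he.
have := coord_le_height (zcol j) (zpos j) he'.
move: (nth _ _ _) (nth _ _ _) (laurent_height F) => u v d; clear; lia.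
Qed.

Lemma mcoeff_laurent_num k F e : e \in dom F -> (forall i, size (e i) = k i) ->
  (laurent_num k F)@_(laurent_mnm k (laurent_height F) e) = coeff e F.
Proof.
move=> he se; rewrite /laurent_num raddf_sum big_mkcond /= (bigD1_seq e) ?uniq_dom //=.
rewrite ifT ?mcoeffZ ?mcoeffX ?eqxx ?mulr1; last by apply/forallP => i; rewrite se.
rewrite big_seq_cond big1 ?addr0 // => e' /andP[he' ne].
case: ifP => // /forallP se'; rewrite mcoeffZ mcoeffX.
case: eqP => [/(laurent_mnm_inj he' he) h|_]; last by rewrite mulr0.
by rewrite h ?eqxx // in ne => i; apply/eqP.
Qed.
Definition homogeneous k F : Prop :=
  forall m k' (x : I -> nat -> ratfun K m), k' <> k -> leval k' F x = 0.

Lemma laurent_of_poly k (P : {mpoly K[#|zindex k|]}) d :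
  exists F, homogeneous k F /\ represents F P d.
Proof.
elim/mpolyind: P => [|c u p _ _ [F [hF rF]]].
  exists 0; split=> [m k' x _|m x _]; first exact: leval0.
  by rewrite leval0 rmorph0 mul0r.
pose e : {ffun I -> seq int} :=
  [ffun i => [seq (u (zord a))%:Z - d%:Z | a <- enum 'I_(k i)]].
have se i : size (e i) = k i by rewrite ffunE size_map size_enum_ord.
exists (c *: << e >> + F); split=> [m k' x nk|m x hx].
  rewrite levalD levalZ levalU hF // addr0; case: ifP => [/forallP h|_]; last first.
    by rewrite mulr0.
  by case: nk; apply: boolp.funext => i; rewrite -(eqP (h i)) se.
rewrite levalD levalZ levalU rF // rmorphD /= mulrDl evZ.
have -> : [forall i, size (e i) == k i] by apply/forallP => i; rewrite se.
rewrite -mulrA; congr (_ * _ + _).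
rewrite evXm rmorphXn /= /var_prod rmorph_prod.
rewrite -prodrXl -prodf_div /laurent_monomial.
rewrite -(prod_zindex k (fun i a => x i a ^ (e i)`_a)); apply: eq_bigr => j _ /=.
have xj : x (zcol j) (zpos j) != 0 by apply/hx/zpos_lt.
rewrite evX; apply: (canRL (mulfK _)); first by rewrite expf_neq0.
rewrite !exprnP -expfzDr //; congr (_ ^ _); apply: (canLR (subrK _)).
rewrite ffunE (nth_map (Ordinal (zpos_lt j))) ?size_enum_ord ?zpos_lt //.
congr (Posz (u _) - _); rewrite -[RHS]zordK; congr zord.
by apply: val_inj; rewrite /= nth_enum_ord // zpos_lt.
Qed.

End Evaluation.

Lemma frac_cross (L : fieldType) (a b c d e : L) : b != 0 -> e != 0 ->
  a / b = c * (d / e) -> a * e = c * d * b.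
Proof.
by move=> b0 e0; rewrite mulrA => /eqP; rewrite eqr_div // => /eqP.
Qed.

Lemma tofrac_cross (A : idomainType) (a b c d : A) : b != 0 -> d != 0 ->
  a * d = c * b -> tofrac a / tofrac b = tofrac c / tofrac d.
Proof.
move=> b0 d0 e; apply/eqP; rewrite eqr_div ?tofrac_eq0 //.
by rewrite -!rmorphM /= e.
Qed.

Lemma permv_divides (K : fieldType) n (s : {perm 'I_n}) (P R : {mpoly K[n]}) :
  divides P R -> divides (permv s P) (permv s R).
Proof. exact: divides_morph. Qed.

(** * Permutations of the variables at each vertex *)

Section VariablePermutations.
Context (K : fieldType) (Q : quiver).
Local Notation I := (vertex Q).
Implicit Types (m n k : I -> nat) (F G : laurent K I).
Local Notation Xall n := (var_prod K #|zindex n|).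
Local Notation zc n := (@zcol I n).

Definition perm_fun n (s : var_perm n) (j : 'I_#|zindex n|) : 'I_#|zindex n| :=
  zord (s (tag (enum_val j)) (tagged (enum_val j))).

Lemma perm_fun_inj n (s : var_perm n) : injective (perm_fun s).
Proof.
move=> j j' /enum_rank_inj; rewrite /= => e; apply: enum_val_inj.
case: (enum_val j) (enum_val j') e => i a [i' a'] /= e.
have ei : i = i' := congr1 tag e; subst i'.
by move/eqP: e; rewrite eq_Tagged /= => /eqP/perm_inj ->.
Qed.

Definition vperm n (s : var_perm n) : {perm 'I_#|zindex n|} := perm (@perm_fun_inj n s).

Lemma vpermE n (s : var_perm n) i (a : 'I_(n i)) : vperm s (zord a) = zord (s i a).
Proof. by rewrite permE /perm_fun /zord enum_rankK. Qed.

Lemma vperm_color n (s : var_perm n) : color_perm (zc n) (vperm s).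
Proof. by apply/forallP => j; rewrite permE zcolE. Qed.

Lemma vperm_inj n : injective (@vperm n).
Proof.
move=> s s' e; apply/ffunP => i; apply/permP => a; apply: val_inj.
by have := congr1 (fun p : {perm _} => zpos (p (zord a))) e; rewrite !vpermE !zposE.
Qed.

Lemma vperm_surj n (p : {perm 'I_#|zindex n|}) : color_perm (zc n) p ->
  exists s : var_perm n, vperm s = p.
Proof.
move=> cp; pose g i (a : 'I_(n i)) : 'I_(n i) := insubd a (zpos (p (zord a))).
have gE i (a : 'I_(n i)) : val (g i a) = zpos (p (zord a)).
  rewrite val_insubd; have := zpos_lt (p (zord a)).
  by rewrite (color_permP _ cp) zcolE => ->.
have g_inj i : injective (g i).
  move=> a b /(congr1 val); rewrite !gE => e; apply: val_inj.
  have : p (zord a) = p (zord b) by apply: zindex_inj => //; rewrite !(color_permP _ cp) !zcolE.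
  by move=> /perm_inj /(congr1 (@zpos _ n)); rewrite !zposE.
pose s : var_perm n := [ffun i => perm (@g_inj i)].
exists s; apply/permP => j; rewrite -(zordK j) vpermE; apply: zindex_inj.
  by rewrite (color_permP _ cp) !zcolE.
by rewrite zposE ffunE permE gE.
Qed.

Lemma sum_var_perm (A : nmodType) n (G : {perm 'I_#|zindex n|} -> A) :
  \sum_(s : var_perm n) G (vperm s) = \sum_(p | color_perm (zc n) p) G p.
Proof.
rewrite -(big_imset G (in2W (@vperm_inj n))) /=; apply: eq_bigl => p.
apply/imsetP/idP => [[s _ ->]|/vperm_surj[s <-]]; first exact: vperm_color.
by exists s.
Qed.

Lemma zpermE n (s : var_perm n) i (a : 'I_(n i)) :
  zperm K s i a = tofrac 'X_(zord (s i a)).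
Proof. by rewrite /zperm valK. Qed.

Lemma zperm_ord n (s : var_perm n) j :
  zperm K s (zcol j) (zpos j) = tofrac 'X_(vperm s j).
Proof. by rewrite zpermE permE. Qed.

Lemma vperm1 n : @vperm n [ffun i => 1%g] = 1%g.
Proof.
by apply/permP => j; rewrite -(zordK j) vpermE ffunE !perm1.
Qed.

Lemma tofracX_neq0 n (j : 'I_#|zindex n|) :
  tofrac ('X_j : {mpoly K[#|zindex n|]}) != 0.
Proof. by rewrite tofrac_eq0 mpolyX_neq0. Qed.

Lemma zperm_nonzero n (s : var_perm n) : nonzero_point n (zperm K s).
Proof.
move=> i a h; have [j [<- <-]] := zord_ex h.
by rewrite zperm_ord tofracX_neq0.
Qed.

Lemma ev_zperm n (s : var_perm n) (P : {mpoly K[#|zindex n|]}) :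
  ev (zperm K s) P = tofrac (permv (vperm s) P).
Proof. by apply: ev_subst => j; rewrite zperm_ord scale1r. Qed.

Lemma permv_Xall n (p : {perm 'I_#|zindex n|}) d : permv p (Xall n ^+ d) = Xall n ^+ d.
Proof.
rewrite rmorphXn /= /var_prod rmorph_prod; congr (_ ^+ _).
by rewrite [RHS](reindex_inj (@perm_inj _ p)); apply: eq_bigr => j _; rewrite /= permvX.
Qed.

Lemma Xall_neq0 n d : Xall n ^+ d != 0.
Proof. by apply/expf_neq0/prodf_neq0 => j _; apply: mpolyX_neq0. Qed.

Lemma leval_zperm n F (P : {mpoly K[#|zindex n|]}) d (s : var_perm n) :
  represents F P d ->
  leval n F (zperm K s) = tofrac (permv (vperm s) P) / tofrac (Xall n ^+ d).
Proof.
by move=> /(_ _ _ (zperm_nonzero s)) ->; rewrite !ev_zperm permv_Xall.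
Qed.

Lemma leval_zvar n F (P : {mpoly K[#|zindex n|]}) d :
  represents F P d -> leval n F (@zvar K I n) = tofrac P / tofrac (Xall n ^+ d).
Proof. by move=> r; rewrite /zvar (leval_zperm _ r) vperm1 permv1. Qed.

Definition color_symmetric n (P : {mpoly K[#|zindex n|]}) : Prop :=
  forall p, color_perm (zc n) p -> permv p P = P.

Lemma symmetric_represents n F (P : {mpoly K[#|zindex n|]}) d :
  represents F P d -> symmetric_laurent F -> color_symmetric P.
Proof.
move=> r sF p /vperm_surj[s <-]; have := sF n s.
rewrite (leval_zperm _ r) (leval_zvar r) => /mulIf h; apply/eqP.
by rewrite -tofrac_eq; apply/eqP/h; rewrite invr_eq0 tofrac_eq0 Xall_neq0.
Qed.

Lemma symmetric_of_represents F :
  (forall n (P : {mpoly K[#|zindex n|]}) d, represents F P d -> color_symmetric P) ->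
  symmetric_laurent F.
Proof.
move=> h n s; have [P [d r]] := represents_ex n F.
by rewrite (leval_zperm _ r) (leval_zvar r) (h _ _ _ r) //; apply: vperm_color.
Qed.

End VariablePermutations.

(** * Wheel conditions in terms of the representing polynomials *)

Section Wheels.
Context (K : fieldType) (Q : quiver) (q : K) (t : edge Q -> K).
Local Notation I := (vertex Q).
Hypothesis q_neq0 : q != 0.
Hypothesis t_neq0 : forall e, t e != 0.
Implicit Types (m n k : I -> nat) (F G : laurent K I).
Local Notation Xall n := (var_prod K #|zindex n|).
Local Notation zc n := (@zcol I n).

Lemma prod_half_edges (A : comNzRingType) (G : bool * edge Q -> A) (i j : I) :
  \prod_(h | adj i j h) G h =
  (\prod_(e : edge Q | (source e == i) && (target e == j)) G (false, e)) *
  (\prod_(e : edge Q | (source e == j) && (target e == i)) G (true, e)).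
Proof.
pose G' b e := if adj i j (b, e) then G (b, e) else 1.
rewrite big_mkcond /= (eq_bigr (fun h => G' h.1 h.2)); last by case.
by rewrite -(pair_bigA _ G') big_bool /= mulrC -!big_mkcond.
Qed.

Lemma tofrac_lin n (a b : 'I_#|zindex n|) (c : K) :
  tofrac (lin a b c) = tofrac 'X_a - ratC n c * tofrac 'X_b.
Proof. by rewrite /lin rmorphB /= -mul_mpolyC rmorphM. Qed.

Lemma zvarE n (j : 'I_#|zindex n|) : zvar K n (zcol j) (zpos j) = tofrac 'X_j.
Proof. by rewrite /zvar zperm_ord vperm1 perm1. Qed.

Lemma wheel_divisorE n (a b : 'I_#|zindex n|) : zpos b = 0%N ->
  wheel_divisor q t n (zcol a) (zcol b) (zpos a) =
  tofrac (wheel_factor q t (zc n) b a).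
Proof.
move=> b0; rewrite /wheel_divisor /wheel_factor rmorph_prod prod_half_edges.
rewrite -b0 !zvarE; congr (_ * _); apply: eq_bigr => e _ /=.
  by rewrite tofrac_lin /hweight /= mulrAC [ratC n (q / _)]rmorphM /= fmorphV.
by rewrite tofrac_lin /hweight /= invf_div mulrCA divff ?mulr1.
Qed.

Lemma ev_wheel_point n (b c : 'I_#|zindex n|) P : zcol b = zcol c ->
  zpos b = 0%N -> zpos c = 1%N ->
  ev (@wheel_point K Q q n (zcol b)) P = tofrac (elim_var c b q P).
Proof.
move=> bc b0 c1; apply: ev_subst => j; rewrite /wheel_point.
have -> : (zcol j == zcol b) && (zpos j == 1%N) = (j == c).
  rewrite bc -c1; apply/andP/eqP => [[/eqP e1 /eqP e2]|->//]; exact: zindex_inj.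
case: eqP => _; last by rewrite scale1r zvarE.
by rewrite -b0 zvarE -mul_mpolyC rmorphM.
Qed.

Lemma wheel_point_nonzero n (b c : 'I_#|zindex n|) : zcol b = zcol c ->
  zpos b = 0%N -> zpos c = 1%N -> nonzero_point n (@wheel_point K Q q n (zcol b)).
Proof.
move=> bc b0 c1 i a h; have [j [<- <-]] := zord_ex h; rewrite /wheel_point.
case: ifP => _; last by rewrite zvarE tofracX_neq0.
by rewrite -b0 zvarE mulf_neq0 ?tofracX_neq0 // fmorph_eq0.
Qed.

(** The definition gives the first two variables of a vertex; symmetry carries the divisibility to
    every pair. The Laurent cofactor is made polynomial by cancelling monomials, which are coprime
    to the wheel divisor. *)
Lemma wheel_in_wheel n F (P : {mpoly K[#|zindex n|]}) d :
  represents F P d -> color_symmetric P -> wheel q t F -> in_wheel q t (zc n) P.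
Proof.
move=> r sP wF.
have base a b c : zcol b = zcol c -> zpos b = 0%N -> zpos c = 1%N -> a != b -> a != c ->
    divides (wheel_factor q t (zc n) b a) (elim_var c b q P).
  move=> bc b0 c1 ab ac.
  have [] := wF n (zcol a) (zcol b) (zpos a).
  - by rewrite bc -c1 zpos_lt.
  - exact: zpos_lt.
  - apply/negP => /andP[/eqP e]; rewrite ltnS leq_eqVlt ltnS leqn0 => /orP[] /eqP h.
      by case/eqP: ac; apply: zindex_inj; rewrite ?e ?h.
    by case/eqP: ab; apply: zindex_inj; rewrite ?e ?h.
  move=> H; have [PH [d' rH]] := represents_ex n H.
  rewrite (r _ _ (wheel_point_nonzero bc b0 c1)) !(ev_wheel_point _ bc b0 c1).
  rewrite (leval_zvar rH) wheel_divisorE // => e.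
  have e2 : elim_var c b q P * Xall n ^+ d' =
      wheel_factor q t (zc n) b a * PH * elim_var c b q (Xall n ^+ d).
    apply/eqP; rewrite -tofrac_eq; apply/eqP; rewrite !rmorphM /=.
    have x1 : tofrac (Xall n ^+ d') != 0 by rewrite tofrac_eq0 Xall_neq0.
    have x2 : tofrac (elim_var c b q (Xall n ^+ d)) != 0.
      by rewrite tofrac_eq0 elim_var_Xall_neq0.
    exact: frac_cross x2 x1 e.
  apply: (@prod_lin_divides_mul K _ _ _ _ (fun=> a) (fun=> b) _ (Xall n ^+ d')) => //.
    move=> h _; apply: elim_var_Xall_neq0.
    by rewrite mulf_neq0 ?invr_eq0 // hweight_neq0.
  by rewrite mulrC e2 -mulrA; apply/divides_mulr/divides_refl.
move=> a b c bc nbc ab ac.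
have hb : (1 < n (zcol b))%N.
  have hc := zpos_lt c; rewrite -bc in hc; have := zpos_lt b.
  case: (ltnP 1 (n (zcol b))) => // h; move: hc; case: (n (zcol b)) h => [|[|]] // _.
  rewrite !ltnS !leqn0 => /eqP e1 /eqP e2.
  by case/eqP: nbc; apply: zindex_inj; rewrite ?e1.
have [b0 [cb0 pb0]] := zord_ex (ltnW hb); have [c0 [cc0 pc0]] := zord_ex hb.
have bc0 : b0 != c0 by apply/eqP => e; rewrite e pc0 in pb0.
(* The product [s] of these transpositions sends [b0] to [b] and [c0] to [c]. *)
pose s1 := tperm b0 b; pose c1 := (s1^-1 c)%g; pose s2 := tperm c0 c1.
have k1 : color_perm (zc n) s1 by apply: color_tperm.
have cc1 : zcol c1 = zcol c0 by rewrite (color_permP _ (color_permV k1)) cc0.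
have k2 : color_perm (zc n) s2 by apply: color_tperm.
pose s := (s2 * s1)%g; have ks : color_perm (zc n) s by apply: color_permM.
have sb : s b0 = b.
  rewrite permM /s2 tpermD ?tpermL // 1?eq_sym //.
  by apply: contra nbc => /eqP e; rewrite -(tpermL b0 b) -/s1 e /c1 permKV.
have sc : s c0 = c by rewrite permM /s2 tpermL /c1 permKV.
have sa : s (s^-1 a)%g = a by rewrite permKV.
have ab0 : (s^-1 a)%g != b0 by rewrite -(inj_eq (@perm_inj _ s)) sa sb.
have ac0 : (s^-1 a)%g != c0 by rewrite -(inj_eq (@perm_inj _ s)) sa sc.
have := permv_divides s (base _ _ _ (etrans cb0 (esym cc0)) pb0 pc0 ab0 ac0).
rewrite permv_elim sb sc sP // /wheel_factor rmorph_prod.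
have -> : zcol (s^-1 a)%g = zcol a by rewrite -[in RHS]sa (color_permP _ ks).
rewrite cb0; by under eq_bigr => h _ do rewrite /= permv_lin sa sb.
Qed.

Lemma wheel_of_represents F :
  (forall n (P : {mpoly K[#|zindex n|]}) d, represents F P d -> in_wheel q t (zc n) P) ->
  wheel q t F.
Proof.
move=> hF n i j a hj hi nij; have [P [d r]] := represents_ex n F.
have [b [cb pb]] := zord_ex (ltnW hj); have [c [cc pc]] := zord_ex hj.
have [a' [ca pa]] := zord_ex hi; have bc : zcol b = zcol c by rewrite cb cc.
have nbc : b != c by apply/eqP => e; rewrite e pc in pb.
have ab : a' != b by apply: contraNneq nij => e; rewrite -ca -cb -pa e pb eqxx.
have ac : a' != c by apply: contraNneq nij => e; rewrite -ca -cc -pa e pc eqxx.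
have [S eS] := hF _ _ _ r a' b c bc nbc ab ac.
(* The substitution z_c = q z_b turns the product of all variables into another monomial; [Y]
   complements it to q times a square of that product, so that the cofactor has a denominator of the
   standard form. *)
pose Y : {mpoly K[#|zindex n|]} := 'X_c * \prod_(j < #|zindex n| | j != b) 'X_j.
have eY : elim_var c b q (Xall n) * Y = q *: (Xall n ^+ 2).
  rewrite expr2 {1 2}/var_prod (bigD1 c) //= rmorphM rmorph_prod /= elim_varX eqxx.
  rewrite (eq_bigr (fun j => 'X_j)); last first.
    by move=> x xc; rewrite elim_varX (negbTE xc).
  rewrite -!scalerAl; congr (_ *: _).
  rewrite /Y mulrACA -mulrA [X in _ = _ * X](bigD1 b) //=.
  by ring.
have eYd : elim_var c b q (Xall n ^+ d) * Y ^+ d = (q ^+ d) *: Xall n ^+ (2 * d).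
  by rewrite rmorphXn /= -exprMn eY exprZn -exprM.
have [H [_ rH]] := laurent_of_poly ((q ^+ d)^-1 *: (S * Y ^+ d)) (2 * d).
exists H; rewrite -cb (r _ _ (wheel_point_nonzero bc pb pc)) !(ev_wheel_point _ bc pb pc).
rewrite -ca -pa wheel_divisorE // (leval_zvar rH) eS rmorphM /= -!mulrA; congr (_ * _).
have qd0 : q ^+ d != 0 by rewrite expf_neq0.
apply: tofrac_cross; [exact: elim_var_Xall_neq0 | exact: Xall_neq0 |].
rewrite -scalerAl -[S * _ * _]mulrA [Y ^+ d * _]mulrC eYd -scalerAr scalerA.
by rewrite mulVf // scale1r.
Qed.

End Wheels.

(** * Shuffle products *)

Section ShuffleTerm.
Context (K : fieldType) (Q : quiver) (q : K) (t : edge Q -> K).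
Local Notation I := (vertex Q).
Hypothesis q_neq0 : q != 0.
Local Notation Xall n := (var_prod K #|zindex n|).
Local Notation zc n := (@zcol I n).
Local Notation ker n := (kernel q t (zc n)).

(* The denominator of [zeta (z_a / z_b)]. *)
Definition kernel_den n (a b : 'I_#|zindex n|) : {mpoly K[#|zindex n|]} :=
  'X_b ^+ #|[pred h | adj (zc n a) (zc n b) h]| *
  (if zc n a == zc n b then q *: lin a b 1 else 1).

Lemma kernel_den_neq0 n (a b : 'I_#|zindex n|) : a != b -> kernel_den a b != 0.
Proof.
move=> ab; rewrite mulf_neq0 ?expf_neq0 ?mpolyX_neq0 //.
case: ifP => _; last exact: oner_neq0.
by rewrite scaler_eq0 negb_or q_neq0 lin_neq0.
Qed.

Lemma zeta_edge_frac (L : fieldType) (x y w : L) : y != 0 -> 1 - w * (x / y) = (y - w * x) / y.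
Proof. by move=> y0; field. Qed.

Lemma zeta_diag_frac (L : fieldType) (x y w : L) : y != 0 -> w != 0 -> x - y != 0 ->
  (1 - x / y / w) / (1 - x / y) = (x - w * y) / (w * (x - y)).
Proof.
move=> y0 w0 xy; have e1 : 1 - x / y = (x - y) / - y by field; rewrite oppr_eq0 y0.
have e2 : 1 - x / y / w = (x - w * y) / (w * - y) by field; rewrite ?oppr_eq0 ?y0 ?w0.
rewrite e1 e2 invf_div mulf_div; apply/eqP.
rewrite eqr_div ?mulf_neq0 ?oppr_eq0 //; apply/eqP; ring.
Qed.

Lemma ratCV n (c : K) : ratC n c^-1 = (@ratC K I n c)^-1.
Proof. exact: (fmorphV (@ratC K I n)). Qed.

Lemma ratC_eq0 n (c : K) : (@ratC K I n c == 0) = (c == 0).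
Proof. exact: (fmorph_eq0 (@ratC K I n)). Qed.

Lemma tofrac_sub_neq0 (n : I -> nat) (a b : 'I_#|zindex n|) : a != b ->
  tofrac ('X_a : {mpoly K[#|zindex n|]}) - tofrac 'X_b != 0.
Proof.
by move=> ab; have := lin_neq0 (1 : K) ab; rewrite -tofrac_eq0 /lin scale1r rmorphB.
Qed.

Lemma zetaE n (a b : 'I_#|zindex n|) : a != b ->
  zeta q t (zc n a) (zc n b) (tofrac 'X_a / tofrac 'X_b) =
  tofrac (ker n a b) / tofrac (kernel_den a b).
Proof.
move=> ab; have b0 := tofracX_neq0 K b.
have e1 : (\prod_(e : edge Q | (source e == zc n a) && (target e == zc n b))
      (1 - ratC n (t e) * (tofrac 'X_a / tofrac 'X_b)))
    * (\prod_(e : edge Q | (source e == zc n b) && (target e == zc n a))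
      (1 - ratC n q * (tofrac 'X_a / tofrac 'X_b) / ratC n (t e))) =
    tofrac (\prod_(h | adj (zc n a) (zc n b) h) lin b a (hweight q t h)) /
    tofrac ('X_b ^+ #|[pred h | adj (zc n a) (zc n b) h]|).
  rewrite rmorph_prod rmorphXn /= -prodr_const -prodf_div.
  rewrite [RHS](eq_bigr (fun h => 1 - ratC n (hweight q t h) *
    (tofrac 'X_a / tofrac 'X_b))); last first.
    by move=> h _; rewrite tofrac_lin zeta_edge_frac.
  rewrite prod_half_edges; congr (_ * _); apply: eq_bigr => e _.
  by rewrite /hweight /= [ratC n (q / _)]rmorphM /= fmorphV mulrAC.
rewrite /zeta -mulrA e1 /kernel /kernel_den.
case: (eqVneq (zc n a) (zc n b)) => [_|_]; last first.
  by rewrite expr0 !mul1r mulr1.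
rewrite expr1 ratCV zeta_diag_frac ?ratC_eq0 ?tofrac_sub_neq0 //.
have -> : tofrac 'X_a - ratC n q * tofrac 'X_b = tofrac (lin a b q).
  by rewrite tofrac_lin.
have -> : ratC n q * (tofrac 'X_a - tofrac 'X_b) = tofrac (q *: lin a b 1).
  by rewrite -mul_mpolyC rmorphM /= tofrac_lin rmorph1 mul1r.
rewrite !rmorphM /= mulf_div; congr (_ / _); exact: mulrC.
Qed.

Context (m k : I -> nat).
Hypothesis km : forall i, (k i <= m i)%N.
Local Notation l := (fun i => m i - k i)%N.

(** [emb1] and [emb2] place the variables of the left and right factor: at each vertex the first
    [k i], then the rest, shifted by [k i]. *)
Definition emb1 (j : 'I_#|zindex k|) : 'I_#|zindex m| :=
  zord (widen_ord (km (zcol j)) (Ordinal (zpos_lt j))).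

Lemma emb2_subproof (j : 'I_#|zindex l|) : (k (zcol j) + zpos j < m (zcol j))%N.
Proof. by have := zpos_lt j; rewrite ltn_subRL. Qed.

Definition emb2 (j : 'I_#|zindex l|) : 'I_#|zindex m| := zord (Ordinal (emb2_subproof j)).

Lemma emb1_col j : zcol (emb1 j) = zcol j. Proof. exact: zcolE. Qed.
Lemma emb2_col j : zcol (emb2 j) = zcol j. Proof. exact: zcolE. Qed.
Lemma emb1_pos j : zpos (emb1 j) = zpos j. Proof. exact: zposE. Qed.
Lemma emb2_pos j : zpos (emb2 j) = (k (zcol j) + zpos j)%N. Proof. exact: zposE. Qed.

Lemma emb1_inj : injective emb1.
Proof.
move=> x y e; apply: zindex_inj; first by rewrite -emb1_col e emb1_col.
by rewrite -emb1_pos e emb1_pos.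
Qed.

Lemma emb2_inj : injective emb2.
Proof.
move=> x y e; have ec : zcol x = zcol y by rewrite -emb2_col e emb2_col.
by apply: zindex_inj => //; have := congr1 (@zpos I m) e; rewrite !emb2_pos ec => /addnI.
Qed.

Lemma emb12_neq x y : emb1 x != emb2 y.
Proof.
apply/eqP => e; have ec : zcol x = zcol y by rewrite -emb1_col e emb2_col.
by have := zpos_lt x; rewrite -emb1_pos e emb2_pos ec ltnNge leq_addr.
Qed.

Lemma emb_cover z : (exists x, z = emb1 x) \/ (exists y, z = emb2 y).
Proof.
case: (ltnP (zpos z) (k (zcol z))) => h.
  have [x [cx px]] := zord_ex h; left; exists x.
  by apply: zindex_inj; rewrite ?emb1_col ?emb1_pos ?cx ?px.
have h' : (zpos z - k (zcol z) < m (zcol z) - k (zcol z))%N.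
  exact: ltn_sub2r (leq_ltn_trans h (zpos_lt z)) (zpos_lt z).
have [y [cy py]] := zord_ex (n := l) h'; right; exists y.
by apply: zindex_inj; rewrite ?emb2_col ?emb2_pos ?cy ?py // subnKC.
Qed.

Definition inc1 : {mpoly K[#|zindex k|]} -> {mpoly K[#|zindex m|]} :=
  subst_var emb1 (fun=> 1).
Definition inc2 : {mpoly K[#|zindex l|]} -> {mpoly K[#|zindex m|]} :=
  subst_var emb2 (fun=> 1).
HB.instance Definition _ := GRing.RMorphism.copy inc1 (subst_var emb1 (fun=> 1)).
HB.instance Definition _ := GRing.RMorphism.copy inc2 (subst_var emb2 (fun=> 1)).

Definition cross_kernel : {mpoly K[#|zindex m|]} :=
  \prod_x \prod_y ker m (emb1 x) (emb2 y).
Definition cross_den : {mpoly K[#|zindex m|]} :=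
  \prod_x \prod_y kernel_den (emb1 x) (emb2 y).

Definition shuffle_num P1 P2 := inc1 P1 * inc2 P2 * cross_kernel.
Definition shuffle_den d1 d2 := inc1 (Xall k ^+ d1) * inc2 (Xall l ^+ d2) * cross_den.

Lemma inc1X j : inc1 'X_j = 'X_(emb1 j).
Proof. by rewrite /inc1 subst_varX scale1r. Qed.

Lemma inc2X j : inc2 'X_j = 'X_(emb2 j).
Proof. by rewrite /inc2 subst_varX scale1r. Qed.

Lemma inc1Z c P : inc1 (c *: P) = c *: inc1 P.
Proof. exact: subst_varZ. Qed.

Lemma inc2Z c P : inc2 (c *: P) = c *: inc2 P.
Proof. exact: subst_varZ. Qed.

Lemma inc1_lin a b (c : K) : inc1 (lin a b c) = lin (emb1 a) (emb1 b) c.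
Proof. by rewrite /lin rmorphB /= inc1Z !inc1X. Qed.

Lemma inc2_lin a b (c : K) : inc2 (lin a b c) = lin (emb2 a) (emb2 b) c.
Proof. by rewrite /lin rmorphB /= inc2Z !inc2X. Qed.

Lemma cross_den_neq0 : cross_den != 0.
Proof.
by apply/prodf_neq0 => x _; apply/prodf_neq0 => y _; apply/kernel_den_neq0/emb12_neq.
Qed.

Lemma inc1_Xall d : inc1 (Xall k ^+ d) = \prod_x 'X_(emb1 x) ^+ d.
Proof.
rewrite rmorphXn /= /var_prod rmorph_prod -prodrXl.
by apply: eq_bigr => x _; rewrite /= inc1X.
Qed.

Lemma inc2_Xall d : inc2 (Xall l ^+ d) = \prod_y 'X_(emb2 y) ^+ d.
Proof.
rewrite rmorphXn /= /var_prod rmorph_prod -prodrXl.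
by apply: eq_bigr => x _; rewrite /= inc2X.
Qed.

Lemma shuffle_den_neq0 d1 d2 : shuffle_den d1 d2 != 0.
Proof.
rewrite /shuffle_den !mulf_neq0 ?cross_den_neq0 //.
  by rewrite inc1_Xall; apply/prodf_neq0 => x _; rewrite expf_neq0 ?mpolyX_neq0.
by rewrite inc2_Xall; apply/prodf_neq0 => x _; rewrite expf_neq0 ?mpolyX_neq0.
Qed.

Lemma permv_inc1 (p : {perm 'I_#|zindex m|}) P :
  permv p (inc1 P) = subst_var (p \o emb1) (fun=> 1) P.
Proof.
by rewrite /permv /inc1 subst_var_comp; apply: subst_var_ext => x //=; rewrite mulr1.
Qed.

Lemma permv_inc2 (p : {perm 'I_#|zindex m|}) P :
  permv p (inc2 P) = subst_var (p \o emb2) (fun=> 1) P.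
Proof.
by rewrite /permv /inc2 subst_var_comp; apply: subst_var_ext => x //=; rewrite mulr1.
Qed.

Lemma permv_kernel_den (p : {perm 'I_#|zindex m|}) a b : color_perm (zc m) p ->
  permv p (kernel_den a b) = kernel_den (p a) (p b).
Proof.
move=> cp; rewrite /kernel_den !(color_permP _ cp) rmorphM rmorphXn /= permvX.
by case: ifP => _; rewrite ?rmorph1 ?permvZ ?permv_lin.
Qed.

Section Term.
Context (s : var_perm m).
Let p := vperm s.

Lemma zperm_emb1 j : zperm K s (zcol j) (zpos j) = tofrac 'X_(p (emb1 j)).
Proof. by rewrite -emb1_col -emb1_pos zperm_ord. Qed.

Lemma zperm_emb2 j :
  zperm K s (zcol j) (k (zcol j) + zpos j) = tofrac 'X_(p (emb2 j)).
Proof. by rewrite -emb2_pos -{1}emb2_col zperm_ord. Qed.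

Lemma prod_zeta :
  \prod_i \prod_j \prod_(a < k i) \prod_(k j <= b < m j)
        zeta q t i j (zperm K s i a / zperm K s j b) =
  tofrac (permv p cross_kernel) / tofrac (permv p cross_den).
Proof.
have cp : color_perm (zc m) p by apply: vperm_color.
pose G (i j : I) (a b : nat) := zeta q t i j (zperm K s i a / zperm K s j (k j + b)%N).
transitivity (\prod_(x < #|zindex k|) \prod_(y < #|zindex l|)
    G (zcol x) (zcol y) (zpos x) (zpos y)).
  rewrite (prod_zindex k (fun i a => \prod_(y < #|zindex l|) G i (zcol y) a (zpos y))).
  apply: eq_bigr => i _; rewrite exchange_big; apply: eq_bigr => a _ /=.
  rewrite (prod_zindex l (fun j b => G i j a b)); apply: eq_bigr => j _.
  rewrite -{1}[k j]add0n big_addn big_mkord; apply: eq_bigr => b _.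
  by rewrite /G addnC.
rewrite /cross_kernel /cross_den !rmorph_prod /= -prodf_div; apply: eq_bigr => x _.
rewrite !rmorph_prod /= -prodf_div; apply: eq_bigr => y _.
rewrite permv_kernel // permv_kernel_den // -zetaE; last first.
  by rewrite (inj_eq perm_inj) emb12_neq.
by rewrite /G zperm_emb1 zperm_emb2 !(color_permP _ cp) emb1_col emb2_col.
Qed.

Lemma shuffle_term F G P1 d1 P2 d2 : represents (k := k) F P1 d1 ->
  represents (k := l) G P2 d2 ->
  leval k F (zperm K s) * leval l G (fun i a => zperm K s i (k i + a)) *
    (tofrac (permv p cross_kernel) / tofrac (permv p cross_den)) =
  tofrac (permv p (shuffle_num P1 P2)) / tofrac (permv p (shuffle_den d1 d2)).
Proof.
move=> r1 r2.
have e1 P : ev (k := k) (zperm K s) P = tofrac (permv p (inc1 P)).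
  rewrite permv_inc1; apply: ev_subst => j; rewrite scale1r; exact: zperm_emb1.
have e2 P : ev (k := l) (fun i a => zperm K s i (k i + a)) P = tofrac (permv p (inc2 P)).
  rewrite permv_inc2; apply: ev_subst => j; rewrite scale1r; exact: zperm_emb2.
rewrite r1; last first.
  by move=> i a h; have [j [<- <-]] := zord_ex h; rewrite zperm_emb1 tofracX_neq0.
rewrite r2; last first.
  by move=> i a h; have [j [<- <-]] := zord_ex (n := l) h; rewrite zperm_emb2 tofracX_neq0.
rewrite !e1 !e2 /shuffle_num /shuffle_den.
have morph3 (A B C : {mpoly K[#|zindex m|]}) :
    tofrac (permv p (A * B * C)) = tofrac (permv p A) * tofrac (permv p B) * tofrac (permv p C).
  by rewrite !rmorphM.
by rewrite !morph3 -!mulf_div.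
Qed.

End Term.

Lemma shuffle_componentE F G P1 d1 P2 d2 : represents (k := k) F P1 d1 ->
  represents (k := l) G P2 d2 ->
  shuffle_component q t m k F G =
  ((\prod_i (k i)`!) * (\prod_i (m i - k i)`!))%N%:R^-1 *
  \sum_(p | color_perm (zc m) p)
    tofrac (permv p (shuffle_num P1 P2)) / tofrac (permv p (shuffle_den d1 d2)).
Proof.
move=> r1 r2; rewrite /shuffle_component -(sum_var_perm (fun p =>
  tofrac (permv p (shuffle_num P1 P2)) / tofrac (permv p (shuffle_den d1 d2)))) mulr_sumr.
apply: eq_bigr => s _; rewrite prod_zeta mulrAC (shuffle_term s r1 r2) mulrC.
by [].
Qed.

End ShuffleTerm.

(** * Shuffle products preserve the wheel conditions *)

Section ShuffleWheel.
Context (K : fieldType) (Q : quiver) (q : K) (t : edge Q -> K).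
Local Notation I := (vertex Q).
Hypothesis q_neq0 : q != 0.
Hypothesis t_neq0 : forall e, t e != 0.
Local Notation Xall n := (var_prod K #|zindex n|).
Local Notation zc n := (@zcol I n).
Local Notation ker n := (kernel q t (zc n)).
Local Notation disc n := (discriminant K (zc n)).

Section Degrees.
Context (m k : I -> nat).
Hypothesis km : forall i, (k i <= m i)%N.
Local Notation l := (fun i => m i - k i)%N.
Local Notation e1 := (emb1 km).
Local Notation e2 := (@emb2 Q m k).
Local Notation i1 := (@inc1 K Q m k km).
Local Notation i2 := (@inc2 K Q m k).

Lemma inc1_elim a b (c : K) P : i1 (elim_var a b c P) = elim_var (e1 a) (e1 b) c (i1 P).
Proof.
apply: (mpoly_morph_ext (f := i1 \o elim_var a b c)
  (g := elim_var (e1 a) (e1 b) c \o i1)) P => [u|x] /=.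
  by rewrite elim_varC /inc1 !subst_varC elim_varC.
rewrite elim_varX inc1X elim_varX (inj_eq (@emb1_inj _ _ _ km)).
by case: ifP => _; rewrite ?inc1Z inc1X.
Qed.

Lemma inc2_elim a b (c : K) P : i2 (elim_var a b c P) = elim_var (e2 a) (e2 b) c (i2 P).
Proof.
apply: (mpoly_morph_ext (f := i2 \o elim_var a b c)
  (g := elim_var (e2 a) (e2 b) c \o i2)) P => [u|x] /=.
  by rewrite elim_varC /inc2 !subst_varC elim_varC.
rewrite elim_varX inc2X elim_varX (inj_eq (@emb2_inj _ _ _)).
by case: ifP => _; rewrite ?inc2Z inc2X.
Qed.

Lemma inc1_wheel_factor a b : i1 (wheel_factor q t (zc k) b a) =
  wheel_factor q t (zc m) (e1 b) (e1 a).
Proof.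
rewrite /wheel_factor rmorph_prod !emb1_col; apply: eq_bigr => h _; exact: inc1_lin.
Qed.

Lemma inc2_wheel_factor a b : i2 (wheel_factor q t (zc l) b a) =
  wheel_factor q t (zc m) (e2 b) (e2 a).
Proof.
rewrite /wheel_factor rmorph_prod !emb2_col; apply: eq_bigr => h _; exact: inc2_lin.
Qed.

Lemma cross_divides x y : divides (ker m (e1 x) (e2 y)) (cross_kernel q t km).
Proof.
apply: (@divides_trans _ (\prod_y' ker m (e1 x) (e2 y'))).
  exact: (@divides_prod_mem _ _ xpredT (fun y' => ker m (e1 x) (e2 y')) y).
exact: (@divides_prod_mem _ _ xpredT (fun x' => \prod_y' ker m (e1 x') (e2 y')) x).
Qed.

(** If all three variables lie in one factor, its own wheel condition applies. Otherwise the
    argument for ordered kernels works with left variables before right ones: a cross factor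
    contains the divisor, or vanishes if [c] is on the left and [b] on the right. *)
Lemma shuffle_num_wheel P1 P2 : in_wheel q t (zc k) P1 -> in_wheel q t (zc l) P2 ->
  in_wheel q t (zc m) (shuffle_num q t km P1 P2).
Proof.
move=> h1 h2 a b c bc nbc ab ac.
have by1 : divides (wheel_factor q t (zc m) b a) (elim_var c b q (i1 P1)) ->
    divides (wheel_factor q t (zc m) b a) (elim_var c b q (shuffle_num q t km P1 P2)).
  by move=> h; rewrite !rmorphM; apply/divides_mulr/divides_mulr.
have by2 : divides (wheel_factor q t (zc m) b a) (elim_var c b q (i2 P2)) ->
    divides (wheel_factor q t (zc m) b a) (elim_var c b q (shuffle_num q t km P1 P2)).
  by move=> h; rewrite !rmorphM; apply/divides_mulr/divides_mull.
have by3 x y : divides (wheel_factor q t (zc m) b a) (elim_var c b q (ker m (e1 x) (e2 y))) ->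
    divides (wheel_factor q t (zc m) b a) (elim_var c b q (shuffle_num q t km P1 P2)).
  move=> h; rewrite rmorphM; apply/divides_mull/(divides_trans h).
  exact/divides_morph/cross_divides.
case: (emb_cover km b) => [[b' eb]|[b' eb]]; case: (emb_cover km c) => [[c' ec]|[c' ec]];
  case: (emb_cover km a) => [[a' ea]|[a' ea]]; subst a b c.
- rewrite !(inj_eq (@emb1_inj _ _ _ km)) in nbc ab ac; rewrite !emb1_col in bc.
  apply: by1; rewrite -inc1_elim -inc1_wheel_factor; apply: (divides_morph i1).
  exact: h1.
- by apply: (by3 b' a'); apply: elim_kernel_left.
- by apply: (by3 a' c'); apply: elim_kernel_right.
- by apply: (by3 b' a'); apply: elim_kernel_left.
- by apply: (by3 c' b'); rewrite elim_kernel_zero //; apply: divides0.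
- by apply: (by3 c' b'); rewrite elim_kernel_zero //; apply: divides0.
- by apply: (by3 a' c'); apply: elim_kernel_right.
- rewrite !(inj_eq (@emb2_inj _ _ _)) in nbc ab ac; rewrite !emb2_col in bc.
  apply: by2; rewrite -inc2_elim -inc2_wheel_factor; apply: (divides_morph i2).
  exact: h2.
Qed.

Definition unit_divisor n (P : {mpoly K[n]}) := exists D, divides P (var_prod K n ^+ D).

Lemma unit_divisor_prod n (A : Type) (r : seq A) (P : pred A) (G : A -> {mpoly K[n]}) :
  (forall x, P x -> unit_divisor (G x)) -> unit_divisor (\prod_(x <- r | P x) G x).
Proof.
move=> h; apply: (big_ind (@unit_divisor n)) => //.
  by exists 0%N; apply: divides_refl.
by move=> P1 P2 [D1 hd1] [D2 hd2]; exists (D1 + D2)%N; rewrite exprD; apply: divides_mul.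
Qed.

Lemma unit_divisorX n (j : 'I_n) d : unit_divisor ('X_j ^+ d : {mpoly K[n]}).
Proof.
exists d; rewrite /var_prod (bigD1 j) //= exprMn; apply/divides_mulr/divides_refl.
Qed.

(** The symmetrization needs one denominator for all its terms. Monomials aside, the discriminant
    serves: it is invariant and contains every difference of two variables of the same color. *)
Lemma shuffle_den_divides d1 d2 :
  exists D, divides (shuffle_den q km d1 d2) (Xall m ^+ D * disc m).
Proof.
have [D1 h1] : unit_divisor (i1 (Xall k ^+ d1)).
  by rewrite inc1_Xall; apply: unit_divisor_prod => x _; apply: unit_divisorX.
have [D2 h2] : unit_divisor (i2 (Xall l ^+ d2)).
  by rewrite inc2_Xall; apply: unit_divisor_prod => x _; apply: unit_divisorX.
pose U := \prod_x \prod_y ('X_(e2 y) ^+ #|[pred h | adj (zc m (e1 x)) (zc m (e2 y)) h]|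
  : {mpoly K[#|zindex m|]}).
have [D3 h3] : unit_divisor U.
  by do 2!(apply: unit_divisor_prod => ? _); apply: unit_divisorX.
pose V := \prod_x \prod_y
  (if zc m (e1 x) == zc m (e2 y) then q *: lin (e1 x) (e2 y) 1 else 1
  : {mpoly K[#|zindex m|]}).
have eUV : cross_den q km = U * V.
  by rewrite /cross_den /U /V -big_split; apply: eq_bigr => x _; rewrite -big_split.
have hV : divides V (disc m).
  pose r (ab : 'I_#|zindex m| * 'I_#|zindex m|) := (zc m ab.1 == zc m ab.2) &&
    ((ab.1 \in codom e1) && (ab.2 \in codom e2)).
  have -> : disc m = (\prod_(ab | r ab) lin ab.1 ab.2 1) *
      (\prod_(ab | [&& zc m ab.1 == zc m ab.2, ab.1 != ab.2 & ~~ r ab]) lin ab.1 ab.2 1).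
    rewrite /discriminant (bigID r) /=; congr (_ * _); apply: eq_bigl => ab; last by rewrite andbA.
    rewrite /r; case: (zc m ab.1 == zc m ab.2) => //=; apply/andP/idP => [[]//|h]; split=> //.
    by have /andP[/codomP[x ->] /codomP[y ->]] := h; apply: emb12_neq.
  apply: divides_mulr.
  have -> : \prod_(ab | r ab) lin ab.1 ab.2 1 = \prod_x \prod_y
      (if zc m (e1 x) == zc m (e2 y) then lin (e1 x) (e2 y) 1 else 1 : {mpoly K[#|zindex m|]}).
    rewrite pair_bigA /= -big_mkcond /=.
    have inj : injective (fun xy => (e1 xy.1, e2 xy.2)).
      by move=> [x y] [x' y'] /= [/emb1_inj -> /emb2_inj ->].
    rewrite -(big_imset (fun ab => lin ab.1 ab.2 1) (h := fun xy => (e1 xy.1, e2 xy.2))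
      (A := [pred xy | zc m (e1 xy.1) == zc m (e2 xy.2)]) (in2W inj)) /=.
    apply: eq_bigl => ab; apply/andP/imsetP => [[hc /andP[/codomP[x ex] /codomP[y ey]]]|].
      exists (x, y); rewrite ?inE /= -?ex -?ey //.
      by case: (ab) ex ey => /= ? ? -> ->.
    by move=> [[x y]]; rewrite inE => hc -> /=; rewrite hc !codom_f.
  apply: divides_prod => x _; apply: divides_prod => y _.
  case: ifP => _; last exact: divides_refl.
  exists (q^-1)%:MP; rewrite mulrC mul_mpolyC scalerA mulVf // scale1r.
  by [].
exists (D1 + D2 + D3)%N; rewrite /shuffle_den eUV !exprD [_ * (U * V)]mulrA.
exact: divides_mul (divides_mul (divides_mul h1 h2) h3) hV.
Qed.

End Degrees.

Hypothesis charK : [pchar K] =i pred0.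
Hypothesis q_neq1 : q != 1.
Hypothesis w_neq1 : forall h, hweight q t h != 1.
Hypothesis w_neqq : forall h, hweight q t h != q.

Lemma disc_neq0 n : disc n != 0.
Proof. by apply/prodf_neq0 => ab /andP[_ h]; apply: lin_neq0. Qed.

(** The form that shuffle components take over the invariant denominator; the discriminant is
    cancelled only in the full product, which is known to be a Laurent polynomial. *)
Definition wheel_fraction n (x : ratfun K n) : Prop := exists P D,
  [/\ color_symmetric P, in_wheel q t (zc n) P &
      x = tofrac P / tofrac (Xall n ^+ D * disc n)].

Lemma wheel_fraction0 n : wheel_fraction (0 : ratfun K n).
Proof.
exists 0, 0%N; split; [by move=> p _; rewrite rmorph0 | exact: in_wheel0 |].
by rewrite rmorph0 mul0r.
Qed.

Lemma add_frac (A : idomainType) (a b c d u : A) : b != 0 -> d != 0 -> u != 0 ->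
  tofrac a / tofrac (b * u) + tofrac c / tofrac (d * u) =
  tofrac (a * d + c * b) / tofrac (b * d * u).
Proof.
move=> b0 d0 u0; rewrite addf_div ?tofrac_eq0 ?mulf_neq0 // -!rmorphM -rmorphD.
by apply: tofrac_cross; rewrite ?mulf_neq0 //; ring.
Qed.

Lemma tofrac_scaled_sum (A : idomainType) (J : finType) (P : pred J) (f : J -> A) (c d : A) :
  tofrac (c * \sum_(p | P p) f p) / tofrac d =
  tofrac c * \sum_(p | P p) (tofrac (f p) / tofrac d).
Proof. by rewrite rmorphM rmorph_sum -mulrA mulr_suml. Qed.

Lemma wheel_fractionD n (x y : ratfun K n) :
  wheel_fraction x -> wheel_fraction y -> wheel_fraction (x + y).
Proof.
move=> [P [D [sP wP ->]]] [P' [D' [sP' wP' ->]]].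
exists (P * Xall n ^+ D' + P' * Xall n ^+ D), (D + D')%N; split.
- by move=> p cp; rewrite rmorphD !rmorphM /= sP // sP' // !permv_Xall.
- by apply: in_wheelD; rewrite mulrC; apply: in_wheelM.
- by rewrite exprD; apply: add_frac; rewrite ?Xall_neq0 ?disc_neq0.
Qed.

Lemma shuffle_component_fraction m k F G : (forall i, k i <= m i)%N ->
  shuffle_algebra q t F -> shuffle_algebra q t G ->
  wheel_fraction (shuffle_component q t m k F G).
Proof.
move=> km [sF wF] [sG wG].
have [P1 [d1 r1]] := represents_ex k F.
have [P2 [d2 r2]] := represents_ex (fun i => m i - k i)%N G.
have w1 := wheel_in_wheel q_neq0 t_neq0 r1 (symmetric_represents r1 sF) wF.
have w2 := wheel_in_wheel q_neq0 t_neq0 r2 (symmetric_represents r2 sG) wG.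
have [D [S eS]] := shuffle_den_divides km d1 d2.
have S0 : S != 0.
  apply: contraTneq (mulf_neq0 (Xall_neq0 K m D) (disc_neq0 m)) => S0.
  by rewrite eS S0 mulr0 eqxx.
rewrite (shuffle_componentE t q_neq0 km r1 r2); set c := (_ * _)%N.
exists ((c%:R^-1)%:MP * \sum_(p | color_perm (zc m) p)
  permv p (shuffle_num q t km P1 P2 * S)), D; split.
- move=> p cp; rewrite rmorphM /= rmorph_sum /= [permv p _%:MP]subst_varC; congr (_ * _).
  rewrite [RHS](reindex_inj (mulIg p)) /=; apply: eq_big => [p'|p' _].
    by rewrite color_permMr.
  by rewrite permvM.
- apply: in_wheelM; apply: in_wheel_sum => p cp; apply: in_wheel_perm => //.
  by rewrite mulrC; apply/in_wheelM/shuffle_num_wheel.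
- rewrite tofrac_scaled_sum; congr (_ * _).
    by rewrite -[tofrac _]/(ratC m _) ratCV rmorph_nat.
  apply: eq_bigr => p cp; apply: tofrac_cross.
  + apply: contraNneq (shuffle_den_neq0 q_neq0 km d1 d2) => e.
    by rewrite -(permv1 (shuffle_den _ _ _ _)) -(mulgV p) permvM e rmorph0.
  + by rewrite mulf_neq0 ?Xall_neq0 ?disc_neq0.
  + rewrite -[X in _ * (X * _)](permv_Xall K p D) -[X in _ * (_ * X)](permv_discriminant K cp).
    by rewrite -!rmorphM eS /=; congr (permv p _); ring.
Qed.

(** Up to monomials, [P] times the discriminant is a symmetric numerator subject to the wheel
    conditions; both properties descend to [P] because the discriminant is invariant and coprime to
    the wheel divisors. *)
Lemma shuffle_product_closed F G P : shuffle_algebra q t F -> shuffle_algebra q t G ->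
  is_shuffle_product q t F G P -> shuffle_algebra q t P.
Proof.
move=> sF sG hP.
have good n (PP : {mpoly K[#|zindex n|]}) d : represents P PP d ->
    color_symmetric PP /\ in_wheel q t (zc n) PP.
  move=> r; have : wheel_fraction (leval n P (zvar K n)).
    rewrite hP; apply: (big_ind (@wheel_fraction n)).
    - exact: wheel_fraction0.
    - exact: wheel_fractionD.
    - by move=> k _; apply: shuffle_component_fraction => // i; rewrite -ltnS; exact: ltn_ord.
  rewrite (leval_zvar r) => -[N [D [sN wN e]]].
  have {}e : PP * (Xall n ^+ D * disc n) = N * Xall n ^+ d.
    apply/eqP; rewrite -tofrac_eq !rmorphM /=; apply/eqP.
    move/eqP: e; rewrite eqr_div ?tofrac_eq0 ?mulf_neq0 ?Xall_neq0 ?disc_neq0 //.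
    by rewrite -!rmorphM tofrac_eq => /eqP ->.
  have nz : Xall n ^+ D * disc n != 0 by rewrite mulf_neq0 ?Xall_neq0 ?disc_neq0.
  split.
    move=> p cp; apply: (mulIf nz); rewrite e -{1}(permv_Xall K p D).
    rewrite -{1}(permv_discriminant K cp) -!rmorphM e rmorphM /= sN //.
    by rewrite permv_Xall.
  apply: (@in_wheel_cancel_prod K Q q t q_neq0 t_neq0 _ (zc n) q_neq1 w_neq1 w_neqq
    (fun ab => (zc n ab.1 == zc n ab.2) && (ab.1 != ab.2))).
    by move=> xy /andP[].
  apply: (in_wheel_cancel_Xall q_neq0 t_neq0 (d := D)).
  have -> : Xall n ^+ D * (disc n * PP) = Xall n ^+ d * N by rewrite mulrC [RHS]mulrC -e; ring.
  exact: in_wheelM.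
split; first by apply: symmetric_of_represents => n PP d /good[].
by apply: wheel_of_represents => // n PP d /good[].
Qed.

End ShuffleWheel.

(** * Appending one variable *)

Section Extension.
Context (K : fieldType) (Q : quiver) (q : K) (t : edge Q -> K).
Local Notation I := (vertex Q).
Context (m k : I -> nat).
Hypothesis km : forall i, (k i <= m i)%N.
Local Notation zc n := (@zcol I n).
Local Notation e1 := (emb1 km).
Local Notation e2 := (@emb2 Q m k).
Local Notation i1 := (@inc1 K Q m k km).
Local Notation i2 := (@inc2 K Q m k).

Lemma prod_cover (A : comNzRingType) (f : 'I_#|zindex m| -> A) :
  \prod_z f z = (\prod_x f (e1 x)) * (\prod_y f (e2 y)).
Proof.
rewrite (bigID (mem (codom e1))) /=; congr (_ * _).
  rewrite -(big_imset f (in2W (@emb1_inj _ _ _ km))) /=; apply: eq_bigl => z.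
  by apply/codomP/imsetP => [[x ->]|[x _ ->]]; exists x.
rewrite -(big_imset f (in2W (@emb2_inj _ m k))) /=; apply: eq_bigl => z.
apply/idP/imsetP => [h|[y _ ->]].
  case: (emb_cover km z) => [[x ex]|[y ey]]; last by exists y.
  by rewrite ex codom_f in h.
by apply/negP => /codomP[x /eqP]; rewrite eq_sym (negbTE (emb12_neq km x y)).
Qed.

Definition ext_fun (w : {perm 'I_#|zindex k|}) z :=
  if [pick x | e1 x == z] is Some x then e1 (w x) else z.

Lemma ext_fun_emb1 w x : ext_fun w (e1 x) = e1 (w x).
Proof.
rewrite /ext_fun; case: pickP => [x' /eqP /emb1_inj ->//|/(_ x)].
by rewrite eqxx.
Qed.

Lemma ext_fun_emb2 w y : ext_fun w (e2 y) = e2 y.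
Proof.
by rewrite /ext_fun; case: pickP => // x; rewrite (negbTE (emb12_neq km x y)).
Qed.

Lemma ext_fun_inj w : injective (ext_fun w).
Proof.
move=> z z'; case: (emb_cover km z) => [[x ->]|[y ->]];
  case: (emb_cover km z') => [[x' ->]|[y' ->]];
  rewrite ?ext_fun_emb1 ?ext_fun_emb2.
- by move=> /emb1_inj /perm_inj ->.
- by move=> /eqP; rewrite (negbTE (emb12_neq km _ _)).
- by move=> /eqP; rewrite eq_sym (negbTE (emb12_neq km _ _)).
- by [].
Qed.

Definition ext_perm w : {perm 'I_#|zindex m|} := perm (@ext_fun_inj w).

Lemma ext_perm_emb1 w x : ext_perm w (e1 x) = e1 (w x).
Proof. by rewrite permE ext_fun_emb1. Qed.

Lemma ext_perm_emb2 w y : ext_perm w (e2 y) = e2 y.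
Proof. by rewrite permE ext_fun_emb2. Qed.

Lemma ext_perm_color w : color_perm (zc k) w -> color_perm (zc m) (ext_perm w).
Proof.
move=> cw; apply/forallP => z; case: (emb_cover km z) => [[x ->]|[y ->]].
  by rewrite ext_perm_emb1 !emb1_col (color_permP _ cw).
by rewrite ext_perm_emb2.
Qed.

Lemma permv_ext_inc1 w P : permv (ext_perm w) (i1 P) = i1 (permv w P).
Proof.
rewrite /permv /inc1 !subst_var_comp; apply: subst_var_ext => x //=.
by rewrite ext_perm_emb1.
Qed.

Lemma permv_ext_inc2 w P : permv (ext_perm w) (i2 P) = i2 P.
Proof.
rewrite /permv /inc2 !subst_var_comp; apply: subst_var_ext => x /=.
  by rewrite ext_perm_emb2.
by rewrite mulr1.
Qed.

Lemma permv_ext_cross w : color_perm (zc k) w ->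
  permv (ext_perm w) (cross_kernel q t km) = cross_kernel q t km.
Proof.
move=> cw; rewrite /cross_kernel rmorph_prod [RHS](reindex_inj (@perm_inj _ w)).
apply: eq_bigr => x _; rewrite /= rmorph_prod; apply: eq_bigr => y _ /=.
by rewrite permv_kernel ?ext_perm_color // ext_perm_emb1 ext_perm_emb2.
Qed.

End Extension.

Section LastVariable.
Context (K : fieldType) (Q : quiver) (q : K) (t : edge Q -> K).
Local Notation I := (vertex Q).
Context (n : I -> nat) (i : I).
Hypothesis ni : (0 < n i)%N.
Local Notation zc n := (@zcol I n).
Local Notation ker n := (kernel q t (zc n)).
Local Notation vdm n := (vandermonde K (zc n) (@zpos I n)).
Local Notation sgn n := (vsign K (zc n) (@zpos I n)).
Local Notation alt n := (@color_alternate K Q #|zindex n| (zc n) (@zpos I n)).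

Definition lower (j : I) : nat := n j - (j == i).

Lemma lower_le j : (lower j <= n j)%N.
Proof. exact: leq_subr. Qed.

Local Notation k := lower.
Local Notation km := lower_le.
Local Notation l := (fun j => n j - lower j)%N.
Local Notation e1 := (emb1 km).
Local Notation e2 := (@emb2 Q n k).
Local Notation i1 := (@inc1 K Q n k km).

Lemma lower_compl j : (n j - lower j = (j == i))%N.
Proof.
rewrite /lower; case: eqP => [->|_]; last by rewrite subn0 subnn.
by rewrite subKn.
Qed.

Lemma last_ex : exists y : 'I_#|zindex l|, zcol y = i /\ zpos y = 0%N.
Proof. by apply: (zord_ex (n := l)); rewrite lower_compl eqxx. Qed.

Lemma last_uniq (y y' : 'I_#|zindex l|) : y = y'.
Proof.
have h (z : 'I_#|zindex l|) : zcol z = i /\ zpos z = 0%N.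
  have := zpos_lt z; rewrite lower_compl; case: eqP => [-> |//].
  by rewrite ltnS leqn0 => /eqP.
have [c p] := h y; have [c' p'] := h y'.
by apply: zindex_inj; rewrite ?c ?p ?c' ?p'.
Qed.

Lemma prod_last (A : comNzRingType) (f : 'I_#|zindex l| -> A) y : \prod_z f z = f y.
Proof.
rewrite (bigD1 y) //= big1 ?mulr1 // => z.
by rewrite (last_uniq z y) eqxx.
Qed.

Section Last.
Context (y : 'I_#|zindex l|).
Local Notation top := (e2 y).

Lemma top_col : zcol top = i.
Proof.
rewrite emb2_col; have := zpos_lt y; rewrite lower_compl.
by case: eqP.
Qed.

Lemma top_pos : zpos top = (n i).-1.
Proof.
have c := top_col; rewrite emb2_col in c; rewrite emb2_pos c.
have := zpos_lt y; rewrite lower_compl c eqxx ltnS leqn0 => /eqP ->.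
by rewrite addn0 /lower eqxx subn1.
Qed.

Lemma emb1_pos_lt x : zcol (e1 x) = i -> (zpos (e1 x) < zpos top)%N.
Proof.
rewrite emb1_col emb1_pos top_pos => c; have := zpos_lt x.
by rewrite c /lower eqxx subn1.
Qed.

Lemma pair_cover (A : comNzRingType) (f : 'I_#|zindex n| -> 'I_#|zindex n| -> A) P :
  ~~ P (top, top) -> (forall x, ~~ P (top, e1 x)) ->
  \prod_(ab | P ab) f ab.1 ab.2 =
  (\prod_(xx | P (e1 xx.1, e1 xx.2)) f (e1 xx.1) (e1 xx.2)) *
  (\prod_(x | P (e1 x, top)) f (e1 x) top).
Proof.
move=> h1 h2; pose g a b := if P (a, b) then f a b else 1.
rewrite big_mkcond /= (eq_bigr (fun ab => g ab.1 ab.2)); last by case.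
rewrite -(pair_bigA _ g) (prod_cover km) (prod_last _ y) /=.
rewrite (prod_cover km (g top)) (prod_last _ y) /= [g top top]/g (negbTE h1) mulr1.
rewrite [X in _ * X]big1 ?mulr1; last by move=> x _; rewrite /g (negbTE (h2 x)).
under eq_bigr => x _ do rewrite (prod_cover km) (prod_last _ y) /=.
rewrite big_split /=; congr (_ * _); last by rewrite [RHS]big_mkcond.
by rewrite (pair_bigA _ (fun x x' => g (e1 x) (e1 x'))) [RHS]big_mkcond.
Qed.

(** A variable that comes last in the order contributes exactly the cross factors of a shuffle
    product with a generator on the right. *)
Lemma ordered_kernel_top key : (forall x, key (e1 x) < key top)%N ->
  ordered_kernel q t (zc n) key =
  i1 (ordered_kernel q t (zc k) (key \o e1)) * cross_kernel q t km.
Proof.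
move=> hk; rewrite /ordered_kernel (pair_cover (ker n)) /=; last 2 first.
- by rewrite ltnn.
- by move=> x; rewrite -leqNgt ltnW.
congr (_ * _).
  rewrite rmorph_prod; apply: eq_bigr => xx _ /=.
  rewrite /kernel rmorphM rmorph_prod /= !emb1_col; congr (_ * _).
    by case: ifP => _; rewrite ?inc1_lin ?rmorph1.
  by apply: eq_bigr => h _; rewrite inc1_lin.
rewrite /cross_kernel; apply: eq_big => [x|x _]; first by rewrite hk.
by rewrite (prod_last _ y).
Qed.

Definition vandermonde_top : {mpoly K[#|zindex n|]} :=
  \prod_(x | zc n (e1 x) == zc n top) lin (e1 x) top 1.

Lemma vandermonde_topE : vdm n = i1 (vdm k) * vandermonde_top.
Proof.
rewrite /vandermonde (pair_cover (fun a b => lin a b 1)) /=; last 2 first.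
- by rewrite ltnn andbF.
- move=> x; apply/negP => /andP[/eqP e]; rewrite ltnNge ltnW // emb1_pos_lt //.
  by rewrite -e top_col.
congr (_ * _); last first.
  apply: eq_bigl => x; case: eqP => //= e; apply: emb1_pos_lt.
  by rewrite e top_col.
rewrite rmorph_prod; apply: eq_big => [xx|xx _] /=; last by rewrite inc1_lin.
by rewrite !emb1_col !emb1_pos.
Qed.

Lemma permv_ext_top w : color_perm (zc k) w ->
  permv (ext_perm km w) vandermonde_top = vandermonde_top.
Proof.
move=> cw; rewrite /vandermonde_top rmorph_prod [RHS](reindex_inj (@perm_inj _ w)) /=.
apply: eq_big => [x|x _]; first by rewrite !emb1_col (color_permP _ cw).
by rewrite permv_lin ext_perm_emb1 ext_perm_emb2.
Qed.

Lemma sgn_ext w : color_perm (zc k) w -> sgn n (ext_perm km w) = sgn k w.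
Proof.
have posn := @zindex_inj I n; have posk := @zindex_inj I k.
move=> cw; apply: (scale_vandermonde_inj (col := zc n) (pos := @zpos I n)).
rewrite -(vsignP K posn (ext_perm_color km cw)).
rewrite vandermonde_topE rmorphM /= permv_ext_top // permv_ext_inc1.
by rewrite (vsignP K posk cw) inc1Z scalerAl.
Qed.

(** Alternating first over the permutations that fix the last variable is absorbed by the full
    alternation, and contributes the order of that subgroup. *)
Lemma alternate_inc1 P Y :
  (forall w, color_perm (zc k) w -> permv (ext_perm km w) Y = Y) ->
  alt n (i1 (alt k P) * Y) =
  #|[pred w | color_perm (zc k) w]|%:R *: alt n (i1 P * Y).
Proof.
have posn := @zindex_inj I n.
move=> hY; have -> : i1 (alt k P) * Y = \sum_(w | color_perm (zc k) w)
    sgn k w *: permv (ext_perm km w) (i1 P * Y).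
  rewrite /color_alternate rmorph_sum mulr_suml; apply: eq_bigr => w cw /=.
  by rewrite inc1Z -permv_ext_inc1 -scalerAl rmorphM /= hY.
rewrite color_alternate_sum scaler_nat -sumr_const; apply: eq_big => [w //|w cw].
have ce := ext_perm_color km cw.
rewrite color_alternateZ (color_alternate_perm posn) // scalerA sgn_ext //.
by rewrite (vsign_sqr K _ cw) scale1r.
Qed.

End Last.

End LastVariable.

Section AppendVariable.
Context (K : fieldType) (Q : quiver) (q : K) (t : edge Q -> K).
Local Notation I := (vertex Q).
Hypothesis q_neq0 : q != 0.
Hypothesis charK : [pchar K] =i pred0.
Context (n : I -> nat) (i : I).
Hypothesis ni : (0 < n i)%N.
Local Notation Xall n := (var_prod K #|zindex n|).
Local Notation zc n := (@zcol I n).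
Local Notation vdm n := (vandermonde K (zc n) (@zpos I n)).
Local Notation sgn n := (vsign K (zc n) (@zpos I n)).
Local Notation alt n := (@color_alternate K Q #|zindex n| (zc n) (@zpos I n)).
Local Notation k := (lower n i).
Local Notation km := (lower_le n i).
Local Notation l := (fun j => n j - lower n i j)%N.
Local Notation e1 := (emb1 km).
Local Notation e2 := (@emb2 Q n k).
Local Notation i1 := (@inc1 K Q n k km).
Local Notation i2 := (@inc2 K Q n k).

Lemma inc_Xall d : i1 (Xall k ^+ d) * i2 (Xall l ^+ d) = Xall n ^+ d.
Proof.
rewrite inc1_Xall inc2_Xall -(prod_cover km (fun z => 'X_z ^+ d)) prodrXl.
by [].
Qed.

Context (y : 'I_#|zindex l|).
Local Notation top := (e2 y).
Local Notation vtop := (vandermonde_top K y).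

(** With a single variable on the right, the zeta denominators give a power of it times
    [vandermonde_top], the factor that separates the Vandermonde products in degrees [k] and [n]. *)
Lemma cross_den_top : exists M (c : K), c != 0 /\
  cross_den q km = c *: (i2 (Xall l ^+ M) * vtop).
Proof.
exists (\sum_x #|[pred h | adj (zc n (e1 x)) (zc n top) h]|)%N.
exists (q ^+ #|[pred x | zc n (e1 x) == zc n top]|); split; first by rewrite expf_neq0.
rewrite inc2_Xall (prod_last ni _ y) /cross_den.
under eq_bigr => x _ do rewrite (prod_last ni _ y) /kernel_den.
rewrite big_split /= -expr_sum scalerAr; congr (_ * _).
rewrite -big_mkcond /vandermonde_top /= scaler_prod prodr_const; congr (_ *: _).
Qed.

Lemma term_identity M (c : K) S' p' a D :
  cross_den q km = c *: (i2 (Xall l ^+ M) * vtop) -> vdm k * S' = alt k p' ->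
  shuffle_num q t km S' (Xall l ^+ (a + M)) * (c *: (Xall n ^+ D * vdm n)) =
  i1 (alt k p') * (i2 (Xall l ^+ a) * cross_kernel q t km) * shuffle_den q km D D.
Proof.
move=> hc <-; rewrite /shuffle_num /shuffle_den inc_Xall hc (vandermonde_topE K ni y).
rewrite exprD [i2 (_ * _)]rmorphM [i1 (vdm k * S')]rmorphM -!mul_mpolyC /=.
move: (i2 (Xall l ^+ M)) (i2 (Xall l ^+ a)) (Xall n ^+ D) (cross_kernel q t km) => u v w x.
by move: (i1 S') (i1 (vdm k)) vtop (c%:MP) => a1 a2 a3 a4; ring.
Qed.

(** Every term is rewritten over the denominator [Z], a multiple of the Vandermonde product. Since
    [Z] changes by the sign of [p], the symmetrization of fractions becomes an alternation of
    numerators. *)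
Lemma alternate_fraction_sum S' p' S D a M (c : K) :
  c != 0 -> cross_den q km = c *: (i2 (Xall l ^+ M) * vtop) ->
  vdm k * S' = alt k p' ->
  vdm n * S = alt n (shuffle_num q t km p' (Xall l ^+ a)) ->
  \sum_(p | color_perm (zc n) p)
    tofrac (permv p (shuffle_num q t km S' (Xall l ^+ (a + M)))) /
    tofrac (permv p (shuffle_den q km D D)) =
  tofrac (#|[pred w | color_perm (zc k) w]|%:R *: S) / tofrac (c *: Xall n ^+ D).
Proof.
move=> c0 hc hS' hS; have posn := @zindex_inj I n.
set Y := i2 (Xall l ^+ a) * cross_kernel q t km.
set Z := c *: (Xall n ^+ D * vdm n).
have v0 : vdm n != 0 by apply: vandermonde_neq0.
have Z0 : Z != 0 by rewrite /Z scaler_eq0 negb_or c0 mulf_neq0 ?Xall_neq0.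
have id0 := term_identity a D hc hS'; rewrite -/Y -/Z in id0.
have den0 p : permv p (shuffle_den q km D D) != 0.
  apply: contraNneq (shuffle_den_neq0 q_neq0 km D D) => e.
  by rewrite -(permv1 (shuffle_den _ _ _ _)) -(mulgV p) permvM e rmorph0.
have term p : color_perm (zc n) p ->
    tofrac (permv p (shuffle_num q t km S' (Xall l ^+ (a + M)))) /
    tofrac (permv p (shuffle_den q km D D)) =
    tofrac (sgn n p *: permv p (i1 (alt k p') * Y)) / tofrac Z.
  move=> cp; apply: tofrac_cross => //.
  have pZ : permv p Z = sgn n p *: Z.
    rewrite /Z permvZ rmorphM /= permv_Xall (vsignP K posn cp).
    by rewrite -scalerAr !scalerA mulrC.
  have /= := congr1 (permv p) id0; rewrite rmorphM /= pZ -scalerAr.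
  rewrite [permv p (_ * shuffle_den _ _ _ _)]rmorphM /=.
  move=> /(congr1 (fun P => sgn n p *: P)); rewrite scalerA (vsign_sqr K _ cp) scale1r => ->.
  by rewrite scalerAl.
rewrite (eq_bigr _ term) -mulr_suml -rmorph_sum /=.
rewrite -/(alt n (i1 (alt k p') * Y)) (alternate_inc1 ni y); last first.
  by move=> w cw; rewrite rmorphM /= permv_ext_inc2 permv_ext_cross.
have -> : i1 p' * Y = shuffle_num q t km p' (Xall l ^+ a) by rewrite /Y mulrA.
rewrite -hS; apply: tofrac_cross => //.
  by rewrite scaler_eq0 negb_or c0 Xall_neq0.
rewrite /Z -!mul_mpolyC; move: (Xall n ^+ D) (vdm n) => u v.
by move: (c%:MP) (_%:R%:MP) => a1 a2; ring.
Qed.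

Lemma zpow_represents a D :
  represents (k := l) (zpow K i (a%:Z - D%:Z)) (Xall l ^+ a) D.
Proof.
move=> m x hx; rewrite levalU.
have -> : [forall j, size ([ffun j0 => if j0 == i then [:: a%:Z - D%:Z] else [::]] j) == l j].
  by apply/forallP => j; rewrite ffunE lower_compl //; case: (j == i).
rewrite /laurent_monomial -(prod_zindex l (fun j b => x j b ^
  ([ffun j0 => if j0 == i then [:: a%:Z - D%:Z] else [::]] j)`_b)).
rewrite !rmorphXn /= /var_prod !rmorph_prod -!prodrXl -prodf_div.
apply: eq_bigr => z _ /=; have xz : x (zcol z) (zpos z) != 0 by apply/hx/zpos_lt.
have [cz pz] : zcol z = i /\ zpos z = 0%N.
  have := zpos_lt z; rewrite lower_compl //; case: eqP => [-> |//].
  by rewrite ltnS leqn0 => /eqP.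
rewrite evX ffunE cz eqxx pz /=; rewrite cz pz in xz.
by rewrite expfzDr // -exprnN.
Qed.

Lemma zpow_homogeneous d : homogeneous l (zpow K i d).
Proof.
move=> m k' x ne; rewrite levalU; case: forallP => // h; case: ne.
apply: boolp.funext => j; have := h j; rewrite ffunE lower_compl // => /eqP <-.
by case: eqP.
Qed.

Lemma shuffle_component_degree m k' l' kF F G : homogeneous kF F -> homogeneous l' G ->
  (k' = kF -> (fun j => m j - k' j)%N = l' -> False) ->
  shuffle_component q t m k' F G = 0.
Proof.
move=> hF hG ne; rewrite /shuffle_component big1 // => s _.
have [e1|e1] := boolp.pselect (k' = kF); last by rewrite hF // !mul0r.
have [e2|e2] := boolp.pselect ((fun j => m j - k' j)%N = l'); first by case: (ne e1 e2).
by rewrite [leval (fun j => m j - k' j)%N _ _]hG // mulr0 !mul0r.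
Qed.

Lemma tofrac_scale_div (A : idomainType) (u a b c d : A) : u != 0 -> b != 0 -> d != 0 ->
  a * (d * u) = c * b -> tofrac a / tofrac b = (tofrac u)^-1 * (tofrac c / tofrac d).
Proof.
move=> u0 b0 d0 e; rewrite [RHS]mulrC -mulrA -invfM -rmorphM; apply: tofrac_cross => //.
by rewrite mulf_neq0.
Qed.

Lemma append_variable E' S' p' D a :
  spherical_subalgebra q t E' -> homogeneous k E' -> represents E' S' D ->
  vdm k * S' = alt k p' ->
  exists E S, [/\ spherical_subalgebra q t E, homogeneous n E, represents E S D &
    vdm n * S = alt n (shuffle_num q t km p' (Xall l ^+ a))].
Proof.
move=> sE' hE' rE' eS'; have posn := @zindex_inj I n.
have [M [c [c0 hc]]] := cross_den_top.
have [S [eS _]] := color_alternate_divides posn charK (shuffle_num q t km p' (Xall l ^+ a)).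
pose C := ((\prod_j (k j)`!) * (\prod_j (n j - k j)`!))%N.
pose W : K := #|[pred w | color_perm (zc k) w]|%:R.
have C0 : C%:R != 0 :> K.
  rewrite (proj1 (pcharf0P K) charK) -lt0n muln_gt0 !prodn_gt0 // => j; exact: fact_gt0.
have W0 : W != 0.
  rewrite /W (proj1 (pcharf0P K) charK) -lt0n; apply/card_gt0P; exists 1%g.
  by rewrite inE color_perm1.
(* [C] is the product of factorials in the shuffle product, [W] comes from the repeated alternation,
   and [c] from the zeta denominators. *)
pose c' := C%:R^-1 * W * c^-1; have c'0 : c' != 0.
  by rewrite !mulf_neq0 ?invr_eq0.
have [E [hE rE]] := laurent_of_poly (c' *: S) D.
exists (c'^-1 *: E), S; split=> //; last 2 first.
- by move=> m k' x ne; rewrite levalZ hE // mulr0.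
- move=> m x hx; rewrite levalZ rE // evZ !mulrA; congr (_ / _).
  by rewrite -rmorphM mulVf // rmorph1 mul1r.
(* [E] is the product of [E'] and the generator [G]. In the exponent, [M] cancels the power of the
   last variable in [cross_den], and [- D] gives both factors the same denominator exponent. *)
apply: gen_scale; pose G := zpow K i ((a + M)%:Z - D%:Z).
have hG : homogeneous l G by apply: zpow_homogeneous.
apply: (@gen_mul K Q q t _ E' G E) => //.
  by apply: gen_mem; exists i, ((a + M)%:Z - D%:Z).
move=> m; have [->|mn] := boolp.pselect (m = n); last first.
  rewrite hE // big1 // => kk _; apply: (shuffle_component_degree hE' hG) => ek el.
  case: mn; apply: boolp.funext => j; have := congr1 (@^~ j) el; have := congr1 (@^~ j) ek.
  move=> /= <- e; rewrite -(subnKC (_ : kk j <= n j)%N) -?e ?subnKC //.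
    by rewrite -ltnS.
  by rewrite (congr1 (@^~ j) ek) lower_le.
pose k0 : {dffun forall j : I, 'I_(n j).+1} := [ffun j => inord (k j)].
have ek0 : (fun j => k0 j : nat) = k.
  by apply: boolp.funext => j; rewrite ffunE inordK // ltnS lower_le.
rewrite (bigD1 k0) //= [X in _ = _ + X]big1 ?addr0; last first.
  move=> kk ne; apply: (shuffle_component_degree hE' hG) => ek _; case/eqP: ne.
  by apply/ffunP => j; apply: val_inj; rewrite /= (congr1 (@^~ j) ek) (congr1 (@^~ j) ek0).
rewrite ek0 (shuffle_componentE t q_neq0 km rE' (zpow_represents (a + M) D)).
rewrite (alternate_fraction_sum D c0 hc eS' eS) (leval_zvar rE).
have eC : (C%:R : ratfun K n) = tofrac ((C%:R : K)%:MP) by rewrite !rmorph_nat.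
rewrite -/C eC; apply: tofrac_scale_div; rewrite ?mpolyC_eq0 ?Xall_neq0 //.
  by rewrite scaler_eq0 negb_or c0 Xall_neq0.
rewrite -!scalerAl -scalerAr [_ * _%:MP]mulrC mul_mpolyC -scalerAr !scalerA.
by congr (_ *: _); rewrite /c' -/W; field; rewrite c0.
Qed.

End AppendVariable.

(** * Elements of the kernel ideal come from spherical elements *)

Section SphericalRepresentation.
Context (K : fieldType) (Q : quiver) (q : K) (t : edge Q -> K).
Local Notation I := (vertex Q).
Hypothesis q_neq0 : q != 0.
Hypothesis charK : [pchar K] =i pred0.
Local Notation zc n := (@zcol I n).
Local Notation vdm n := (vandermonde K (zc n) (@zpos I n)).
Local Notation alt n := (@color_alternate K Q #|zindex n| (zc n) (@zpos I n)).
Implicit Type n : I -> nat.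

(** [p] stands for its alternation divided by the Vandermonde product and by a monomial. The
    exponent [D] is held fixed so that representations can be added. *)
Definition spherical_rep n (p : {mpoly K[#|zindex n|]}) D := exists E S,
  [/\ spherical_subalgebra q t E, homogeneous n E, represents E S D & vdm n * S = alt n p].

Lemma spherical_repD n p p' D :
  @spherical_rep n p D -> @spherical_rep n p' D -> spherical_rep (p + p') D.
Proof.
move=> [E [S [gE hE rE eS]]] [E' [S' [gE' hE' rE' eS']]].
exists (E + E'), (S + S'); split.
- exact: gen_add.
- by move=> m k x ne; rewrite levalD hE // hE' // addr0.
- by move=> m x hx; rewrite levalD rE // rE' // rmorphD /= mulrDl.
- by rewrite mulrDr eS eS' color_alternateD.
Qed.

Lemma spherical_rep_alternateZ n p p' c D : alt n p' = c *: alt n p ->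
  @spherical_rep n p D -> spherical_rep p' D.
Proof.
move=> e [E [S [gE hE rE eS]]]; exists (c *: E), (c *: S); split.
- exact: gen_scale.
- by move=> m k x ne; rewrite levalZ hE // mulr0.
- by move=> m x hx; rewrite levalZ rE // evZ mulrA.
- by rewrite -scalerAr eS e.
Qed.

Lemma spherical_rep0 n D : spherical_rep (0 : {mpoly K[#|zindex n|]}) D.
Proof.
exists (0 *: << [ffun=> [::]] >>), 0; split.
- exact/gen_scale/gen_one.
- by move=> m k x ne; rewrite levalZ rmorph0 mul0r.
- by move=> m x hx; rewrite levalZ !rmorph0 !mul0r.
- by rewrite mulr0 color_alternate0.
Qed.

Lemma spherical_rep_perm n p D s : color_perm (zc n) s ->
  @spherical_rep n p D -> spherical_rep (permv s p) D.
Proof.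
move=> cs; apply: spherical_rep_alternateZ.
exact: (color_alternate_perm (@zindex_inj I n)).
Qed.

Lemma mpoly_no_var N (P : {mpoly K[N]}) : N = 0%N -> exists c, P = c%:MP.
Proof.
move=> N0; elim/mpoly_ring_ind: P => [c|j|P P' [c ->] [c' ->]|P P' [c ->] [c' ->]].
- by exists c.
- by case: j => j; rewrite N0.
- by exists (c + c'); rewrite mpolyCD.
- by exists (c * c'); rewrite mpolyCM.
Qed.

Lemma spherical_rep_empty n p D : #|zindex n| = 0%N -> @spherical_rep n p D.
Proof.
move=> n0; have [S [eS _]] := color_alternate_divides (@zindex_inj I n) charK p.
have [c cS] := mpoly_no_var S n0.
have ni j : n j = 0%N.
  apply/eqP; rewrite -leqn0 leqNgt; apply/negP => h; have [x _] := zord_ex h.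
  by have := ltn_ord x; rewrite [X in (_ < X)%N]n0.
exists (c *: << [ffun=> [::]] >>), S; split=> //.
- exact/gen_scale/gen_one.
- move=> m k x ne; rewrite levalZ levalU; case: forallP => [h|_]; last by rewrite mulr0.
  by case: ne; apply: boolp.funext => j; have := h j; rewrite ffunE ni => /eqP.
- move=> m x hx; rewrite levalZ levalU ifT; last first.
    by apply/forallP => j; rewrite ffunE ni.
  rewrite rmorphXn /= ev_Xall cS evC /laurent_monomial.
  rewrite [X in _ / X ^+ _]big1 => [|j _]; last by rewrite ni big_ord0.
  by rewrite big1 ?expr1n ?divr1 ?mulr1 // => j _; rewrite ni big_ord0.
Qed.

Section TopVariable.
Context (n : I -> nat) (i : I).
Hypothesis ni : (0 < n i)%N.
Local Notation k := (lower n i).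
Local Notation km := (lower_le n i).
Local Notation l := (fun j => n j - lower n i j)%N.
Local Notation e1 := (emb1 km).
Local Notation e2 := (@emb2 Q n k).
Context (y : 'I_#|zindex l|).
Local Notation top := (e2 y).

Lemma card_lower : (#|zindex k| < #|zindex n|)%N.
Proof.
pose f (o : option 'I_#|zindex k|) : 'I_#|zindex n| := if o is Some x then e1 x else top.
have f_inj : injective f.
  case=> [x|] [x'|] //=; first by move/emb1_inj ->.
    by move/eqP; rewrite (negbTE (emb12_neq km _ _)).
  by move/esym/eqP; rewrite (negbTE (emb12_neq km _ _)).
by have := leq_card f f_inj; rewrite card_option !card_ord.
Qed.

(** By linearity [h] may be a monomial; it splits into a monomial in the other variables and a power
    of the last one, while [ordered_kernel_top] splits the kernel. *)
Lemma spherical_rep_top key D : injective key -> (forall x, key (e1 x) < key top)%N ->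
  (forall h, spherical_rep (h * ordered_kernel q t (zc k) (key \o e1)) D) ->
  forall h, spherical_rep (h * ordered_kernel q t (zc n) key) D.
Proof.
move=> ik kt IH; elim/mpolyind => [|c u h _ _ IHh].
  rewrite mul0r; exact: spherical_rep0.
rewrite mulrDl; apply: spherical_repD IHh.
apply: (spherical_rep_alternateZ (p := 'X_[u] * ordered_kernel q t (zc n) key) (c := c)).
  by rewrite -scalerAl color_alternateZ.
pose u' := [multinom u (e1 x) | x < #|zindex k|].
have [E' [S' [gE hE rE eS]]] := IH 'X_[u'].
have -> : 'X_[u] * ordered_kernel q t (zc n) key =
    shuffle_num q t km ('X_[u'] * ordered_kernel q t (zc k) (key \o e1))
      (var_prod K #|zindex l| ^+ u top).
  rewrite (ordered_kernel_top q t ni kt) /shuffle_num rmorphM /= inc2_Xall (prod_last ni _ y).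
  have -> : @inc1 K Q n k km 'X_[u'] = \prod_x 'X_(e1 x) ^+ u (e1 x).
    by rewrite mpolyXE_id rmorph_prod; apply: eq_bigr => x _; rewrite rmorphXn /= inc1X mnmE.
  rewrite mpolyXE_id (prod_cover km (fun z => 'X_z ^+ u z)) (prod_last ni _ y).
  by rewrite mulrACA mulrA.
have [E [S [? ? ? ?]]] := append_variable q_neq0 charK ni y (u top) gE hE rE eS.
by exists E, S.
Qed.

End TopVariable.

(** Induction on the number of variables. A permutation changes the alternation only by a sign, so
    the variable of largest key may be moved to the last position at its vertex and split off. *)
Lemma spherical_rep_kernel n key h D : injective key ->
  spherical_rep (h * ordered_kernel q t (zc n) key) D.
Proof.
have [N] := ubnP #|zindex n|; elim: N n key h => // N IH n key h hN ik.
have [n0|] := posnP #|zindex n|; first exact: spherical_rep_empty.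
move=> n0; pose v := [arg max_(v > Ordinal n0) key v]%N.
have vmax w : (key w <= key v)%N by rewrite /v; case: arg_maxnP => // v' _; apply.
have ni : (0 < n (zcol v))%N by apply: leq_ltn_trans (zpos_lt v).
have [y _] := last_ex ni.
set top := emb2 y; pose s := tperm v top.
have cs : color_perm (zc n) s by apply: color_tperm; rewrite (top_col ni).
have -> : h * ordered_kernel q t (zc n) key =
    permv s (permv s h * ordered_kernel q t (zc n) (key \o s)).
  rewrite rmorphM /= -permvM /s tperm2 permv1 (permv_ordered_kernel _ _ _ cs).
  congr (_ * _); rewrite /ordered_kernel; apply: eq_bigl => ab /=.
  by rewrite !permKV.
apply: spherical_rep_perm cs _.
apply: (spherical_rep_top ni (y := y)).
- by move=> a b /= /ik/perm_inj.
- move=> x /=; rewrite /s tpermR ltn_neqAle vmax andbT.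
  rewrite (inj_eq ik); apply: contraNneq (emb12_neq (lower_le n _) x y) => e.
  by apply/eqP/(@perm_inj _ s); rewrite [RHS]tpermR.
- move=> h'; apply: IH.
    exact: leq_trans (card_lower y) _.
  by move=> a b /= /ik/perm_inj/emb1_inj.
Qed.

Lemma spherical_rep_ideal n p D : kernel_ideal q t (zc n) p -> spherical_rep p D.
Proof.
elim=> [|key P F ik _ IH]; first exact: spherical_rep0.
exact/spherical_repD/IH/spherical_rep_kernel.
Qed.

End SphericalRepresentation.

Lemma leval_inj (K : fieldType) (Q : quiver) (F : laurent K (vertex Q)) :
  (forall n, leval n F (@zvar K (vertex Q) n) = 0) -> F = 0.
Proof.
move=> F0; rewrite -(freeg_sumE F) big_seq big1 // => e he.
pose n i := size (e i); have := F0 n.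
rewrite (leval_zvar (represents_laurent_num (k := n) F)) => /eqP.
rewrite mulf_eq0 invr_eq0 !tofrac_eq0 (negbTE (Xall_neq0 _ _ _)) orbF => /eqP P0.
by rewrite -(mcoeff_laurent_num (k := n) he) // P0 mcoeff0 freegU0.
Qed.

(** * Comparison of the two algebras *)

Section Membership.
Context (K : fieldType) (Q : quiver) (q : K) (t : edge Q -> K).
Local Notation I := (vertex Q).
Hypothesis q_neq0 : q != 0.
Hypothesis t_neq0 : forall e, t e != 0.
Hypothesis charK : [pchar K] =i pred0.

Section Spherical.
Hypothesis q_neq1 : q != 1.
Hypothesis w_neq1 : forall h, hweight q t h != 1.
Hypothesis w_neqq : forall h, hweight q t h != q.

(** With at most one variable at each vertex there is nothing to permute and no second variable to
    specialize. *)
Lemma small_shuffle (e : {ffun I -> seq int}) : (forall i, (size (e i) <= 1)%N) ->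
  shuffle_algebra q t << e >>.
Proof.
move=> se; split=> [n s|n i j a nj _ _].
  have small (h : [forall i, size (e i) == n i]) i (b c : 'I_(n i)) : b = c.
    have b0 (d : 'I_(n i)) : d = 0%N :> nat.
      by apply/eqP; rewrite -leqn0 -ltnS (leq_trans (ltn_ord d)) // -(eqP (forallP h i)).
    by apply: val_inj; rewrite /= !b0.
  case h : [forall i, size (e i) == n i].
    have [s' ->] : exists s' : var_perm n, zvar K n = zperm K s' by eexists.
    have -> : zperm K s = zperm K s'.
      apply: boolp.funext => i; apply: boolp.funext => b.
      rewrite /zperm; case: insubP => // b' _ _.
      by rewrite (small h i (s i b') (s' i b')).
    reflexivity.
  rewrite levalU h.
  rewrite levalU h.
  reflexivity.
exists 0; rewrite [leval n 0 _]leval0 mulr0 levalU ifF //.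
apply/negP => /forallP/(_ j)/eqP h.
by have := se j; rewrite h leqNgt nj.
Qed.

Lemma spherical_sub_shuffle F : spherical_subalgebra q t F -> shuffle_algebra q t F.
Proof.
elim=> [{}F [i [d ->]]||F1 F2 _ [s1 w1] _ [s2 w2]|c F1 _ [s1 w1]|F1 F2 P _ h1 _ h2 hP].
- by apply: small_shuffle => j; rewrite ffunE; case: ifP.
- by apply: small_shuffle => j; rewrite ffunE.
- split=> [n s|n i j a hj hi nij]; first by rewrite !levalD s1 s2.
  have [H1 e1] := w1 n i j a hj hi nij; have [H2 e2] := w2 n i j a hj hi nij.
  by exists (H1 + H2); rewrite !levalD e1 e2 mulrDr.
- split=> [n s|n i j a hj hi nij]; first by rewrite !levalZ s1.
  have [H1 e1] := w1 n i j a hj hi nij.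
  by exists (c *: H1); rewrite !levalZ e1 mulrCA.
- exact: shuffle_product_closed hP.
Qed.

End Spherical.

Context (R : realFieldType) (nu : K -> R).
Hypothesis nuM : forall x y, nu (x * y) = nu x * nu y.
Hypothesis nu_gt0 : forall x, x != 0 -> 0 < nu x.
Hypothesis nuq_lt1 : nu q < 1.
Hypothesis nu_t : forall e, nu q < nu (t e) < 1.

(** V P is antisymmetric and inherits the wheel conditions, so a monomial multiple of it is in the
    ideal. As alternation multiplies that element by the number of permutations, V cancels and P is
    recovered. *)
Lemma spherical_component F n : shuffle_algebra q t F -> exists E,
  [/\ spherical_subalgebra q t E, homogeneous n E &
      leval n E (@zvar K I n) = leval n F (@zvar K I n)].
Proof.
move=> [sF wF]; have [P [d r]] := represents_ex n F.
have sP := symmetric_represents r sF; have wP := wheel_in_wheel q_neq0 t_neq0 r sP wF.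
pose zc := @zcol I n; have posn := @zindex_inj I n.
pose V := vandermonde K zc (@zpos I n); pose X := var_prod K #|zindex n|.
have antiV s : color_perm zc s -> permv s (V * P) = vsign K zc (@zpos I n) s *: (V * P).
  by move=> cs; rewrite rmorphM /= sP // (vsignP K posn cs) scalerAl.
have [d' hd] := wheel_kernel_ideal nuM nu_gt0 q_neq0 t_neq0 nuq_lt1 nu_t charK
  (vsignM K posn) (fun s cs => vsign_sqr K _ cs) (vsign_tperm posn charK)
  (in_wheelM V wP) antiV.
(* In the exponent, [d'] undoes the monomial that brings V P into the ideal, and [d] is the
   denominator of [F]. *)
have [E [S [gE hE rE eS]]] := spherical_rep_ideal q_neq0 charK (d' + d) hd.
pose w : K := #|[pred s | color_perm zc s]|%:R.
have w0 : w != 0.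
  rewrite /w (proj1 (pcharf0P K) charK) -lt0n; apply/card_gt0P; exists 1%g.
  by rewrite inE color_perm1.
have ES : S = w *: (X ^+ d' * P).
  apply: (mulfI (vandermonde_neq0 K zc (@zpos I n))).
  rewrite eS /color_alternate (eq_bigr (fun=> X ^+ d' * (V * P))) => [|s cs]; last first.
    by rewrite rmorphM /= permv_Xall antiV // -scalerAr scalerA (vsign_sqr K _ cs) scale1r.
  by rewrite sumr_const -scaler_nat -scalerAr mulrCA.
exists (w^-1 *: E); split.
- exact: gen_scale.
- by move=> m k x ne; rewrite levalZ hE // mulr0.
rewrite levalZ (leval_zvar rE) (leval_zvar r) mulrA /ratC -rmorphM mul_mpolyC.
rewrite ES scalerA mulVf // scale1r; apply: tofrac_cross; rewrite ?Xall_neq0 //.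
by rewrite exprD mulrAC [RHS]mulrC.
Qed.

(** Only finitely many degrees occur in the support, so the components can be summed; equality with
    [F] is tested at the generic points. *)
Lemma shuffle_sub_spherical F : shuffle_algebra q t F -> spherical_subalgebra q t F.
Proof.
move=> sF; pose deg (e : {ffun I -> seq int}) := [ffun i => size (e i)].
have part (r : seq {ffun I -> nat}) : uniq r -> exists2 E, spherical_subalgebra q t E &
    forall n : {ffun I -> nat}, leval n E (@zvar K I n) =
      if n \in r then leval n F (@zvar K I n) else 0.
  elim: r => [_|n0 r IH /= /andP[n0r /IH[E gE hE]]].
    exists (0 *: << [ffun=> [::]] >>); first exact/gen_scale/gen_one.
    by move=> n; rewrite levalZ rmorph0 mul0r.
  have [E0 [gE0 hE0 eE0]] := spherical_component n0 sF.
  exists (E0 + E); first exact: gen_add.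
  move=> n; rewrite levalD hE inE; case: eqP => [->|ne].
    by rewrite (negbTE n0r) addr0 eE0.
  rewrite hE0 ?add0r // => e; apply: ne; apply/ffunP => i; by rewrite e.
have [E gE hE] := part _ (undup_uniq (map deg (dom F))).
suff -> : F = E by [].
apply/eqP; rewrite -subr_eq0; apply/eqP/leval_inj => n0.
pose n : {ffun I -> nat} := finfun n0.
have -> : n0 = n by apply: boolp.funext => i; rewrite ffunE.
rewrite -scaleN1r levalD levalZ hE; case: ifP => [_|].
  by rewrite rmorphN1 mulN1r subrr.
rewrite mulr0 addr0 mem_undup => /negP nF; rewrite /leval big_seq_cond big1 // => e.
move=> /andP[he /forallP se]; case: nF; apply/mapP; exists e => //.
by apply/ffunP => i; rewrite [deg e i]ffunE (eqP (se i)).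
Qed.

End Membership.

Theorem theorem1p4 (R : realType) (Q : quiver) (K : fieldType)
    (charK : [pchar K] =i pred0)
    (q : K) (t : edge Q -> K)
    (q_neq0 : q != 0) (t_neq0 : forall e, t e != 0)
    (hrho : exists rho : {rmorphism K -> R[i]},
      `|rho q| < 1 /\ (forall e, `|rho q| < `|rho (t e)| < 1)) :
  forall F : laurent K (vertex Q),
    spherical_subalgebra q t F <-> shuffle_algebra q t F.
Proof.
(* Norms in [R[i]] are themselves elements of [R[i]]; taking the real part makes [nu]
   real-valued. *)
have [rho [hq ht]] := hrho; pose nu c : R := complex.Re `|rho c|.
have nuE c : `|rho c| = (nu c)%:C%C by rewrite /nu normc_def.
have nuM x y : nu (x * y) = nu x * nu y.
  by apply: complexI; rewrite rmorphM /= -!nuE rmorphM normrM.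
have nu_gt0 x : x != 0 -> 0 < nu x.
  by move=> x0; rewrite -ltcR -nuE normr_gt0 fmorph_eq0.
have nuq : nu q < 1 by rewrite -ltcR -nuE.
have nut e : nu q < nu (t e) < 1 by rewrite -!ltcR -!nuE.
have nu1 : nu 1 = 1 by rewrite /nu rmorph1 normr1.
have nuw h := nu_hweight nuM nu_gt0 q_neq0 t_neq0 nut h.
move=> F; split.
  (* Comparing moduli gives the inequations under which the discriminant can be cancelled in the
     wheel conditions. *)
  apply: spherical_sub_shuffle => // [|h|h].
  - by apply: contraTneq nuq => ->; rewrite nu1 ltxx.
  - by apply: contraTneq (nuw h) => ->; rewrite nu1 ltxx andbF.
  - by apply: contraTneq (nuw h) => ->; rewrite ltxx.
exact: (shuffle_sub_spherical q_neq0 t_neq0 charK nuM nu_gt0 nuq nut).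
Qed.
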